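(* Let $M$ be a simply connected hyperkähler manifold with twistor space $\mathcal{Z}$, and let $j\ge1$. A valence $(0,2j)$ Killing tensor $\mu_{A'_1\cdots A'_{2j}}$ on $M$ gives rise to a global section of $T_F\mathcal{Z}\otimes\pi^*\mathcal{O}(2j-2)$ over $\mathcal{Z}$, represented over $\zeta\in\mathbb{C}^\times$ by $X(\zeta)=\sum_{n=1-j}^{j-1}X_n\zeta^{-n}$, whose fiberwise Lie derivative preserves the symplectic form induced on each fiber by the canonical holomorphic 2-form of $\mathcal{Z}$, $$\mathcal{L}_{X(\zeta)}\omega(\zeta)=0,$$ and for which the holomorphic section of $\pi^*\mathcal{O}(2j)$ represented by $\mu(\zeta)=\sum_{n=-j}^{j}\mu_n\zeta^{-n}$, whose coefficients $\mu_n$ (the components of the Killing tensor) form a bounded recursive chain of hyperpotentials with respect to $I_0$, plays on each fiber the role of Hamiltonian function: $$\iota_{X(\zeta)}\omega(\zeta)=d\mu(\zeta).$$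
   Context: $M$ is a hyperkähler manifold of real dimension $4m$, with metric $g$, complex structures $I_1,I_2,I_3$ with $I_1^2=I_2^2=I_3^2=I_1I_2I_3=-1$, and symplectic forms $\omega_k(X,Y)=g(X,I_kY)$. Endomorphisms act on 1-forms from the right. Put $I_+=\tfrac12(I_1+iI_2)$, $I_0=I_3$, $I_-=-\tfrac12(I_1-iI_2)$, $\omega_+=\tfrac12(\omega_1+i\omega_2)$, $\omega_0=\omega_3$, $\omega_-=-\tfrac12(\omega_1-i\omega_2)$. For $\mathbf{u}=(x_1,x_2,x_3)\in S^2\cong\mathbb{CP}^1$, $I(\mathbf{u})=\sum x_kI_k$, with complex coordinate $\zeta=-\frac{x_1+ix_2}{1+x_3}$ ($\zeta=0$ labels $I_0$). Twistor space: $\mathcal{Z}=M\times S^2$ with complex structure $I(\mathbf{u})\oplus I_{\mathbb{CP}^1}$ at $(x,\mathbf{u})$, holomorphic projection $\pi:\mathcal{Z}\to\mathbb{CP}^1$, and $T_F\mathcal{Z}=\ker d\pi$ the holomorphic tangent bundle along the fibers. It carries a canonical global holomorphic section of $\Lambda^2T_F^*\otimes\pi^*\mathcal{O}(2)$, given over $\zeta\in\mathbb{C}^\times$ by $\omega(\zeta)=\frac{\omega_+}{\zeta}+\omega_0+\zeta\omega_-$, inducing a complex symplectic form on each fiber. Sections of $\pi^*\mathcal{O}(2k)$-twisted bundles are represented over $\zeta\in\mathbb{C}^\times$ in the analogous symmetric trivialization (powers $\zeta^{-k},\dots,\zeta^{k}$). $d$, $\iota$ and $\mathcal{L}$ are taken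 along the fibers ($\cong M$) at fixed $\zeta$. $E\otimes H$ formalism: $T_{\mathbb{C}}M=E\otimes H$, with $E$, $H$ of ranks $2m$, $2$ associated to the standard representations of $Sp(m)$, $Sp(1)$; the Levi-Civita connection $\nabla$ preserves the splitting and $H$ is flat, hence (as $M$ is simply connected) trivial with a global parallel frame. Indices $A,B,\dots$ for $E$ and $A',B',\dots\in\{0',1'\}$ for $H$ are raised and lowered with parallel symplectic forms: $\xi_B=\xi^A\varepsilon_{AB}$, $\xi^A=\varepsilon^{AB}\xi_B$ (likewise primed); $g_{AA',BB'}=\varepsilon_{AB}\varepsilon_{A'B'}$ and $(I_k)^{AA'}{}_{BB'}=-i(\sigma_k)^{A'}{}_{B'}\delta^A{}_B$. A parallel frame of $H$ is used in which $\varepsilon_{0'1'}=1$ and $\sigma_k$ are the standard Pauli matrices. $e^\vee_{AA'}$ is the corresponding (co-vielbein) frame of $T_{\mathbb{C}}M$. Round brackets denote symmetrization. A valence $(0,2j)$ Killing tensor is a totally symmetric section $\mu_{A'_1\cdots A'_{2j}}$ of $S^{2j}H$ with $\nabla_{A(A'}\mu_{A'_1\cdots A'_{2j})}=0$. Then $\nabla^A{}_{A'}\mu_{A'_1\cdots A'_{2j}}=-i\,\varepsilon_{A'(A'_1}X^A{}_{A'_2\cdots A'_{2j})}$ with $X^A{}_{A'_2\cdots A'_{2j}}=-i\frac{2j}{2j+1}\nabla^{AA'_1}\mu_{A'_1\cdots A'_{2j}}$. Put $X_{A'_1\cdots A'_{2j-2}}=X^{AA'}{}_{A'_1\cdots A'_{2j-2}}e^\vee_{AA'}$.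 Components: $\mu_n=(-1)^n\binom{2j}{j+n}\mu_{0'\cdots0'1'\cdots1'}$ ($j+n$ indices $0'$, $j-n$ indices $1'$), and $X_n=(-1)^n\binom{2j-2}{j-1+n}X_{0'\cdots0'1'\cdots1'}$ ($j-1+n$ indices $0'$, $j-1-n$ indices $1'$). A recursive chain of hyperpotentials with respect to $I_0$ is a sequence $(\phi_n)_{n\in\mathbb{Z}}$ of functions with $d\phi_{n-1}I_++d\phi_nI_0+d\phi_{n+1}I_-=0$ for all $n$ on a common non-trivial domain; bounded means only finitely many are non-zero. *)

(* Defs.v *)
From HB Require Import structures.
From mathcomp Require Import all_boot all_order all_algebra all_fingroup.
From mathcomp Require Import complex.
From mathcomp Require Import all_classical all_reals all_analysis.
From mathcomp Require Import ring lra.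

Set Implicit Arguments.
Unset Strict Implicit.
Unset Printing Implicit Defensive.

Import Order.TTheory GRing.Theory Num.Theory.
Import numFieldNormedType.Exports.

Local Open Scope classical_set_scope.
Local Open Scope ring_scope.
Local Open Scope complex_scope.

Section Smooth.
Variables (R : realType) (V W : normedModType R).

(* All the iterated directional derivatives exist and are continuous on U; V is
   finite-dimensional and U is open in every use. *)
Fixpoint Ck_on (k : nat) (U : set V) (f : V -> W) : Prop :=
  (forall x, U x -> {for x, continuous f}) /\
  (if k is k'.+1 then
     forall v, (forall x, U x -> derivable f x v) /\
               Ck_on k' U (fun x => 'D_v f x)
   else True).

Definition smooth_on (U : set V) (f : V -> W) : Prop :=
  forall k, Ck_on k U f.

End Smooth.

Section ComplexValued.
Variables (R : realType) (V : normedModType R).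

Definition csmooth_on (U : set V) (f : V -> R[i]) : Prop :=
  smooth_on U (fun x => complex.Re (f x) : R^o) /\
  smooth_on U (fun x => complex.Im (f x) : R^o).

Definition cD (v : V) (f : V -> R[i]) (x : V) : R[i] :=
  ('D_v (fun x => complex.Re (f x) : R^o) x) +i*
  ('D_v (fun x => complex.Im (f x) : R^o) x).

Definition csmooth_mx_on p q (U : set V) (F : V -> 'M[R[i]]_(p, q)) : Prop :=
  forall i k, csmooth_on U (fun x => F x i k).

End ComplexValued.

Section Topology.
Variables (R : realType) (M : topologicalType).

Definition is_path (c : R -> M) : Prop := {within `[0, 1], continuous c}.

Definition simply_connected : Prop :=
  [/\ inhabited M,
      forall x y : M, exists c, [/\ is_path c, c 0 = x & c 1 = y] &
      forall c, is_path c -> c 0 = c 1 ->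
        exists H : R * R -> M,
          [/\ {within (`[0, 1] `*` `[0, 1]), continuous H},
              forall t, 0 <= t <= 1 -> H (t, 0) = c t,
              forall t, 0 <= t <= 1 -> H (t, 1) = c 0,
              forall s, 0 <= s <= 1 -> H (0, s) = c 0 &
              forall s, 0 <= s <= 1 -> H (1, s) = c 0]].

End Topology.

(* The functions crd a and crd_inv a are total; only their values on dom a and
   on its image are meaningful. *)
Record smooth_atlas (R : realType) (n : nat) (M : topologicalType) :=
  SmoothAtlas {
    chart : Type;
    dom : chart -> set M;
    crd : chart -> M -> 'cV[R]_n;
    crd_inv : chart -> 'cV[R]_n -> M;
    dom_open : forall a, open (dom a);
    dom_cover : forall x, exists a, dom a x;
    img_open : forall a, open (crd a @` dom a);
    crdK : forall a x, dom a x -> crd_inv a (crd a x) = x;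
    crd_continuous : forall a x, dom a x -> {for x, continuous (crd a)};
    crd_inv_continuous : forall a y, (crd a @` dom a) y ->
      {for y, continuous (crd_inv a)};
    crd_smooth : forall a b,
      smooth_on (crd a @` (dom a `&` dom b)) (crd b \o crd_inv a)
  }.

Section Fields.
Variables (R : realType) (n : nat) (M : topologicalType).
Variable A : smooth_atlas R n M.

Definition img (a : chart A) : set 'cV[R]_n := crd a @` dom a.

Definition overlap (a b : chart A) : set 'cV[R]_n :=
  crd a @` (dom a `&` dom b).

Definition trans (a b : chart A) : 'cV[R]_n -> 'cV[R]_n := crd b \o crd_inv a.

Definition jac (a b : chart A) (y : 'cV[R]_n) : 'M[R]_n :=
  \matrix_(i, k) ('D_(delta_mx k 0) (fun x => trans a b x i 0 : R^o) y).

Definition cmx p q (B : 'M[R]_(p, q)) : 'M[R[i]]_(p, q) :=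
  map_mx (real_complex R) B.

(* Tensor fields are families of component functions, one for each chart, as
   functions of the coordinates.  Tangent vectors are columns and covectors are
   rows, so that endomorphisms act on the former from the left and on the
   latter from the right.  A 2-form B has the value v^T *m B *m w on (v, w). *)
Definition real_mx_field : Type := chart A -> 'cV[R]_n -> 'M[R]_n.
Definition mx_field : Type := chart A -> 'cV[R]_n -> 'M[R[i]]_n.
Definition vfield : Type := chart A -> 'cV[R]_n -> 'cV[R[i]]_n.

Definition vfield_compat (X : vfield) : Prop :=
  forall a b y, overlap a b y ->
    X b (trans a b y) = cmx (jac a b y) *m X a y.

Definition csmooth_fun_on (U : set M) (f : M -> R[i]) : Prop :=
  forall a : chart A, csmooth_on (crd a @` (dom a `&` U)) (f \o crd_inv a).

Definition dfun (f : M -> R[i]) (a : chart A) (y : 'cV[R]_n) : 'rV[R[i]]_n :=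
  \row_k cD (delta_mx k 0) (f \o crd_inv a) y.

Definition interior_prod (X : vfield) (B : mx_field) (a : chart A) (y : 'cV[R]_n) :
    'rV[R[i]]_n := (X a y)^T *m B a y.

Definition lie_form (X : vfield) (B : mx_field) (a : chart A) (y : 'cV[R]_n) :
    'M[R[i]]_n :=
  \matrix_(p, q) \sum_k
    (X a y k 0 * cD (delta_mx k 0) (fun x => B a x p q) y
     + cD (delta_mx p 0) (fun x => X a x k 0) y * B a y k q
     + cD (delta_mx q 0) (fun x => X a x k 0) y * B a y p k).

End Fields.

Section LeviCivita.
Variables (R : realType) (n : nat).

Definition pd (k : 'I_n) (f : 'cV[R]_n -> R) (y : 'cV[R]_n) : R :=
  'D_(delta_mx k 0) (f : 'cV[R]_n -> R^o) y.

(* Levi-Civita connection of G *)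
Definition christoffel (G : 'cV[R]_n -> 'M[R]_n) (y : 'cV[R]_n)
    (k i l : 'I_n) : R :=
  2^-1 * \sum_q invmx (G y) k q *
    (pd i (fun x => G x l q) y + pd l (fun x => G x i q) y
     - pd q (fun x => G x i l) y).

Definition nabla_endo (G K : 'cV[R]_n -> 'M[R]_n) (y : 'cV[R]_n)
    (q i l : 'I_n) : R :=
  pd q (fun x => K x i l) y
  + \sum_p christoffel G y i q p * K y p l
  - \sum_p christoffel G y p q l * K y i p.

End LeviCivita.

Record hyperkahler (R : realType) (m : nat) (M : topologicalType)
    (A : smooth_atlas R (4 * m) M) := Hyperkahler {
  met : real_mx_field A;
  cpx : 'I_3 -> real_mx_field A;
  met_smooth : forall a i k, smooth_on (img a) (fun y => met a y i k : R^o);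
  met_compat : forall a b y, overlap a b y ->
    met a y = (jac a b y)^T *m met b (trans a b y) *m jac a b y;
  met_sym : forall a y, img a y -> (met a y)^T = met a y;
  met_pos : forall a y, img a y ->
    forall v : 'cV[R]_(4 * m), v != 0 -> 0 < (v^T *m met a y *m v) 0 0;
  cpx_smooth : forall r a i k,
    smooth_on (img a) (fun y => cpx r a y i k : R^o);
  cpx_compat : forall r a b y, overlap a b y ->
    cpx r b (trans a b y) *m jac a b y = jac a b y *m cpx r a y;
  cpx_sqr : forall r a y, img a y -> cpx r a y *m cpx r a y = - 1%:M;
  cpx_mul : forall a y, img a y ->
    cpx 0 a y *m cpx 1 a y *m cpx 2 a y = - 1%:M;
  cpx_orth : forall r a y, img a y ->
    (cpx r a y)^T *m met a y *m cpx r a y = met a y;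
  cpx_parallel : forall r a y, img a y ->
    forall q i l, nabla_endo (met a) (cpx r a) y q i l = 0
}.

Section HyperkahlerGeometry.
Variables (R : realType) (m : nat) (M : topologicalType).
Variable A : smooth_atlas R (4 * m) M.
Variable hk : hyperkahler A.

Local Notation C := (R[i]).
Local Notation n := (4 * m)%N.
Local Notation "'cI'" := ('i : C) (at level 0).

Definition I_plus : mx_field A := fun a y =>
  2^-1 *: (cmx (cpx hk 0 a y) + cI *: cmx (cpx hk 1 a y)).
Definition I_zero : mx_field A := fun a y => cmx (cpx hk 2 a y).
Definition I_minus : mx_field A := fun a y =>
  - (2^-1 *: (cmx (cpx hk 0 a y) - cI *: cmx (cpx hk 1 a y))).

Definition omega_k (r : 'I_3) : mx_field A := fun a y =>
  cmx (met hk a y *m cpx hk r a y).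
Definition omega_plus : mx_field A := fun a y =>
  2^-1 *: (omega_k 0 a y + cI *: omega_k 1 a y).
Definition omega_zero : mx_field A := omega_k 2.
Definition omega_minus : mx_field A := fun a y =>
  - (2^-1 *: (omega_k 0 a y - cI *: omega_k 1 a y)).

Definition omega (z : C) : mx_field A := fun a y =>
  z^-1 *: omega_plus a y + omega_zero a y + z *: omega_minus a y.

Definition pauli (r : 'I_3) : 'M[C]_2 :=
  if r == 0 then \matrix_(p, q) (p != q)%:R
  else if r == 1 then
    \matrix_(p, q) (if p == q then 0 else if p == 0 then - cI else cI)
  else \matrix_(p, q) (if p == q then (if p == 0 then 1 else -1) else 0).

Definition epsH : 'M[C]_2 :=
  \matrix_(p, q) (if p == q then 0 else if p == 0 then 1 else -1).

(* xi_B = xi^A eps_AB and xi^A = eps^AB xi_B force eps^AB eps_CB = delta^A_C. *)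
Definition eps_up d (eps : 'M[C]_d) : 'M[C]_d := invmx eps^T.

(* A frame e_AA' of the complexified tangent space at the point with
   coordinates y in the chart a which is the product of a frame of E, with
   respect to which the symplectic form of E has the matrix epsE, and of the
   fixed parallel frame of H.  The index 0 (resp. 1) of 'I_2 stands for 0'
   (resp. 1'). *)
Record frame := Frame {
  vec : 'I_(2 * m) -> 'I_2 -> 'cV[C]_n;
  epsE : 'M[C]_(2 * m)
}.

Definition adapted (a : chart A) (y : 'cV[R]_n) (e : frame) : Prop :=
  [/\ epsE e \in unitmx,
      (epsE e)^T = - epsE e,
      forall v : 'cV[C]_n, exists c : 'I_(2 * m) -> 'I_2 -> C,
        v = \sum_B \sum_B' c B B' *: vec e B B',
      forall B B' D D',
        ((vec e B B')^T *m cmx (met hk a y) *m vec e D D') 0 0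
        = epsE e B D * epsH B' D' &
      forall r D D',
        cmx (cpx hk r a y) *m vec e D D'
        = \sum_B' (- cI * pauli r B' D') *: vec e D B'].

(* In an adapted frame the I_k have constant components acting on the factor H
   only; as they are parallel, so is the frame of H (which they determine up to
   a sign that can be moved to E).
   A tensor with r lower primed indices, i.e. a section of the r-th tensor power
   of H, is given by its components with respect to the global parallel frame
   of H, as a function of the sequence of its indices; only sequences of size r
   are relevant.  As the frame is parallel, the components of the covariant
   derivative are the derivatives of the components. *)
Definition Htensor : Type := seq 'I_2 -> M -> C.

Definition nabla (a : chart A) (y : 'cV[R]_n) (e : frame)
    (B : 'I_(2 * m)) (B' : 'I_2) (f : M -> C) : C :=
  (dfun f a y *m vec e B B') 0 0.

Definition nabla_up (a : chart A) (y : 'cV[R]_n) (e : frame)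
    (B : 'I_(2 * m)) (B' : 'I_2) (f : M -> C) : C :=
  \sum_D \sum_D' eps_up (epsE e) B D * eps_up epsH B' D' * nabla a y e D D' f.

Definition symmetrize (T : seq 'I_2 -> C) (t : seq 'I_2) : C :=
  ((size t)`!%:R)^-1 *
  \sum_(s : 'S_(size t)) T [seq nth 0 t (s p) | p <- enum 'I_(size t)].

Definition killing_tensor (r : nat) (mu : Htensor) : Prop :=
  [/\ forall t, size t = r -> csmooth_fun_on A setT (mu t),
      forall t s, size t = r -> perm_eq t s -> mu t = mu s &
      forall a y e, img a y -> adapted a y e ->
        forall B t, size t = r.+1 ->
          symmetrize (fun s => nabla a y e B (head 0 s) (mu (behead s))) t = 0].

Section KillingVectors.
Variables (j : nat) (mu : Htensor).

(* X^A_{A'_2 ... A'_{2j}} *)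
Definition killing_X (a : chart A) (y : 'cV[R]_n) (e : frame)
    (B : 'I_(2 * m)) (t : seq 'I_2) : C :=
  - cI * ((2 * j)%:R / (2 * j).+1%:R) *
  \sum_D' nabla_up a y e B D' (mu (D' :: t)).

(* X_{A'_1 ... A'_{2j-2}} computed in the frame e *)
Definition killing_vec_in (a : chart A) (y : 'cV[R]_n) (e : frame)
    (t : seq 'I_2) : 'cV[C]_n :=
  \sum_B \sum_B' (\sum_D' eps_up epsH B' D' * killing_X a y e B (D' :: t))
    *: vec e B B'.

(* The value is the same for all the adapted frames at the given point. *)
Definition killing_vec (t : seq 'I_2) : vfield A := fun a y =>
  xget 0 [set v | exists e, adapted a y e /\ v = killing_vec_in a y e t].

End KillingVectors.

(* For |n| <= k, the component of index n of a tensor with 2k primed indices. *)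
Definition component (V : lmodType C) (k : nat) (T : seq 'I_2 -> V) (l : int)
    : V :=
  if (`|l| <= k)%N then
    ((-1) ^ l * ('C(2 * k, absz (k%:Z + l)))%:R) *:
      T (nseq (absz (k%:Z + l)) 0 ++ nseq (absz (k%:Z - l)) 1)
  else 0.

(* \sum_(-k <= l <= k) c_l z^(-l) *)
Definition laurent (V : lmodType C) (k : nat) (c : int -> V) (z : C) : V :=
  \sum_(p < (2 * k).+1) z ^ (k%:Z - p%:Z) *: c (p%:Z - k%:Z).

Definition mu_comp (j : nat) (mu : Htensor) (l : int) : M -> C := fun x =>
  component (V := C^o) j (fun t => mu t x) l.

Definition mu_of (j : nat) (mu : Htensor) (z : C) : M -> C := fun x =>
  laurent (V := C^o) j (fun l => mu_comp j mu l x) z.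

Definition X_comp (j : nat) (mu : Htensor) (l : int) : vfield A := fun a y =>
  component j.-1 (fun t => killing_vec j mu t a y) l.

Definition X_of (j : nat) (mu : Htensor) (z : C) : vfield A := fun a y =>
  laurent j.-1 (fun l => X_comp j mu l a y) z.

Definition recursive_chain (U : set M) (phi : int -> M -> C) : Prop :=
  [/\ open U, U !=set0, forall l, csmooth_fun_on A U (phi l) &
      forall l (a : chart A) y, (crd a @` (dom a `&` U)) y ->
        dfun (phi (l - 1)) a y *m I_plus a y
        + dfun (phi l) a y *m I_zero a y
        + dfun (phi (l + 1)) a y *m I_minus a y = 0].

Definition bounded_chain (phi : int -> M -> C) : Prop :=
  exists N : nat, forall l, (N < `|l|)%N -> phi l = cst 0.

Definition zeta (u : 'rV[R]_3) : C :=
  - ((u 0 0 +i* u 0 1) / (1 + u 0 2)%:C).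

(* CP^1 = S^2 is covered by two copies of the complex plane, labelled by a
   boolean: sphere_pt false z is the point with zeta = z and sphere_pt true z
   is the point with 1 / zeta = z; see zeta_sphere_pt0 and zeta_sphere_pt1. *)
Definition sphere_pt (b : bool) (z : C) : 'rV[R]_3 :=
  let: p +i* q := z in
  let s := p ^+ 2 + q ^+ 2 in
  (1 + s)^-1 *: \row_(r < 3)
    (if r == 0 then - (2 * p)
     else if r == 1 then (if b then 2 * q else - (2 * q))
     else (if b then s - 1 else 1 - s)).

Definition I_sphere (u : 'rV[R]_3) : real_mx_field A := fun a y =>
  \sum_r u 0 r *: cpx hk r a y.

(* Types of complex tangent vectors with respect to I(u), u = sphere_pt b z. *)
Definition type10 (b : bool) (z : C) (a : chart A) (y : 'cV[R]_n)
    (v : 'cV[C]_n) : Prop :=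
  cmx (I_sphere (sphere_pt b z) a y) *m v = cI *: v.

Definition type01 (b : bool) (z : C) (a : chart A) (y : 'cV[R]_n)
    (v : 'cV[C]_n) : Prop :=
  cmx (I_sphere (sphere_pt b z) a y) *m v = - cI *: v.

Definition proj10 (b : bool) (z : C) (a : chart A) (y : 'cV[R]_n)
    (v : 'cV[C]_n) : 'cV[C]_n :=
  2^-1 *: (v - cI *: (cmx (I_sphere (sphere_pt b z) a y) *m v)).

(* Coordinates on the twistor space: the coordinates y of a chart of M and the
   complex coordinate z = p + i q of one of the two copies of the plane. *)
Local Notation ZR := ('cV[R]_n * (R^o * R^o))%type.

Definition Zimg (a : chart A) : set ZR := [set t | img a t.1].
Definition zc (t : ZR) : C := t.2.1 +i* t.2.2.

Definition D_fiber (v : 'cV[C]_n) (f : ZR -> C) (t : ZR) : C :=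
  \sum_k v k 0 * cD ((delta_mx k 0, (0, 0)) : ZR) f t.

Definition D_zbar (f : ZR -> C) (t : ZR) : C :=
  2^-1 * (cD ((0, (1, 0)) : ZR) f t + cI * cD ((0, (0, 1)) : ZR) f t).

(* A section of pi^* O(2k) (resp. of T_F Z (x) pi^* O(2k)) is given by its
   representatives in the trivializations of O(2k) over the two copies of the
   plane, which are related by the transition function zeta^(2k); it is
   represented by s(zeta) in the symmetric trivialization over C^* when the
   first representative is zeta^k s(zeta). *)
Definition tw_fun : Type := bool -> C -> M -> C.
Definition tw_vfield : Type := bool -> C -> vfield A.

Definition fun_coord (f : tw_fun) (b : bool) (a : chart A) (t : ZR) : C :=
  f b (zc t) (crd_inv a t.1).
Definition vfield_coord (S : tw_vfield) (b : bool) (a : chart A) (t : ZR) :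
    'cV[C]_n := S b (zc t) a t.1.

(* Smooth functions annihilated by the (0,1) vectors of the complex structure
   I(u) (+) I_CP1 *)
Definition holomorphic_fun (f : tw_fun) : Prop :=
  forall b (a : chart A),
    csmooth_on (Zimg a) (fun_coord f b a) /\
    forall t, Zimg a t ->
      (forall w, type01 b (zc t) a t.1 w -> D_fiber w (fun_coord f b a) t = 0)
      /\ D_zbar (fun_coord f b a) t = 0.

Definition holomorphic_section_O (k : nat) (f : tw_fun) : Prop :=
  holomorphic_fun f /\
  forall z x, z != 0 -> f false z x = z ^+ (2 * k) * f true z^-1 x.

(* Component along M of the bracket of the (0,1) vector field
   w + c d/dzbar with the vertical vector field v; its other component is
   - v(c) d/dzbar, which is always of type (0,1). *)
Definition bracket (w : ZR -> 'cV[C]_n) (c : ZR -> C) (v : ZR -> 'cV[C]_n)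
    (t : ZR) : 'cV[C]_n :=
  \col_p (D_fiber (w t) (fun t => v t p 0) t
          + c t * D_zbar (fun t => v t p 0) t
          - D_fiber (v t) (fun t => w t p 0) t).

(* Smooth vertical vector fields of type (1,0) whose brackets with all the local
   vector fields of type (0,1) are of type (0,1) *)
Definition holomorphic_vertical (S : tw_vfield) : Prop :=
  [/\ forall b z, vfield_compat (S b z),
      forall b (a : chart A), csmooth_mx_on (Zimg a) (vfield_coord S b a),
      forall b z (a : chart A) y, img a y -> type10 b z a y (S b z a y) &
      forall b (a : chart A) (O : set ZR) w c,
        open O -> O `<=` Zimg a -> csmooth_mx_on O w -> csmooth_on O c ->
        (forall t, O t -> type01 b (zc t) a t.1 (w t)) ->
        forall t, O t ->
          type01 b (zc t) a t.1 (bracket w c (vfield_coord S b a) t)].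

Definition holomorphic_section_TF (k : nat) (S : tw_vfield) : Prop :=
  holomorphic_vertical S /\
  forall z (a : chart A) y, z != 0 -> img a y ->
    S false z a y = z ^+ (2 * k) *: S true z^-1 a y.

Definition fun_represented (k : nat) (f : tw_fun) (s : C -> M -> C) : Prop :=
  forall z x, z != 0 -> f false z x = z ^+ k * s z x.

(* T_F Z is identified with the quotient of the complexified tangent bundle of
   the fibers by the vectors of type (0,1), hence the projection. *)
Definition vfield_represented (k : nat) (S : tw_vfield) (X : C -> vfield A) :
    Prop :=
  forall z (a : chart A) y, z != 0 -> img a y ->
    S false z a y = z ^+ k *: proj10 false z a y (X z a y).

(* The canonical section of the 2-forms along the fibers twisted by
   pi^* O(2) in the two trivializations: zeta omega(zeta) and
   zeta^-1 omega(zeta), extended to zeta = 0 and to zeta = oo. *)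
Definition tw_omega (b : bool) (z : C) : mx_field A := fun a y =>
  if b then omega_minus a y + z *: omega_zero a y + z ^+ 2 *: omega_plus a y
  else omega_plus a y + z *: omega_zero a y + z ^+ 2 *: omega_minus a y.

End HyperkahlerGeometry.

Section SpherePoints.
Variable R : realType.

Lemma sphere_pt_norm b (z : R[i]) : \sum_r (sphere_pt b z 0 r) ^+ 2 = 1.
Proof.
case: z => p q; rewrite !big_ord_recl big_ord0 /sphere_pt !mxE /=.
have h : 1 + (p ^+ 2 + q ^+ 2) != 0.
  by rewrite gt_eqF// ltr_pwDl// addr_ge0// sqr_ge0.
by case: b => /=; field.
Qed.

Lemma zeta_sphere_pt0 (z : R[i]) : zeta (sphere_pt false z) = z.
Proof.
case: z => p q; rewrite /zeta /sphere_pt !mxE /=.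
have h : 1 + (p ^+ 2 + q ^+ 2) != 0.
  by rewrite gt_eqF// ltr_pwDl// addr_ge0// sqr_ge0.
have e : 1 + (1 + (p ^+ 2 + q ^+ 2))^-1 * (1 - (p ^+ 2 + q ^+ 2)) =
         2 / (1 + (p ^+ 2 + q ^+ 2)) by field.
have e0 : (2 / (1 + (p ^+ 2 + q ^+ 2)))%:C != 0 :> R[i].
  by rewrite fmorph_eq0 mulf_neq0 ?invr_eq0.
rewrite e; apply: (mulIf e0); rewrite mulNr divfK//.
by apply/eqP; rewrite eq_complex /=; apply/andP; split; apply/eqP; field.
Qed.

Lemma zeta_sphere_pt1 (z : R[i]) :
  z != 0 -> (zeta (sphere_pt true z))^-1 = z.
Proof.
case: z => p q z0; rewrite /zeta /sphere_pt !mxE /=.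
have s0 : p ^+ 2 + q ^+ 2 != 0.
  apply: contra z0; rewrite paddr_eq0 ?sqr_ge0// !sqrf_eq0 => /andP[/eqP-> /eqP->].
  by rewrite eq_complex /= !eqxx.
have h : 1 + (p ^+ 2 + q ^+ 2) != 0.
  by rewrite gt_eqF// ltr_pwDl// addr_ge0// sqr_ge0.
have e : 1 + (1 + (p ^+ 2 + q ^+ 2))^-1 * (p ^+ 2 + q ^+ 2 - 1) =
         2 * (p ^+ 2 + q ^+ 2) / (1 + (p ^+ 2 + q ^+ 2)) by field.
set u := (_ +i* _).
have u0 : u != 0.
  apply: contra s0; rewrite /u eq_complex /= !mulf_eq0 invr_eq0 (negPf h) /=.
  rewrite oppr_eq0 !mulf_eq0 pnatr_eq0 /= => /andP[/eqP-> /eqP->].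
  by rewrite !expr0n addr0.
rewrite e invrN invf_div -mulNr; apply: (mulIf u0); rewrite divfK//.
by apply/eqP; rewrite /u eq_complex /=; apply/andP; split; apply/eqP; field.
Qed.

End SpherePoints.

(* Main.v *)
Require Import Defs.
From HB Require Import structures.
From mathcomp Require Import all_boot all_order all_algebra all_fingroup.
From mathcomp Require Import complex.
From mathcomp Require Import all_classical all_reals all_analysis.
From mathcomp Require Import ring lra zify.

Set Implicit Arguments.
Unset Strict Implicit.
Unset Printing Implicit Defensive.

Import Order.TTheory GRing.Theory Num.Theory.
Import numFieldNormedType.Exports.

Local Open Scope classical_set_scope.
Local Open Scope ring_scope.
Local Open Scope complex_scope.

(** Over a point of [M] the complexified tangent space is [E (x) H], and the
    complex structures act on the factor [H] only. In a frame [e_B0], [e_B1]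
    adapted to this decomposition ([adapted_exists]) the Killing equation reads,
    for the components [m_k] of the tensor with [k] indices [0'],

      (k + 1) dm_k(e_B0) + (2j - k) dm_(k+1)(e_B1) = 0,

    so that, for each [B], all these derivatives are multiples of a single
    sequence [P]: [dm_k(e_B0) = (2j - k) P_k] and [dm_(k+1)(e_B1) = - (k + 1) P_k]
    ([killing_potential]). With the binomial factors of the [mu_n] the two
    families coincide, which is the recursive chain ([phi_recursion]).

    The vector [X_t] is the metric dual of the covector
    [- c (dm_k I_+ + dm_(k+1) I_0 + dm_(k+2) I_-)], where [k] is the number of
    indices [0'] of [t] and [c = 2j / (2j + 1)] ([killing_vecE]). This formula
    involves no frame; on [e_B0], [e_B1] the covector takes the values
    [2 i j P_(k+1)], [2 i j P_k]. In homogeneous coordinates [(s, t)] with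
    [zeta = t / s] the canonical 2-form is [Omega = g J] with
    [J = s^2 I_+ + s t I_0 + t^2 I_-], and the Hamiltonian equation
    [i_X Omega = d mu], evaluated on the frame, is Pascal's rule between the
    binomial coefficients of order [2j - 2] in [X] and those of order [2j - 1]
    that differentiation produces from the ones in [mu] ([hamilton_hom]).

    The rest is formal. The Kaehler forms are closed because they are parallel
    ([omega_k_closed]), so Cartan's formula gives [L_X Omega = d d mu = 0]
    ([lie_form_hamiltonian]). The kernel of [Omega] on a fibre consists of the
    vectors of type (0,1) ([tw_omega_ker], a computation with quaternions), hence
    replacing [X] by its part [S] of type (1,0) does not change its contraction
    with [Omega]. A vertical field is therefore holomorphic as soon as its bracket
    with every field [W] of type (0,1) is killed by [Omega], and
    [i_[W,S] Omega = L_W i_S Omega - i_S L_W Omega = d (W mu) = 0], because [Omega]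
    is closed along the fibres, depends holomorphically on [zeta], and [mu] is
    holomorphic ([bracket_kernel]). Homogeneity in [(s, t)] gives the transition
    functions of [O(2j)] and [O(2j - 2)].

    What is needed from analysis is Schwarz' theorem on mixed derivatives and the
    chain rule for functions with continuous directional derivatives; both come
    from the mean value theorem along segments ([schwarz], [chain_rule]). *)

(** * Functions of class C^k *)

Section CkClosure.
Context {R : realType} {V : normedModType R}.
Implicit Types (U : set V) (k : nat).

Lemma Ck_on_le (W : normedModType R) k l U (f : V -> W) :
  (l <= k)%N -> Ck_on k U f -> Ck_on l U f.
Proof.
elim: l k f => [|l IH] [|k] f //= lk; first by case.
case=> fc fd; split=> // v; have [fv dk] := fd v; split=> //.
exact: IH dk.
Qed.

Lemma Ck_on_sub (W : normedModType R) k U U' (f : V -> W) :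
  U' `<=` U -> Ck_on k U f -> Ck_on k U' f.
Proof.
move=> UU; elim: k f => [|k IH] f [fc fd]; split=> //; try by move=> x /UU/fc.
move=> v; have [fv dk] := fd v; split=> [x /UU/fv//|]; exact: IH.
Qed.

(** The derivatives only see the germ of the function, hence the need for an
    open set. *)
Lemma Ck_on_congr (W : normedModType R) k U (f g : V -> W) :
  open U -> (forall x, U x -> f x = g x) -> Ck_on k U f -> Ck_on k U g.
Proof.
move=> oU.
have nr (f' g' : V -> W) x : (forall x, U x -> f' x = g' x) -> U x ->
    \near x, f' x = g' x.
  by move=> fg Ux; near do apply: fg; apply: open_nbhs_nbhs.
have ctr (f' g' : V -> W) x : (forall x, U x -> f' x = g' x) -> U x ->
    {for x, continuous f'} -> {for x, continuous g'}.
  move=> fg Ux fc; rewrite /prop_for /continuous_at -fg//.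
  by apply: cvg_trans fc; apply: near_eq_cvg; exact: nr.
elim: k f g => [|k IH] f g fg [fc fd]; split=> //;
  try by move=> x Ux; exact: ctr fg Ux (fc x Ux).
move=> v; have [fv dk] := fd v; split=> [x Ux|].
    by apply: near_eq_derivable (fv x Ux); exact: nr.
  apply: IH dk => x Ux; apply: near_eq_derive; exact: nr.
Unshelve. all: by end_near. Qed.

Lemma Ck_on_cst (W : normedModType R) k U (c : W) : Ck_on k U (fun _ : V => c).
Proof.
have cc (c' : W) x : {for x, continuous (fun _ : V => c')} by exact: cvg_cst.
elim: k c => [|k IH] c; split=> //; try by move=> x _; exact: cc.
move=> v; split=> [x _|].
  exact: derivable_cst.
have -> : (fun x => 'D_v (fun _ : V => c) x) = (fun _ => 0).
  by apply/funext => x; rewrite derive_cst.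
exact: IH.
Qed.

Lemma Ck_onD k U (f g : V -> R^o) : open U ->
  Ck_on k U f -> Ck_on k U g -> Ck_on k U (fun x => f x + g x : R^o).
Proof.
move=> oU; elim: k f g => [|k IH] f g [fc fd] [gc gd]; split=> //.
- by move=> x Ux; apply: cvgD; [exact: fc|exact: gc].
- by move=> x Ux; apply: cvgD; [exact: fc|exact: gc].
move=> v; have [fv fk] := fd v; have [gv gk] := gd v; split=> [x Ux|].
  by apply: derivableD; [exact: fv|exact: gv].
apply: (Ck_on_congr oU _ (IH _ _ fk gk)) => x Ux.
by rewrite [RHS]deriveD//; [exact: fv|exact: gv].
Qed.

(** Leibniz' rule expresses the derivative of the product by products of
    functions of class [C^k] again; it holds on [U] only, so that the induction
    goes through the congruence lemma. The inverse is treated in the same way. *)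
Lemma Ck_onM k U (f g : V -> R^o) : open U ->
  Ck_on k U f -> Ck_on k U g -> Ck_on k U (fun x => f x * g x : R^o).
Proof.
move=> oU; elim: k f g => [|k IH] f g Cf Cg; move: (Cf) (Cg) => [fc fd] [gc gd]; split=> //.
- by move=> x Ux; apply: cvgM; [exact: fc|exact: gc].
- by move=> x Ux; apply: cvgM; [exact: fc|exact: gc].
move=> v; have [fv fk] := fd v; have [gv gk] := gd v; split=> [x Ux|].
  by apply: derivableM; [exact: fv|exact: gv].
have Cf' := Ck_on_le (leqnSn k) Cf; have Cg' := Ck_on_le (leqnSn k) Cg.
apply: (Ck_on_congr oU _ (Ck_onD oU (IH _ _ Cf' gk) (IH _ _ Cg' fk))) => x Ux.
by rewrite [RHS]deriveM//; [exact: fv|exact: gv].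
Qed.

Lemma Ck_onV k U (f : V -> R^o) : open U -> (forall x, U x -> f x != 0) ->
  Ck_on k U f -> Ck_on k U (fun x => (f x)^-1 : R^o).
Proof.
move=> oU f0; elim: k => [|k IH] Cf; move: (Cf) => [fc fd]; split=> //.
- by move=> x Ux; apply: cvgV; [exact: f0|exact: fc].
- by move=> x Ux; apply: cvgV; [exact: f0|exact: fc].
move=> v; have [fv fk] := fd v; split=> [x Ux|].
  by apply: derivableV; [exact: f0|exact: fv].
have Cf' := IH (Ck_on_le (leqnSn k) Cf).
have Cp := Ck_onM oU (Ck_onM oU (Ck_on_cst k U (-1 : R^o)) (Ck_onM oU Cf' Cf')) fk.
apply: (Ck_on_congr oU _ Cp) => x Ux.
rewrite [RHS]deriveV//; [|exact: f0|exact: fv].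
by rewrite mulN1r -expr2 exprVn.
Qed.

End CkClosure.

(** * Mean value theorem along segments *)

Section Segments.
Context {R : realType} {V : normedModType R}.
Implicit Types f : V -> R^o.

Lemma derivable_line f (x v : V) (t : R) : derivable f (x + t *: v) v ->
  is_derive t 1 (fun s : R => f (x + s *: v) : R^o) ('D_v f (x + t *: v)).
Proof.
move=> fd.
have E : (fun h : R => h^-1 *: (((fun s : R => f (x + s *: v)) \o shift t) (h *: (1:R^o)) - f (x + t *: v))) =
  (fun h => h^-1 *: ((f \o shift (x + t *: v)) (h *: v) - f (x + t *: v))).
  apply/funext => h /=; congr (_ *: (f _ - _)).
  by rewrite [h *: (1:R^o)]mulr1 scalerDl addrCA.
by split; rewrite /derivable /derive E.
Qed.

Lemma MVT_line f (x v : V) (h : R) :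
  (forall t, 0 <= t <= h -> derivable f (x + t *: v) v) -> 0 <= h ->
  exists2 c, 0 <= c <= h &
    f (x + h *: v) - f x = h * 'D_v f (x + c *: v).
Proof.
move=> fd h0.
pose g (s : R) : R^o := f (x + s *: v).
have gd t : t \in `[0, h]%R -> is_derive t 1 g ('D_v f (x + t *: v)).
  by rewrite in_itv/= => /fd; exact: derivable_line.
have gc : {within `[0, h], continuous g}.
  by apply: derivable_within_continuous => t /gd dt; exact: (@ex_derive _ _ _ _ _ _ _ dt).
have gd' t : t \in `]0, h[%R -> is_derive t 1 g ('D_v f (x + t *: v)).
  by move=> th; apply: gd; exact: subset_itv_oo_cc.
have [c] := MVT_segment h0 gd' gc.
rewrite in_itv/= => ch; rewrite /g scale0r addr0 subr0 => ->.
by exists c => //; rewrite mulrC.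
Qed.

Lemma near_parallelogram (U : set V) (x u v : V) : nbhs x U ->
  exists2 d : R, 0 < d & forall s t, `|s| <= d -> `|t| <= d ->
    U (x + s *: u + t *: v).
Proof.
move=> /nbhs_ballP[e/= e0 eU].
pose d := e / 2 / (1 + `|u| + `|v|).
have n0 : 0 < 1 + `|u| + `|v| by rewrite -addrA ltr_pwDl// addr_ge0.
have d0 : 0 < d by rewrite !divr_gt0.
exists d => // s t sd td; apply: eU; rewrite -ball_normE/= -addrA opprD addNKr.
rewrite normrN.
have le1 : `|s *: u + t *: v| <= d * (1 + `|u| + `|v|).
  apply: (le_trans (ler_normD _ _)); rewrite !normrZ.
  have := ler_wpM2r (normr_ge0 u) sd; have := ler_wpM2r (normr_ge0 v) td.
  by rewrite -addrA !mulrDr mulr1; lra.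
apply: (le_lt_trans le1); rewrite /d divfK ?gt_eqF//.
by rewrite ltr_pdivrMr// ltr_pMr// ltr1n.
Qed.

End Segments.

(** * Directional derivatives *)

Section Directional.
Context {R : realType} {V : normedModType R}.
Implicit Types (f : V -> R^o) (U : set V).

Lemma derive_scale f (x v : V) (h : R) : derivable f x v ->
  'D_(h *: v) f x = h * 'D_v f x.
Proof.
move=> fv.
have fv1 : is_derive (h * 0 : R) (1 : R) (fun t : R => f (x + t *: v) : R) ('D_v f x).
  by have := @derivable_line _ _ f x v (h * 0); rewrite mulr0 scale0r addr0; apply.
have h1 : is_derive (0 : R) (1 : R) (fun t : R => h * t : R) h.
  have := @is_deriveZ _ _ _ (id : R -> R^o) h (0 : R) (1 : R) 1 (is_derive_id _ _).
  by rewrite [_ *: (1 : R)]mulr1.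
have := @is_derive1_comp _ _ (fun t => h * t) 0 _ _ fv1 h1.
case=> _; rewrite mulrC => <-; rewrite /derive.
apply: (f_equal (fun g : R -> R^o => lim (g @ (0 : R)^'))).
apply/funext => s /=; rewrite mulr0 scale0r addr0 addr0 [s *: (1 : R)]mulr1.
by rewrite scalerA [x + _]addrC [h * s]mulrC.
Qed.

Lemma growth_at_right f (x v : V) : derivable f x v ->
  s^-1 * (f (x + s *: v) - f x) @[s --> 0^'+] --> ('D_v f x : R).
Proof.
move=> fv.
have {}fv : s^-1 * (f (x + s *: v) - f x) @[s --> (0:R)^'] --> ('D_v f x : R).
  have -> : (fun s => s^-1 * (f (x + s *: v) - f x)) =
     (fun h => h^-1 *: ((f \o shift x) (h *: v) - f x)).
    by apply/funext => s /=; rewrite [_ *: v + x]addrC.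
  exact: fv.
move=> P /fv /nbhs_ballP[_ /posnumP[e] xe]; exists e%:num => //= y xy.
by rewrite lt_def => /andP[y0 _]; exact: xe.
Qed.

(** The difference quotient along [u + v] is the sum of the one along [u] at
    [x] and of the one along [v] at a point close to [x]; the latter is a value
    of the derivative by the mean value theorem. *)
Lemma derive_addv U f (x u v : V) : nbhs x U ->
  derivable f x u -> derivable f x (u + v) ->
  (forall y, U y -> derivable f y v) -> {for x, continuous (fun y => 'D_v f y : R^o)} ->
  'D_(u + v) f x = 'D_u f x + 'D_v f x.
Proof.
move=> xU fu fuv fv cv; apply/eqP; rewrite -subr_eq0 -normr_le0.
apply/ler_addgt0Pr => e e0; rewrite add0r.
have e3 : 0 < e / 3 by rewrite divr_gt0.
have nV : nbhs x [set y | U y /\ `|'D_v f x - 'D_v f y| < e / 3].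
  by apply: filterI => //; have /cvgrPdist_lt := cv; exact.
have [d d0 dU] := near_parallelogram u v nV.
have gu := growth_at_right fu; have guv := growth_at_right fuv.
(* Positive increments suffice: both sides are limits along [s > 0]. *)
near (0 : R)^'+ => s.
have s0 : 0 < s by near: s; exact: nbhs_right_gt.
have sd : s <= d by near: s; exact: nbhs_right_le.
have A1 : `|'D_u f x - s^-1 * (f (x + s *: u) - f x)| < e / 3.
  by near: s; move/cvgrPdist_lt : gu; exact.
have A2 : `|'D_(u + v) f x - s^-1 * (f (x + s *: (u + v)) - f x)| < e / 3.
  by near: s; move/cvgrPdist_lt : guv; exact.
have sin t : 0 <= t <= s -> U (x + s *: u + t *: v) /\
   `|'D_v f x - 'D_v f (x + s *: u + t *: v)| < e / 3.
  move=> /andP[t0 ts]; apply: dU; first by rewrite gtr0_norm.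
  by rewrite ger0_norm// (le_trans ts).
have [c /sin[_ A3] E] := @MVT_line _ _ f (x + s *: u) v s
   (fun t ts => fv _ (sin t ts).1) (ltW s0).
have E' : s^-1 * (f (x + s *: (u + v)) - f x) =
   s^-1 * (f (x + s *: u) - f x) + 'D_v f (x + s *: u + c *: v).
  have sn0 : s != 0 by rewrite gt_eqF.
  by rewrite scalerDr addrA; apply: (mulfI sn0); rewrite [RHS]mulrDr !mulVKf// -E; ring.
rewrite E' in A2.
move: A1 A2 A3; move: ('D_u f x) ('D_(u + v) f x) ('D_v f x) ('D_v f _) (s^-1 * _) => x1 x2 x3 x4 x5.
rewrite !ltr_distl => /andP[? ?] /andP[? ?] /andP[? ?].
rewrite ler_norml; lra.
Unshelve. all: by end_near. Qed.

(** Applied twice, the mean value theorem shows that the second difference of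
    [f] over the parallelogram spanned by [s u] and [s v] is [s^2] times a value,
    close to [x], of either of the mixed derivatives; continuity concludes. *)
Lemma schwarz U f (x u v : V) : nbhs x U ->
  (forall y, U y -> derivable f y u) -> (forall y, U y -> derivable f y v) ->
  (forall y, U y -> derivable (fun z => 'D_u f z : R^o) y v) ->
  (forall y, U y -> derivable (fun z => 'D_v f z : R^o) y u) ->
  {for x, continuous (fun y => 'D_v (fun z => 'D_u f z : R^o) y : R^o)} ->
  {for x, continuous (fun y => 'D_u (fun z => 'D_v f z : R^o) y : R^o)} ->
  'D_v (fun z => 'D_u f z : R^o) x = 'D_u (fun z => 'D_v f z : R^o) x.
Proof.
have key (w w' : V) (e : R) : 0 < e -> nbhs x U ->
  (forall y, U y -> derivable f y w) ->
  (forall y, U y -> derivable (fun z => 'D_w f z : R^o) y w') ->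
  {for x, continuous (fun y => 'D_w' (fun z => 'D_w f z : R^o) y : R^o)} ->
  \forall s \near (0:R)^'+, `|'D_w' (fun z => 'D_w f z : R^o) x -
    s^-1 * (s^-1 * (f (x + s *: w + s *: w') - f (x + s *: w) - f (x + s *: w') + f x))| < e.
  move=> e0 xU fw fww' cw.
  have nV : nbhs x [set y | U y /\
      `|'D_w' (fun z => 'D_w f z : R^o) x - 'D_w' (fun z => 'D_w f z : R^o) y| < e].
    by apply: filterI => //; have /cvgrPdist_lt := cw; exact.
  have [d d0 dU] := near_parallelogram w w' nV.
  near=> s.
  have s0 : 0 < s by near: s; exact: nbhs_right_gt.
  have sd : s <= d by near: s; exact: nbhs_right_le.
  have sin t t' : 0 <= t <= s -> 0 <= t' <= s -> U (x + t *: w + t' *: w') /\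
     `|'D_w' (fun z => 'D_w f z : R^o) x -
       'D_w' (fun z => 'D_w f z : R^o) (x + t *: w + t' *: w')| < e.
    move=> /andP[t0 ts] /andP[t'0 t's].
    by apply: dU; rewrite ger0_norm// (le_trans _ sd).
  have s00 : 0 <= (0:R) <= s by rewrite lexx ltW.
  have s0s : 0 <= s <= s by rewrite lexx ltW.
  pose g y := f (y + s *: w') - f y : R^o.
  have dsh y : derivable f (y + s *: w') w ->
      is_derive y w (fun z => f (z + s *: w') : R^o) ('D_w f (y + s *: w')).
    move=> fy; split; rewrite /derivable /derive.
      have -> : (fun h : R => h^-1 *: (((fun z => f (z + s *: w')) \o shift y) (h *: w) - f (y + s *: w')))
        = (fun h => h^-1 *: ((f \o shift (y + s *: w')) (h *: w) - f (y + s *: w'))).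
        by apply/funext => h /=; rewrite addrA.
      exact: fy.
    by apply: (f_equal (fun g : R -> R^o => lim (g @ (0 : R)^'))); apply/funext => h /=; rewrite addrA.
  have dg t : 0 <= t <= s -> is_derive (x + t *: w) w g
      ('D_w f (x + t *: w + s *: w') - 'D_w f (x + t *: w)).
    move=> ts; apply: is_deriveB; first exact: (dsh _ (fw _ (sin _ _ ts s0s).1)).
    apply: derivableP; apply: fw.
    by have [] := sin _ _ ts s00; rewrite scale0r addr0.
  have [c cs E1] := @MVT_line _ _ g x w s (fun t ts => @ex_derive _ _ _ _ _ _ _ (dg t ts)) (ltW s0).
  have [c' cs' E2] := @MVT_line _ _ (fun z => 'D_w f z : R^o) (x + c *: w) w' s
    (fun t ts => fww' _ (sin _ _ cs ts).1) (ltW s0).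
  have -> : f (x + s *: w + s *: w') - f (x + s *: w) - f (x + s *: w') + f x =
     s * (s * 'D_w' (fun z => 'D_w f z : R^o) (x + c *: w + c' *: w')).
    by rewrite -E2 -(@derive_val _ _ _ _ _ _ _ (dg c cs)) -E1 /g; ring.
  by rewrite !mulKf ?gt_eqF//; exact: (sin _ _ cs cs').2.
move=> xU fu fv fuv fvu cuv cvu; apply/eqP; rewrite -subr_eq0 -normr_le0.
apply/ler_addgt0Pr => e e0; rewrite add0r.
have e2 : 0 < e / 2 by rewrite divr_gt0.
near (0 : R)^'+ => s.
have A1 : `|'D_v (fun z => 'D_u f z : R^o) x -
    s^-1 * (s^-1 * (f (x + s *: u + s *: v) - f (x + s *: u) - f (x + s *: v) + f x))| < e / 2.
  by near: s; exact: (key u v _ e2 xU).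
have A2 : `|'D_u (fun z => 'D_v f z : R^o) x -
    s^-1 * (s^-1 * (f (x + s *: v + s *: u) - f (x + s *: v) - f (x + s *: u) + f x))| < e / 2.
  by near: s; exact: (key v u _ e2 xU).
have E : f (x + s *: v + s *: u) - f (x + s *: v) - f (x + s *: u) + f x =
   f (x + s *: u + s *: v) - f (x + s *: u) - f (x + s *: v) + f x.
  by rewrite [x + s *: v + _]addrAC; ring.
rewrite E in A2.
move: A1 A2; move: (s^-1 * (s^-1 * (f (x + s *: u + s *: v) - f (x + s *: u)
  - f (x + s *: v) + f x))) => r.
move: ('D_v _ x) ('D_u _ x) => a b A1 A2.
apply: (le_trans (ler_distD r _ _)); rewrite [leRHS](splitr e).
by apply: lerD; apply: ltW => //; rewrite distrC.
Unshelve. all: by end_near. Qed.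

End Directional.

(** * The chain rule *)

Section ChainRule.
Context {R : realType}.

Section C1.
Context {V : normedModType R} (U : set V) (f : V -> R^o).
Hypotheses (oU : open U) (fC1 : Ck_on 1 U f).

Lemma derive_lincomb n (c : 'I_n -> R) (v : 'I_n -> V) x : U x ->
  'D_(\sum_i c i *: v i) f x = \sum_i c i * 'D_(v i) f x.
Proof.
move=> Ux; have [_ fd] := fC1.
have xU : nbhs x U by apply: open_nbhs_nbhs.
have fdv y w : U y -> derivable f y w by exact: (fd w).1.
elim: n c v => [|n IH] c v; first by rewrite !big_ord0 derive0.
rewrite !big_ord_recl -IH -derive_scale; last exact: fdv.
apply: (derive_addv xU); try exact: fdv.
- by move=> y Uy; exact: fdv.
- exact: (fd _).2.1.
Qed.

End C1.

(** The mean value theorem along the segment from [tau y] to [tau (y + s v)]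
    turns the difference quotient into the combination of the partial
    derivatives of [f], at a point of the segment, with the coordinates of the
    difference quotient of [tau]. *)
Lemma chain_rule (V : normedModType R) n (U : set 'cV[R]_n)
    (f : 'cV[R]_n -> R^o) (tau : V -> 'cV[R]_n) (y v : V) :
  open U -> Ck_on 1 U f -> U (tau y) -> {for y, continuous tau} ->
  derivable tau y v ->
  is_derive y v (f \o tau : V -> R^o)
    (\sum_i 'D_v (fun x => tau x i 0 : R^o) y * 'D_(delta_mx i 0) f (tau y)).
Proof.
move=> oU fC1 Uy ct dt; have [fc fd] := fC1.
set x := tau y in Uy *.
pose w (s : R) := tau (s *: v + y) - x.
pose P (s : R) := [set c : R | 0 <= c <= 1 /\ f (x + w s) - f x =
   \sum_i w s i 0 * 'D_(delta_mx i 0) f (x + c *: w s)].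
pose c s := xget 0 (P s).
(* [c s] is a mean value parameter when there is one and 0 otherwise, so that
   it is defined for all [s] and always lies in the unit interval. *)
have c01 s : 0 <= c s <= 1.
  by rewrite /c; case: xgetP => [t _ [//]|_]; rewrite lexx ler01.
have w0 : w s @[s --> (0:R)^'] --> (0 : 'cV[R]_n).
  have h : s *: v + y @[s --> (0:R)^'] --> y.
    rewrite -[X in _ --> X]add0r -[X in _ --> X + _](scale0r v).
    apply: cvgD; last exact: cvg_cst.
    by apply: cvgZr_tmp; apply: cvg_within.
  rewrite -[X in _ --> X](subrr x); apply: cvgB; last exact: cvg_cst.
  by apply: (@cvg_comp _ _ _ (fun s : R => s *: v + y) tau _ (nbhs y)).
have cw0 : x + c s *: w s @[s --> (0:R)^'] --> x.
  rewrite -[X in _ --> X]addr0; apply: cvgD; first exact: cvg_cst.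
  apply/cvgrPdist_le => e e0; move/cvgrPdist_le : w0 => /(_ e e0); apply: filterS => s.
  rewrite !sub0r !normrN normrZ => h; apply: le_trans h.
  by have /andP[? ?] := c01 s; rewrite ler_piMl// ger0_norm.
have nP : \forall s \near (0:R)^', P s (c s).
  have [e /= e0 eU] : exists2 e : R, 0 < e & ball x e `<=` U.
    by apply/nbhs_ballP; exact: open_nbhs_nbhs.
  move/cvgrPdist_lt : w0 => /(_ e e0); apply: filterS => s; rewrite sub0r normrN => ws.
  have sU t : 0 <= t <= 1 -> U (x + t *: w s).
    move=> /andP[t0 t1]; apply: eU; rewrite -ball_normE/= opprD addNKr normrN.
    by rewrite normrZ (le_lt_trans _ ws)// ler_piMl// ger0_norm.
  have [t t01] := @MVT_line _ _ f x (w s) 1 (fun t t01 => (fd _).1 _ (sU t t01)) ler01.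
  rewrite scale1r mul1r => E; apply: (@xgetPex _ 0 (P s)); exists t; split=> //.
  rewrite E -(derive_lincomb oU fC1); last exact: sU.
  congr ('D_ _ f _); apply/matrixP => p q; rewrite summxE (bigD1 p)//= big1 ?addr0.
    by rewrite !mxE (ord1 q) !eqxx mulr1.
  by move=> k kp; rewrite !mxE eq_sym (negPf kp) mulr0.
have lim : s^-1 *: (f (tau (s *: v + y)) - f (tau y)) @[s --> (0:R)^'] -->
   (\sum_i 'D_v (fun x => tau x i 0 : R^o) y * 'D_(delta_mx i 0) f (tau y) : R^o).
  have : \sum_i (s^-1 * w s i 0) * 'D_(delta_mx i 0) f (x + c s *: w s)
      @[s --> (0:R)^'] -->
     (\sum_i 'D_v (fun x => tau x i 0 : R^o) y * 'D_(delta_mx i 0) f (tau y) : R^o).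
    apply: (@cvg_big R^o _ +%R 0) => [|i _]; first exact: add_continuous.
    apply: cvgM.
      have /derivable_mxP/(_ i 0) di := dt.
      have -> : (fun s => s^-1 * w s i 0) =
        (fun h => h^-1 *: (((fun x => tau x i 0 : R^o) \o shift y) (h *: v) - tau y i 0)).
        by apply/funext => s /=; rewrite /w !mxE.
      exact: di.
    have [_ [Dc _]] := fd (delta_mx i 0).
    by apply: (@cvg_comp _ _ _ (fun s : R => x + c s *: w s)
      (fun y => 'D_(delta_mx i 0) f y : R^o) _ (nbhs x)) => //; exact: Dc.
  move=> h; apply: cvg_trans h; apply: near_eq_cvg; move: nP; apply: filterS => s [_ E] /=.
  have -> : tau (s *: v + y) = x + w s by rewrite /w addrCA subrr addr0.
  by rewrite [f (x + w s) - _]E scaler_sumr; apply: eq_bigr => i _; exact/esym/mulrA.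
split; last exact/cvg_lim.
by apply/cvg_ex; eexists; exact: lim.
Qed.

End ChainRule.

(** * Smooth complex-valued functions *)

Lemma eq_ReIm (R : realType) (a b : R[i]) :
  complex.Re a = complex.Re b -> complex.Im a = complex.Im b -> a = b.
Proof. by case: a b => [? ?] [? ?] /= -> ->. Qed.

Lemma creM (R : realType) (a b : R[i]) : complex.Re (a * b) =
  complex.Re a * complex.Re b - complex.Im a * complex.Im b.
Proof. by case: a b => [? ?] [? ?]. Qed.

Lemma cimM (R : realType) (a b : R[i]) : complex.Im (a * b) =
  complex.Re a * complex.Im b + complex.Im a * complex.Re b.
Proof. by case: a b => [? ?] [? ?]. Qed.

Lemma creD (R : realType) (a b : R[i]) : complex.Re (a + b) =
  complex.Re a + complex.Re b.
Proof. by case: a b => [? ?] [? ?]. Qed.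

Lemma cimD (R : realType) (a b : R[i]) : complex.Im (a + b) =
  complex.Im a + complex.Im b.
Proof. by case: a b => [? ?] [? ?]. Qed.

(** The real and imaginary parts of a product of complex functions have this
    form, with [c = -1] and [c = 1]. *)
Lemma derive_lin2 (R : realType) (V : normedModType R) (x v : V)
    (f g h k : V -> R^o) (df dg dh dk : R) (c : R) :
  is_derive x v f df -> is_derive x v g dg -> is_derive x v h dh ->
  is_derive x v k dk ->
  'D_v (fun y => f y * g y + c * (h y * k y) : R^o) x =
  f x * dg + df * g x + c * (h x * dk + dh * k x).
Proof.
move=> df_ dg_ dh_ dk_.
have := is_deriveD (is_deriveM df_ dg_) (is_deriveZ c (is_deriveM dh_ dk_)).
move=> /(@derive_val _ _ _ _ _ _ _) E.
rewrite [LHS]E; congr (_ + _ * _).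
  by rewrite [df * _]mulrC.
by rewrite [dh * _]mulrC.
Qed.

Section RealSmooth.
Context {R : realType} {V : normedModType R} (U : set V).
Hypothesis oU : open U.
Implicit Types f g : V -> R^o.

Lemma smooth_derivable (W : normedModType R) (f : V -> W) x v :
  smooth_on U f -> U x -> derivable f x v.
Proof. by move=> /(_ 1%N)[_ /(_ v)[fd _]] Ux; exact: fd. Qed.

Lemma smooth_derive (W : normedModType R) (f : V -> W) v :
  smooth_on U f -> smooth_on U (fun x => 'D_v f x).
Proof. by move=> fs k; have [_ /(_ v)[_]] := fs k.+1. Qed.

Lemma smooth_continuous (W : normedModType R) (f : V -> W) x :
  smooth_on U f -> U x -> {for x, continuous f}.
Proof. by move=> /(_ 0%N)[fc _]; exact: fc. Qed.

Lemma smooth_congr (W : normedModType R) (f g : V -> W) :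
  (forall x, U x -> f x = g x) -> smooth_on U f -> smooth_on U g.
Proof. by move=> fg fs k; exact: Ck_on_congr (fs k). Qed.

Lemma derive_congr (W : normedModType R) (f g : V -> W) x v :
  (forall x, U x -> f x = g x) -> U x -> 'D_v f x = 'D_v g x.
Proof.
move=> fg Ux; apply: near_eq_derive.
by near do apply: fg; apply: open_nbhs_nbhs.
Unshelve. all: by end_near. Qed.

Lemma smooth_cst (W : normedModType R) (c : W) : smooth_on U (fun _ => c).
Proof. by move=> k; exact: Ck_on_cst. Qed.

Lemma smoothD f g : smooth_on U f -> smooth_on U g ->
  smooth_on U (fun x => f x + g x : R^o).
Proof. by move=> fs gs k; exact: Ck_onD. Qed.

Lemma smoothM f g : smooth_on U f -> smooth_on U g ->
  smooth_on U (fun x => f x * g x : R^o).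
Proof. by move=> fs gs k; exact: Ck_onM. Qed.

Lemma smoothV f : (forall x, U x -> f x != 0) -> smooth_on U f ->
  smooth_on U (fun x => (f x)^-1 : R^o).
Proof. by move=> f0 fs k; exact: Ck_onV. Qed.

Lemma smoothN f : smooth_on U f -> smooth_on U (fun x => - f x : R^o).
Proof.
move=> fs; apply: smooth_congr (smoothM (smooth_cst (-1 : R^o)) fs) => x _.
by rewrite mulN1r.
Qed.

Lemma smooth_sum I (r : seq I) (P : pred I) (F : I -> V -> R^o) :
  (forall i, smooth_on U (F i)) ->
  smooth_on U (fun x => \sum_(i <- r | P i) F i x : R^o).
Proof.
move=> Fs; elim: r => [|i r IH].
  by apply: smooth_congr (smooth_cst (0 : R^o)) => x _; rewrite big_nil.
have [Pi|Pi] := boolP (P i).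
  by apply: smooth_congr (smoothD (Fs i) IH) => x _; rewrite big_cons Pi.
by apply: smooth_congr IH => x _; rewrite big_cons (negPf Pi).
Qed.

Lemma smooth_prod I (r : seq I) (F : I -> V -> R^o) :
  (forall i, smooth_on U (F i)) ->
  smooth_on U (fun x => \prod_(i <- r) F i x : R^o).
Proof.
move=> Fs; elim: r => [|i r IH].
  by apply: smooth_congr (smooth_cst (1 : R^o)) => x _; rewrite big_nil.
by apply: smooth_congr (smoothM (Fs i) IH) => x _; rewrite big_cons.
Qed.

Lemma smooth_det n (F : V -> 'M[R]_n) :
  (forall i j, smooth_on U (fun x => F x i j : R^o)) ->
  smooth_on U (fun x => \det (F x) : R^o).
Proof.
move=> Fs; apply: smooth_sum => s; apply: smoothM; first exact: smooth_cst.
by apply: smooth_prod => i.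
Qed.

(** By Cramer's rule. *)
Lemma smooth_invmx n (F : V -> 'M[R]_n) :
  (forall x, U x -> F x \in unitmx) ->
  (forall i j, smooth_on U (fun x => F x i j : R^o)) ->
  forall i j, smooth_on U (fun x => invmx (F x) i j : R^o).
Proof.
move=> Fu Fs i j.
have ds : smooth_on U (fun x => (\det (F x))^-1 : R^o).
  by apply: smoothV (smooth_det Fs) => x /Fu; rewrite unitmxE unitfE.
have cs : smooth_on U (fun x => cofactor (F x) j i : R^o).
  apply: smoothM; first exact: smooth_cst.
  apply: smooth_det => p q; apply: smooth_congr (Fs (lift j p) (lift i q)) => x _.
  by rewrite !mxE.
by apply: smooth_congr (smoothM ds cs) => x Ux; rewrite /invmx Fu// !mxE.
Qed.

Lemma smooth_linear (L : V -> R^o) : continuous L ->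
  (forall h v x, L (h *: v + x) = h * L v + L x) -> smooth_on U L.
Proof.
move=> Lc Ll; have Ld x v : is_derive x v L (L v).
  have E : \forall h \near (0:R)^', h^-1 *: ((L \o shift x) (h *: v) - L x) = L v.
    near=> h; rewrite /= Ll addrK; apply: mulKf.
    by near: h; exact: nbhs_dnbhs_neq.
  have lim : h^-1 *: ((L \o shift x) (h *: v) - L x) @[h --> (0:R)^'] --> L v.
    exact: cvg_near_cst.
  by split; [apply/cvg_ex; eexists; exact: lim|exact/cvg_lim].
case=> [|k]; split=> //; try by move=> x _; exact: Lc.
move=> v; split=> [x _|]; first exact: (@ex_derive _ _ _ _ _ _ _ (Ld x v)).
have -> : (fun x => 'D_v L x) = (fun _ => L v).
  by apply/funext => x; rewrite (@derive_val _ _ _ _ _ _ _ (Ld x v)).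
exact: Ck_on_cst.
Unshelve. all: by end_near. Qed.

End RealSmooth.

Section ComplexSmooth.
Context {R : realType} {V : normedModType R} (U : set V).
Hypothesis oU : open U.
Local Notation C := R[i].
Implicit Types f g : V -> C.

Lemma csmooth_congr f g : (forall x, U x -> f x = g x) ->
  csmooth_on U f -> csmooth_on U g.
Proof.
move=> fg [fr fi]; split.
  by apply: smooth_congr fr => // x /fg ->.
by apply: smooth_congr fi => // x /fg ->.
Qed.

Lemma csmooth_cst (c : C) : csmooth_on U (fun _ => c).
Proof. by split; exact: smooth_cst. Qed.

Lemma csmoothD f g : csmooth_on U f -> csmooth_on U g ->
  csmooth_on U (fun x => f x + g x).
Proof.
move=> [fr fi] [gr gi]; split.
  by apply: smooth_congr (smoothD oU fr gr) => // x _; rewrite creD.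
by apply: smooth_congr (smoothD oU fi gi) => // x _; rewrite cimD.
Qed.

Lemma csmoothM f g : csmooth_on U f -> csmooth_on U g ->
  csmooth_on U (fun x => f x * g x).
Proof.
move=> [fr fi] [gr gi]; split.
  apply: smooth_congr (smoothD oU (smoothM oU fr gr) (smoothN oU (smoothM oU fi gi))) => // x _.
  by rewrite creM.
apply: smooth_congr (smoothD oU (smoothM oU fr gi) (smoothM oU fi gr)) => // x _.
by rewrite cimM.
Qed.

Lemma csmooth_sum I (r : seq I) (P : pred I) (F : I -> V -> C) :
  (forall i, csmooth_on U (F i)) ->
  csmooth_on U (fun x => \sum_(i <- r | P i) F i x).
Proof.
move=> Fs; elim: r => [|i r IH].
  by apply: csmooth_congr (csmooth_cst 0) => x _; rewrite big_nil.
have [Pi|Pi] := boolP (P i).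
  by apply: csmooth_congr (csmoothD (Fs i) IH) => x _; rewrite big_cons Pi.
by apply: csmooth_congr IH => x _; rewrite big_cons (negPf Pi).
Qed.

Lemma csmoothX f k : csmooth_on U f -> csmooth_on U (fun x => f x ^+ k).
Proof.
move=> fs; elim: k => [|k IH].
  by apply: csmooth_congr (csmooth_cst 1) => x _; rewrite expr0.
by apply: csmooth_congr (csmoothM fs IH) => x _; rewrite exprS.
Qed.

Lemma csmooth_real (f : V -> R^o) : smooth_on U f ->
  csmooth_on U (fun x => (f x)%:C).
Proof. by move=> fs; split=> //; exact: smooth_cst. Qed.

Lemma csmooth_cD f v : csmooth_on U f -> csmooth_on U (fun x => cD v f x).
Proof. by move=> [fr fi]; split; exact: smooth_derive. Qed.

Lemma cD_congr f g v x : (forall x, U x -> f x = g x) -> U x ->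
  cD v f x = cD v g x.
Proof.
move=> fg Ux; apply: eq_ReIm => /=.
  by apply: (@derive_congr _ _ U) => // y /fg ->.
by apply: (@derive_congr _ _ U) => // y /fg ->.
Qed.

Lemma cD_cst (c : C) v x : cD v (fun _ : V => c) x = 0.
Proof. by apply: eq_ReIm; rewrite /= derive_cst. Qed.

Lemma cDD f g v x : csmooth_on U f -> csmooth_on U g -> U x ->
  cD v (fun y => f y + g y) x = cD v f x + cD v g x.
Proof.
move=> [fr fi] [gr gi] Ux; apply: eq_ReIm => /=.
  rewrite -deriveD; try exact: smooth_derivable Ux.
  by apply: (@derive_congr _ _ U) => // y _; rewrite creD.
rewrite -deriveD; try exact: smooth_derivable Ux.
by apply: (@derive_congr _ _ U) => // y _; rewrite cimD.
Qed.

Lemma cDM f g v x : csmooth_on U f -> csmooth_on U g -> U x ->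
  cD v (fun y => f y * g y) x = f x * cD v g x + cD v f x * g x.
Proof.
move=> [fr fi] [gr gi] Ux.
have [Fr Gr] := (derivableP (smooth_derivable (v := v) fr Ux), derivableP (smooth_derivable (v := v) gr Ux)).
have [Fi Gi] := (derivableP (smooth_derivable (v := v) fi Ux), derivableP (smooth_derivable (v := v) gi Ux)).
have key := derive_lin2 (-1) Fr Gr Fi Gi.
have key' := derive_lin2 1 Fr Gi Fi Gr.
apply: eq_ReIm; rewrite ?creD ?cimD ?creM ?cimM /=.
  transitivity ('D_v (fun y => complex.Re (f y) * complex.Re (g y)
     + (-1) * (complex.Im (f y) * complex.Im (g y)) : R^o) x).
    by apply: (@derive_congr _ _ U) => // y _; rewrite creM mulN1r.
  by rewrite key; ring.
transitivity ('D_v (fun y => complex.Re (f y) * complex.Im (g y)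
     + 1 * (complex.Im (f y) * complex.Re (g y)) : R^o) x).
  by apply: (@derive_congr _ _ U) => // y _; rewrite cimM mul1r.
by rewrite key'; ring.
Qed.

Lemma cDZ (c : C) f v x : csmooth_on U f -> U x ->
  cD v (fun y => c * f y) x = c * cD v f x.
Proof.
by move=> fs Ux; rewrite cDM//; [rewrite cD_cst mul0r addr0|exact: csmooth_cst].
Qed.

Lemma cD_sum I (r : seq I) (F : I -> V -> C) v x :
  (forall i, csmooth_on U (F i)) -> U x ->
  cD v (fun y => \sum_(i <- r) F i y) x = \sum_(i <- r) cD v (F i) x.
Proof.
move=> Fs Ux; elim: r => [|i r IH].
  rewrite big_nil -[RHS](cD_cst 0 v x).
  by apply: (cD_congr _ _ Ux) => y _; rewrite big_nil.
rewrite big_cons -IH -cDD//; last exact: csmooth_sum.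
by apply: (cD_congr _ _ Ux) => y _; rewrite big_cons.
Qed.

Lemma cD_comm f u v x : csmooth_on U f -> U x ->
  cD u (fun y => cD v f y) x = cD v (fun y => cD u f y) x.
Proof.
move=> [fr fi] Ux.
have key (g : V -> R^o) : smooth_on U g ->
    'D_u (fun y => 'D_v g y : R^o) x = 'D_v (fun y => 'D_u g y : R^o) x.
  move=> gs; apply: (@schwarz _ _ U); try by move=> y; apply: smooth_derivable => //; do ?exact: smooth_derive.
  - exact: open_nbhs_nbhs.
  - by apply: smooth_continuous Ux; do 2!apply: smooth_derive.
  - by apply: smooth_continuous Ux; do 2!apply: smooth_derive.
by apply: eq_ReIm => /=; exact: key.
Qed.

End ComplexSmooth.

Lemma csmooth_sub (R : realType) (V : normedModType R) (U U' : set V) (f : V -> R[i]) :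
  U' `<=` U -> csmooth_on U f -> csmooth_on U' f.
Proof. by move=> UU [fr fi]; split=> k; apply: Ck_on_sub UU _. Qed.

(** * Products and the coordinate of the twistor line *)

Section Product.
Context {R : realType} {V W : normedModType R}.
Implicit Types (U : set V).

Lemma Ck_on_fst k U (f : V -> R^o) : Ck_on k U f ->
  Ck_on k [set t : V * W | U t.1] (fun t => f t.1 : R^o).
Proof.
have fc (g : V -> R^o) : (forall x, U x -> {for x, continuous g}) ->
    forall t : V * W, U t.1 -> {for t, continuous (fun t : V * W => g t.1 : R^o)}.
  move=> gc t Ut; apply: (@cvg_comp _ _ _ fst g _ (nbhs t.1)); first exact: cvg_fst.
  exact: gc.
elim: k f => [|k IH] f [/fc ct fd]; split=> // v; have [fv fk] := fd v.1; split.
  by move=> t /= /fv.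
by have := IH _ fk; congr Ck_on.
Qed.

Lemma csmooth_fst U (f : V -> R[i]) : csmooth_on U f ->
  csmooth_on [set t : V * W | U t.1] (fun t => f t.1).
Proof. move=> [fr fi]; split=> k.
  exact: (@Ck_on_fst k U (fun x => complex.Re (f x) : R^o) (fr k)).
exact: (@Ck_on_fst k U (fun x => complex.Im (f x) : R^o) (fi k)). Qed.

Lemma cD_fst (f : V -> R[i]) (v t : V * W) :
  cD v (fun t : V * W => f t.1) t = cD v.1 f t.1.
Proof. by []. Qed.

Lemma cD0 (f : V -> R[i]) (x : V) : cD 0 f x = 0.
Proof. by apply: eq_ReIm; rewrite /= derive0. Qed.

Lemma cD_slice (F : V * W -> R[i]) (v : V) (t : V * W) :
  cD ((v, 0) : V * W) F t = cD v (fun y => F (y, t.2)) t.1.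
Proof.
have key (g : V * W -> R^o) :
    'D_((v, 0) : V * W) g t = 'D_v (fun y => g (y, t.2) : R^o) t.1.
  rewrite /derive; apply: (f_equal (fun g : R -> R^o => lim (g @ (0 : R)^'))).
  apply/funext => h /=; rewrite -surjective_pairing.
  by congr (_ *: (g _ - _)); case: t => a b; congr pair; rewrite /= scaler0 add0r.
by apply: eq_ReIm => /=; rewrite key.
Qed.

Lemma open_fst U : open U -> open [set t : V * W | U t.1].
Proof.
move=> oU; apply: (@open_comp _ _ (fst : V * W -> V) U) => // t _.
exact: cvg_fst.
Qed.

End Product.

Section TwistorCoordinates.
Context {R : realType} {m : nat}.
Local Notation C := R[i].
Local Notation n := (4 * m)%N.
Local Notation ZR := ('cV[R]_n * (R^o * R^o))%type.
Local Notation zc := (@zc R m).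

Lemma csmooth_zc (U : set ZR) : open U -> csmooth_on U zc.
Proof.
move=> oU; split; apply: smooth_linear => //=.
- move=> t; apply: (@cvg_comp _ _ _ (snd : ZR -> R^o * R^o) fst _ (nbhs t.2)); [exact: cvg_snd|exact: cvg_fst].
- move=> t; apply: (@cvg_comp _ _ _ (snd : ZR -> R^o * R^o) snd _ (nbhs t.2)); [exact: cvg_snd|exact: cvg_snd].
Qed.

Lemma cD_zc (v : ZR) t : cD v zc t = v.2.1 +i* v.2.2.
Proof.
have lin (L : ZR -> R^o) : continuous L ->
  (forall h v x, L (h *: v + x) = h * L v + L x) -> 'D_v L t = L v.
  move=> Lc Ll; rewrite /derive; apply/cvg_lim => //; apply: cvg_near_cst.
  near=> h; rewrite /= Ll addrK; apply: mulKf.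
  by near: h; exact: nbhs_dnbhs_neq.
apply: eq_ReIm; apply: lin => //=.
- move=> x; apply: (@cvg_comp _ _ _ (snd : ZR -> R^o * R^o) fst _ (nbhs x.2)); [exact: cvg_snd|exact: cvg_fst].
- move=> x; apply: (@cvg_comp _ _ _ (snd : ZR -> R^o * R^o) snd _ (nbhs x.2)); [exact: cvg_snd|exact: cvg_snd].
Unshelve. all: by end_near. Qed.

Section Zbar.
Variable U : set ZR.
Hypothesis oU : open U.
Implicit Types f g : ZR -> C.

Lemma zbar_congr f g t : (forall x, U x -> f x = g x) -> U t ->
  D_zbar f t = D_zbar g t.
Proof.
move=> fg Ut; rewrite /D_zbar.
have E v : cD v f t = cD v g t by exact: (@cD_congr R ZR U oU f g v t fg Ut).
by rewrite E E.
Qed.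

Lemma zbarM f g t : csmooth_on U f -> csmooth_on U g -> U t ->
  D_zbar (fun x => f x * g x) t = f t * D_zbar g t + D_zbar f t * g t.
Proof.
move=> fs gs Ut; rewrite /D_zbar.
have E v := @cDM R ZR U oU f g v t fs gs Ut.
rewrite (E (0, (1, 0))) (E (0, (0, 1))).
move: (cD _ f t) (cD _ f t) (cD _ g t) (cD _ g t) => a b c d; ring.
Qed.

Lemma zbar_cst (c : C) t : D_zbar (fun _ : ZR => c) t = 0.
Proof. by rewrite /D_zbar !cD_cst mulr0 addr0 mulr0. Qed.

Lemma zbar_sum I (r : seq I) (F : I -> ZR -> C) t :
  (forall i, csmooth_on U (F i)) -> U t ->
  D_zbar (fun y => \sum_(i <- r) F i y) t = \sum_(i <- r) D_zbar (F i) t.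
Proof.
move=> Fs Ut; 
rewrite /D_zbar; have E v := @cD_sum R ZR U oU I r F v t Fs Ut.
by rewrite (E (0, (1, 0))) (E (0, (0, 1))) mulr_sumr -big_split mulr_sumr.
Qed.

Lemma zbar_zc t : D_zbar zc t = 0.
Proof.
rewrite /D_zbar !cD_zc /=; apply/eqP; rewrite mulf_eq0; apply/orP; right.
by rewrite eq_complex /= !(mul0r, mul1r, mulr0, subr0, add0r, addr0) subrr eqxx.
Qed.

Lemma zbar_zcX k t : U t -> D_zbar (fun x => zc x ^+ k) t = 0.
Proof.
move=> Ut; elim: k => [|k IH].
  by rewrite -[RHS](zbar_cst 1 t); apply: zbar_congr Ut => x _; rewrite expr0.
have -> : D_zbar (fun x => zc x ^+ k.+1) t = D_zbar (fun x => zc x * zc x ^+ k) t.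
  by apply: zbar_congr Ut => x _; rewrite exprS.
have zs := csmooth_zc oU.
by rewrite zbarM// ?IH ?zbar_zc ?mulr0 ?mul0r ?addr0//; exact: csmoothX.
Qed.

Lemma zbar_fst (f : 'cV[R]_n -> C) (t : ZR) : D_zbar (fun t => f t.1) t = 0.
Proof. by rewrite /D_zbar !cD_fst !cD0 mulr0 addr0 mulr0. Qed.

End Zbar.

End TwistorCoordinates.

(** * Quaternions *)

Lemma ord2P (P : 'I_2 -> Prop) : P 0 -> P 1 -> forall i, P i.
Proof.
move=> P0 P1 [[|[|//]] h].
  by have -> : Ordinal h = 0 by exact: val_inj.
by have -> : Ordinal h = 1 by exact: val_inj.
Qed.

Lemma ord3P (P : 'I_3 -> Prop) : P 0 -> P 1 -> P 2 -> forall i, P i.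
Proof.
move=> P0 P1 P2 [[|[|[|//]]] h].
- by have -> : Ordinal h = 0 by exact: val_inj.
- by have -> : Ordinal h = 1 by exact: val_inj.
- by have -> : Ordinal h = 2 by exact: val_inj.
Qed.

Lemma sum2 (V : nmodType) (F : 'I_2 -> V) : \sum_i F i = F 0 + F 1.
Proof.
rewrite !big_ord_recl big_ord0 addr0; congr (_ + F _); exact: val_inj.
Qed.

Lemma sum3 (V : nmodType) (F : 'I_3 -> V) : \sum_i F i = F 0 + F 1 + F 2.
Proof.
rewrite !big_ord_recl big_ord0 addr0 addrA.
by congr (_ + F _ + F _); exact: val_inj.
Qed.

Section Quaternions.
Context {F : comUnitRingType} {n : nat}.
Variable K : 'I_3 -> 'M[F]_n.
Hypothesis sqr : forall r, K r *m K r = - 1%:M.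
Hypothesis mul3 : K 0 *m K 1 *m K 2 = - 1%:M.

(** The quaternion [a + b I + c J + d K] with scalars in [F], acting through
    three anticommuting complex structures. *)
Definition quat (a b c d : F) : 'M[F]_n :=
  a%:M + b *: K 0 + c *: K 1 + d *: K 2.

Lemma K01 : K 0 *m K 1 = K 2.
Proof.
have := congr1 (mulmx^~ (K 2)) mul3.
by rewrite -mulmxA sqr mulmxN mulmx1 mulNmx mul1mx => /oppr_inj.
Qed.

Lemma K12 : K 1 *m K 2 = K 0.
Proof.
have := congr1 (mulmx (K 0)) mul3.
by rewrite -mulmxA mulmxA sqr mulNmx mul1mx mulmxN mulmx1 => /oppr_inj.
Qed.

Lemma K10 : K 1 *m K 0 = - K 2.
Proof. by rewrite -K12 mulmxA sqr mulNmx mul1mx. Qed.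

Lemma K21 : K 2 *m K 1 = - K 0.
Proof. by rewrite -K01 -mulmxA sqr mulmxN mulmx1. Qed.

Lemma K20 : K 2 *m K 0 = K 1.
Proof. by rewrite -K01 -mulmxA K10 mulmxN -K01 mulmxA sqr mulNmx mul1mx opprK. Qed.

Lemma K02 : K 0 *m K 2 = - K 1.
Proof. by rewrite -K01 mulmxA sqr mulNmx mul1mx. Qed.

Lemma quatM a b c d a' b' c' d' :
  quat a b c d *m quat a' b' c' d' =
  quat (a * a' - b * b' - c * c' - d * d')
       (a * b' + b * a' + c * d' - d * c')
       (a * c' - b * d' + c * a' + d * b')
       (a * d' + b * c' - c * b' + d * a').
Proof.
rewrite /quat !mulmxDl !mulmxDr -!scalar_mxM -!scalemxAl -!scalemxAr.
rewrite !mul_scalar_mx !mul_mx_scalar !sqr K01 K12 K20 K10 K21 K02.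
apply/matrixP => p q; rewrite !mxE; case: (p == q); rewrite ?mulr1n ?mulr0n; ring.
Qed.

Lemma quat_sqr b c d : quat 0 b c d *m quat 0 b c d =
  (- (b * b + c * c + d * d))%:M.
Proof.
rewrite quatM [RHS](_ : _ = quat (- (b * b + c * c + d * d)) 0 0 0).
  by congr quat; ring.
by rewrite /quat !scale0r !addr0.
Qed.

Lemma quatZ k a b c d : k *: quat a b c d = quat (k * a) (k * b) (k * c) (k * d).
Proof. by rewrite /quat !scalerDr !scalerA scale_scalar_mx. Qed.

Lemma quatD a b c d a' b' c' d' : quat a b c d + quat a' b' c' d' =
  quat (a + a') (b + b') (c + c') (d + d').
Proof.
rewrite /quat !scalerDl raddfD /=.
apply/matrixP => p q; rewrite !mxE; ring.
Qed.

End Quaternions.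

(** The quaternion identities behind the twistor line, in the homogeneous
    coordinates [(s, t)] of [zeta] and their conjugates [(sb, tb)]: the
    null vector [J] is an eigenvector, for the eigenvalue [w = i], of the right
    multiplication by the point [u] of the sphere, and [u + w] is a left
    multiple of [J]. *)
Section TwistorQuaternions.
Context {F : numFieldType} {n : nat} (K : 'I_3 -> 'M[F]_n).
Hypothesis sqr : forall r, K r *m K r = - 1%:M.
Hypothesis mul3 : K 0 *m K 1 *m K 2 = - 1%:M.
Variables (w s t sb tb : F).
Hypothesis ww : w * w = - 1.
Local Notation N := (s * sb + t * tb).
Hypothesis N0 : N != 0.

Let J := quat K 0 ((s ^+ 2 - t ^+ 2) / 2) (w * (s ^+ 2 + t ^+ 2) / 2) (s * t).
Let u0 := - (t * sb + tb * s) / N.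
Let u1 := w * (t * sb - tb * s) / N.
Let u2 := (s * sb - t * tb) / N.

Lemma quat_J_sphere : J *m quat K 0 u0 u1 u2 = w *: J.
Proof.
rewrite /J quatM// quatZ /u0 /u1 /u2; congr quat; by field: ww.
Qed.

Lemma quat_sphere_J : quat K w u0 u1 u2 =
  quat K 0 (- (w * (sb ^+ 2 - tb ^+ 2)) / N ^+ 2) (- (sb ^+ 2 + tb ^+ 2) / N ^+ 2)
    (- (2 * w * (tb * sb)) / N ^+ 2) *m J.
Proof.
rewrite /J quatM// /u0 /u1 /u2; congr quat; by field: ww.
Qed.

End TwistorQuaternions.

(** * The hyperkaehler structure at a point *)

Lemma trmxD (F : nmodType) p q (B D : 'M[F]_(p, q)) : (B + D)^T = B^T + D^T.
Proof. by apply/matrixP => i j; rewrite !mxE. Qed.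

Lemma trmxZ (F : pzRingType) p q (c : F) (B : 'M[F]_(p, q)) : (c *: B)^T = c *: B^T.
Proof. by apply/matrixP => i j; rewrite !mxE. Qed.

Lemma J_coef (F : numFieldType) (s t w : F) :
  [/\ s ^+ 2 * 0 + s * t * 0 + t ^+ 2 * 0 = 0,
   s ^+ 2 * 2^-1 + s * t * 0 + t ^+ 2 * - 2^-1 = (s ^+ 2 - t ^+ 2) / 2,
   s ^+ 2 * (w / 2) + s * t * 0 + t ^+ 2 * (w / 2) = w * (s ^+ 2 + t ^+ 2) / 2 &
   s ^+ 2 * 0 + s * t * 1 + t ^+ 2 * 0 = s * t].
Proof. by split; field. Qed.

Section Pointwise.
Context {R : realType} {m : nat} {M : topologicalType}.
Context {A : smooth_atlas R (4 * m) M}.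
Variable hk : hyperkahler A.
Local Notation C := R[i].
Local Notation n := (4 * m)%N.

Lemma mul_i_i : 'i * 'i = - 1 :> C.
Proof. by rewrite -expr2 sqr_i. Qed.

Lemma i_neq0 : 'i != 0 :> C.
Proof. by rewrite eq_complex /= oner_eq0 andbF. Qed.

Lemma two_neq0 : 2 != 0 :> C.
Proof. by rewrite pnatr_eq0. Qed.

Section Point.
Variables (a : chart A) (y : 'cV[R]_n).
Hypothesis hy : img a y.
Local Notation G := (cmx (met hk a y)).
Local Notation K := (fun r => cmx (cpx hk r a y)).
Local Notation Kr r := (cmx (cpx hk r a y)).
Local Notation Ip := (I_plus hk a y).
Local Notation I0 := (I_zero hk a y).
Local Notation Im := (I_minus hk a y).

Lemma cpx_csqr r : Kr r *m Kr r = - 1%:M.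
Proof. by rewrite -map_mxM cpx_sqr// map_mxN map_mx1. Qed.

Lemma cpx_cmul : Kr 0 *m Kr 1 *m Kr 2 = - 1%:M.
Proof. by rewrite -!map_mxM cpx_mul// map_mxN map_mx1. Qed.

Lemma met_csym : G^T = G.
Proof. by rewrite map_trmx met_sym. Qed.

Lemma met_unit : met hk a y \in unitmx.
Proof.
rewrite -row_free_unit -kermx_eq0; apply/rowV0P => v /sub_kermxP vG.
apply/eqP; apply: contraT => v0.
have := met_pos hk hy (v := v^T); rewrite trmxK vG mul0mx mxE ltxx => -> //.
by apply: contra v0 => /eqP/(congr1 trmx); rewrite trmxK trmx0 => ->.
Qed.

Lemma met_cunit : G \in unitmx.
Proof. by rewrite map_unitmx met_unit. Qed.

Lemma cpx_corth r : (Kr r)^T *m G *m Kr r = G.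
Proof. by rewrite map_trmx -!map_mxM cpx_orth. Qed.

(** An orthogonal endomorphism of square [-1] is skew for the metric. *)
Lemma cpx_skew r : (Kr r)^T *m G = - (G *m Kr r).
Proof.
have := congr1 (mulmx^~ (Kr r)) (cpx_corth r).
by rewrite /= -mulmxA cpx_csqr mulmxN mulmx1 => <-; rewrite opprK.
Qed.

Lemma I_plusE : Ip = quat K 0 2^-1 ('i / 2) 0.
Proof.
by rewrite /quat /I_plus raddf0 scale0r addr0 add0r scalerDr scalerA [_ * 'i]mulrC.
Qed.

Lemma I_zeroE : I0 = quat K 0 0 0 1.
Proof. by rewrite /quat raddf0 !scale0r !add0r scale1r. Qed.

Lemma I_minusE : Im = quat K 0 (- 2^-1) ('i / 2) 0.
Proof.
rewrite /quat /I_minus raddf0 scale0r addr0 add0r scalerBr scalerA opprB.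
by rewrite addrC scaleNr [_ * 'i]mulrC.
Qed.

Lemma I_skew : (Ip^T *m G = - (G *m Ip)) * (I0^T *m G = - (G *m I0)) *
  (Im^T *m G = - (G *m Im)).
Proof.
have sk b c d : (quat K 0 b c d)^T *m G = - (G *m quat K 0 b c d).
  rewrite /quat raddf0 add0r !trmxD !trmxZ !mulmxDl !mulmxDr -!scalemxAl.
  by rewrite -!scalemxAr !cpx_skew !scalerN !opprD.
by rewrite I_plusE I_zeroE I_minusE; split; [split|]; exact: sk.
Qed.

(** The endomorphism [J] with [tw_omega = G J], in homogeneous coordinates
    [(s, t)] on the twistor line with [zeta = t / s]. *)
Definition J_hom (s t : C) : 'M[C]_n := s ^+ 2 *: Ip + (s * t) *: I0 + t ^+ 2 *: Im.

Lemma J_homE s t : J_hom s t =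
  quat K 0 ((s ^+ 2 - t ^+ 2) / 2) ('i * (s ^+ 2 + t ^+ 2) / 2) (s * t).
Proof.
rewrite /J_hom I_plusE I_zeroE I_minusE !quatZ !quatD.
by have [-> -> -> ->] := J_coef s t ('i : C).
Qed.

Lemma J_hom_skew s t : (J_hom s t)^T *m G = - (G *m J_hom s t).
Proof.
have [[h1 h2] h3] := I_skew; move: h1 h2 h3; rewrite /J_hom.
move: Ip I0 Im => P Z Q hP hZ hQ.
rewrite !trmxD !trmxZ !mulmxDl !mulmxDr -!scalemxAl -!scalemxAr hP hZ hQ.
by rewrite !scalerN !opprD.
Qed.

(** Homogeneous coordinates of the point with coordinate [z] in the copy [b]
    of the plane. *)
Definition hom_pt (b : bool) (z : C) : C * C := if b then (z, 1) else (1, z).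

Lemma tw_omegaE b z :
  tw_omega hk b z a y = G *m J_hom (hom_pt b z).1 (hom_pt b z).2.
Proof.
have oE r : omega_k hk r a y = G *m Kr r by rewrite /omega_k -map_mxM.
have opE : omega_plus hk a y = G *m Ip.
  by rewrite /omega_plus /I_plus !oE -scalemxAr mulmxDr -scalemxAr.
have omE : omega_minus hk a y = G *m Im.
  by rewrite /omega_minus /I_minus !oE mulmxN -scalemxAr mulmxBr -scalemxAr.
have ozE : omega_zero hk a y = G *m I0 by rewrite /omega_zero oE.
rewrite /tw_omega opE omE ozE /J_hom; case: b => /=.
  rewrite expr1n scale1r mulr1 !mulmxDr -!scalemxAr.
  by move: (G *m Ip) (G *m I0) (G *m Im) => P Z Q; rewrite [LHS]addrC [Q + _]addrC addrA.
by rewrite expr1n scale1r mul1r !mulmxDr -!scalemxAr.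
Qed.

Lemma tw_omega_alt b z : (tw_omega hk b z a y)^T = - tw_omega hk b z a y.
Proof.
by rewrite tw_omegaE trmx_mul met_csym J_hom_skew.
Qed.

Local Notation Iu b z := (cmx (I_sphere hk (sphere_pt b z) a y)).

Lemma I_sphereE b z : Iu b z =
  quat K 0 (sphere_pt b z 0 0)%:C (sphere_pt b z 0 1)%:C (sphere_pt b z 0 2)%:C.
Proof.
by rewrite /I_sphere /quat raddf0 add0r sum3 /cmx !map_mxD !map_mxZ.
Qed.

Lemma I_sphere_sqr b z : Iu b z *m Iu b z = - 1%:M.
Proof.
rewrite I_sphereE (quat_sqr cpx_csqr cpx_cmul).
have := congr1 (real_complex R) (sphere_pt_norm b z).
by rewrite sum3 !rmorphD !rmorphXn rmorph1 /= !expr2 => ->; rewrite raddfN.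
Qed.

Let hom_norm (b : bool) (z : C) : let st := hom_pt b z in
  st.1 * conjc st.1 + st.2 * conjc st.2 != 0.
Proof.
have h (u : C) : 1 + u * conjc u != 0 by rewrite gt_eqF// ltr_pwDl// mulcJ_ge0.
by case: b; rewrite /= oppr0 mulr1 ?[_ + 1]addrC h.
Qed.

(** The inverse stereographic projection, homogenized. *)
Lemma sphere_coef b z : let s := (hom_pt b z).1 in let t := (hom_pt b z).2 in
  let N := s * conjc s + t * conjc t in
  [/\ (sphere_pt b z 0 0)%:C = - (t * conjc s + conjc t * s) / N,
      (sphere_pt b z 0 1)%:C = 'i * (t * conjc s - conjc t * s) / N &
      (sphere_pt b z 0 2)%:C = (s * conjc s - t * conjc t) / N].
Proof.
move=> s t N; have N0 : N != 0 := hom_norm b z.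
have h p q : 1 + (p ^+ 2 + q ^+ 2) != 0 :> R.
  by rewrite gt_eqF// ltr_pwDl// addr_ge0// sqr_ge0.
have NE : N = let: p +i* q := z in (1 + (p ^+ 2 + q ^+ 2))%:C.
  rewrite /N /s /t {s t N N0}; case: z b => p q [] /=; apply: eq_ReIm => /=; ring.
rewrite {}/N in N0 NE *; rewrite {}/s {}/t in N0 NE *.
split; apply: (mulIf N0); rewrite divfK//; rewrite NE /sphere_pt {N0 NE};
  case: z b => p q [] /=; rewrite !mxE /=; apply: eq_ReIm => /=; field; exact: h.
Qed.

(** Hence [J] kills the vectors of type (0,1); by [sphere_J] it kills no others. *)
Lemma J_sphere b z : let st := hom_pt b z in
  J_hom st.1 st.2 *m Iu b z = 'i *: J_hom st.1 st.2.
Proof.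
move=> st; rewrite I_sphereE J_homE; have [-> -> ->] := sphere_coef b z.
apply: (quat_J_sphere cpx_csqr cpx_cmul mul_i_i); exact: hom_norm.
Qed.

Lemma sphere_J b z : exists N, Iu b z + 'i%:M = N *m J_hom (hom_pt b z).1 (hom_pt b z).2.
Proof.
have := quat_sphere_J cpx_csqr cpx_cmul mul_i_i (hom_norm b z).
rewrite -J_homE; have [<- <- <-] := sphere_coef b z.
move=> E; eexists; apply: etrans E.
rewrite I_sphereE /quat raddf0 add0r.
move: ('i%:M) (_ *: Kr 0) (_ *: Kr 1) (_ *: Kr 2) => P Q S T.
by rewrite [LHS]addrC !addrA.
Qed.

Lemma type01P b z v : type01 hk b z a y v <->
  J_hom (hom_pt b z).1 (hom_pt b z).2 *m v = 0.
Proof.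
split=> [tv|Jv].
  have := congr1 (mulmx^~ v) (J_sphere b z); rewrite /= -mulmxA [Iu b z *m v]tv.
  rewrite -scalemxAr -scalemxAl; move: (_ *m v) => w /eqP.
  rewrite scaleNr eq_sym -addr_eq0 -scalerDl scaler_eq0 => /orP[|/eqP//].
  by rewrite -mulr2n mulrn_eq0 (negPf i_neq0).
have [N NE] := sphere_J b z; have := congr1 (mulmx^~ v) NE.
rewrite /= -mulmxA Jv mulmx0 mulmxDl mul_scalar_mx => /eqP.
by rewrite addr_eq0 -scaleNr => /eqP.
Qed.

(** The vectors of type (0,1) are the kernel of the canonical 2-form: this is how
    the holomorphy of a vertical vector field is read off its contraction with
    that form. *)
Lemma tw_omega_ker b z v :
  v^T *m tw_omega hk b z a y = 0 <-> type01 hk b z a y v.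
Proof.
rewrite type01P tw_omegaE; move: (J_hom_skew (hom_pt b z).1 (hom_pt b z).2).
move: (J_hom _ _) => J Jsk; have E : v^T *m (G *m J) = - ((J *m v)^T *m G).
  by rewrite trmx_mul -mulmxA Jsk mulmxN opprK.
rewrite E; split=> [/eqP|->]; last by rewrite trmx0 mul0mx oppr0.
rewrite oppr_eq0 => /eqP/(congr1 (mulmx^~ (invmx G))).
rewrite /= mulmxK ?met_cunit// mul0mx => /(congr1 trmx).
by rewrite trmxK trmx0.
Qed.

Lemma proj10E b z v : proj10 hk b z a y v = 2^-1 *: (v - 'i *: (Iu b z *m v)).
Proof. by []. Qed.

Lemma type10_proj10 b z v : type10 hk b z a y (proj10 hk b z a y v).
Proof.
rewrite /type10 proj10E -scalemxAr mulmxBr -scalemxAr mulmxA I_sphere_sqr.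
rewrite mulNmx mul1mx scalerN opprK [RHS]scalerA mulrC -[RHS]scalerA; congr (_ *: _).
by rewrite scalerBr scalerA mul_i_i scaleN1r opprK addrC.
Qed.

(** The projection differs from the identity by a vector of type (0,1). *)
Lemma proj10_omega b z v : (proj10 hk b z a y v)^T *m tw_omega hk b z a y =
  v^T *m tw_omega hk b z a y.
Proof.
apply/eqP; rewrite -subr_eq0 -mulmxBl -linearB /=; apply/eqP/tw_omega_ker/type01P.
rewrite mulmxBr proj10E -scalemxAr mulmxBr -scalemxAr mulmxA J_sphere.
rewrite -scalemxAl; move: (_ *m v) => w.
rewrite scalerA mul_i_i scaleN1r opprK -mulr2n -[w *+ 2]scaler_nat scalerA mulVf ?two_neq0//.
by rewrite scale1r subrr.
Qed.

End Point.
End Pointwise.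

(** * Adapted frames *)

Lemma mx11_eq (T : Type) (u v : 'M[T]_1) : u 0 0 = v 0 0 -> u = v.
Proof. by move=> h; apply/matrixP => p q; rewrite (ord1 p) (ord1 q). Qed.

Section Frames.
Context {R : realType} {m : nat} {M : topologicalType}.
Context {A : smooth_atlas R (4 * m) M}.
Variable hk : hyperkahler A.
Local Notation C := R[i].
Local Notation n := (4 * m)%N.

Section Point.
Variables (a : chart A) (y : 'cV[R]_n).
Hypothesis hy : img a y.
Local Notation G := (cmx (met hk a y)).
Local Notation Kr r := (cmx (cpx hk r a y)).
Local Notation Ip := (I_plus hk a y).
Local Notation I0 := (I_zero hk a y).
Local Notation Im := (I_minus hk a y).

Section Adapted.
Variable e : frame R m.
Hypothesis he : adapted hk a y e.

Lemma adapted_cpx D :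
  [/\ Kr 0 *m vec e D 0 = - 'i *: vec e D 1, Kr 0 *m vec e D 1 = - 'i *: vec e D 0,
      Kr 1 *m vec e D 0 = vec e D 1 & Kr 1 *m vec e D 1 = - vec e D 0].
Proof.
case: he => _ _ _ _ h; split; rewrite h sum2 /pauli !mxE /=.
- by rewrite mulr0 scale0r add0r mulr1.
- by rewrite mulr0 scale0r addr0 mulr1.
- by rewrite mulr0 scale0r add0r mulNr mul_i_i opprK scale1r.
- by rewrite mulr0 scale0r addr0 mulrNN mul_i_i scaleN1r.
Qed.

Lemma adapted_I D :
  [/\ Ip *m vec e D 0 = 0, I0 *m vec e D 0 = - 'i *: vec e D 0 &
      Im *m vec e D 0 = 'i *: vec e D 1] /\
  [/\ Ip *m vec e D 1 = - 'i *: vec e D 0, I0 *m vec e D 1 = 'i *: vec e D 1 &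
      Im *m vec e D 1 = 0].
Proof.
have [h00 h01 h10 h11] := adapted_cpx D.
have t0 := @two_neq0 R.
have dbl (V : lmodType C) (c : C) (v : V) : 2^-1 *: (c *: v + c *: v) = c *: v.
  by rewrite -scalerDl scalerA -mulr2n -[c *+ 2]mulr_natl mulrA mulVf// mul1r.
split; split.
- by rewrite /I_plus -scalemxAl mulmxDl -scalemxAl h00 h10 scaleNr addNr scaler0.
- by case: he => _ _ _ _ h; rewrite /I_zero h sum2 /pauli !mxE /= mulr1 mulr0 scale0r addr0.
- rewrite /I_minus mulNmx -scalemxAl mulmxBl -scalemxAl h00 h10 scaleNr -opprD.
  by rewrite scalerN opprK dbl.
- by rewrite /I_plus -scalemxAl mulmxDl -scalemxAl h01 h11 scalerN -scaleNr dbl.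
- by case: he => _ _ _ _ h; rewrite /I_zero h sum2 /pauli !mxE /= mulrN1 mulr0 scale0r add0r opprK.
- rewrite /I_minus mulNmx -scalemxAl mulmxBl -scalemxAl h01 h11 scalerN opprK.
  by rewrite scaleNr addNr scaler0 oppr0.
Qed.

(** The values on a frame of the covectors which occur both in the recursion and
    in the definition of the Killing vector fields. *)
Lemma adapted_form (r r' r'' : 'rV[C]_n) D :
  let f := r *m Ip + r' *m I0 + r'' *m Im in
  (f *m vec e D 0) 0 0 = - 'i * (r' *m vec e D 0) 0 0 + 'i * (r'' *m vec e D 1) 0 0 /\
  (f *m vec e D 1) 0 0 = - 'i * (r *m vec e D 0) 0 0 + 'i * (r' *m vec e D 1) 0 0.
Proof.
have [[p0 z0 m0] [p1 z1 m1]] := adapted_I D.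
have evD (x x' : 'rV[C]_n) D' : ((x + x') *m vec e D D') 0 0 =
    (x *m vec e D D') 0 0 + (x' *m vec e D D') 0 0 by rewrite mulmxDl mxE.
have evR (x : 'rV[C]_n) c D' : (x *m (c *: vec e D D')) 0 0 = c * (x *m vec e D D') 0 0.
  by rewrite -scalemxAr mxE.
split; rewrite !evD -!mulmxA.
  have -> : (r *m (Ip *m vec e D 0)) 0 0 = 0 by rewrite p0 mulmx0 mxE.
  have -> : (r' *m (I0 *m vec e D 0)) 0 0 = - 'i * (r' *m vec e D 0) 0 0 by rewrite z0 evR.
  have -> : (r'' *m (Im *m vec e D 0)) 0 0 = 'i * (r'' *m vec e D 1) 0 0 by rewrite m0 evR.
  by rewrite add0r.
have -> : (r *m (Ip *m vec e D 1)) 0 0 = - 'i * (r *m vec e D 0) 0 0 by rewrite p1 evR.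
have -> : (r' *m (I0 *m vec e D 1)) 0 0 = 'i * (r' *m vec e D 1) 0 0 by rewrite z1 evR.
have -> : (r'' *m (Im *m vec e D 1)) 0 0 = 0 by rewrite m1 mulmx0 mxE.
by rewrite addr0.
Qed.

Lemma adapted_row_eq p (r r' : 'M[C]_(p, n)) :
  (forall B, r *m vec e B 0 = r' *m vec e B 0) ->
  (forall B, r *m vec e B 1 = r' *m vec e B 1) -> r = r'.
Proof.
move=> h0 h1; have h (v : 'cV[C]_n) : r *m v = r' *m v.
  case: he => _ _ /(_ v)[c ->] _ _; rewrite !mulmx_sumr; apply: eq_bigr => B _.
  by rewrite !mulmx_sumr !sum2 -!scalemxAr h0 h1.
by apply/matrixP => i k; have := h (delta_mx k 0); rewrite -!colE => /colP/(_ i); rewrite !mxE.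
Qed.

End Adapted.

Let P0 : 'M[C]_n := 2^-1 *: (1%:M + 'i *: Kr 2).
Let P1 : 'M[C]_n := 2^-1 *: (1%:M - 'i *: Kr 2).

Let P01 : P0 + P1 = 1%:M.
Proof.
rewrite /P0 /P1 -scalerDr addrACA subrr addr0 -mulr2n -[1%:M *+ 2]scaler_nat scalerA.
by rewrite mulVf ?two_neq0// scale1r.
Qed.

Let P0_P1 : P0 *m P1 = 0.
Proof.
have XX : ('i *: Kr 2) *m ('i *: Kr 2) = 1%:M.
  by rewrite -scalemxAl -scalemxAr scalerA mul_i_i cpx_csqr// scaleN1r opprK.
rewrite /P0 /P1; move: XX; move: ('i *: Kr 2) => X XX.
rewrite -scalemxAl -scalemxAr mulmxBr mulmx1 mulmxDl mul1mx XX.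
by rewrite [X + _]addrC subrr !scaler0.
Qed.

Let P0_idem : P0 *m P0 = P0.
Proof.
have := congr1 (mulmx P0) P01; rewrite mulmxDr P0_P1 addr0 mulmx1.
by [].
Qed.

Let K1_P1 : Kr 1 *m P1 = P0 *m Kr 1.
Proof.
rewrite /P0 /P1 -scalemxAr -scalemxAl mulmxBr mulmxDl mulmx1 mul1mx.
rewrite -scalemxAr -scalemxAl (K12 (cpx_csqr hk hy) (cpx_cmul hk hy)).
by rewrite (K21 (cpx_csqr hk hy) (cpx_cmul hk hy)) scalerN.
Qed.

Let K1_unit : Kr 1 \in unitmx.
Proof.
have : Kr 1 *m - Kr 1 = 1%:M by rewrite mulmxN cpx_csqr// opprK.
by case/mulmx1_unit.
Qed.

Let P0_rank : \rank P0 = (2 * m)%N.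
Proof.
have r01 : \rank P1 = \rank P0.
  rewrite -[RHS](mxrankMfree _ (_ : row_free (Kr 1))) ?row_free_unit//.
  by rewrite -K1_P1 -[RHS]mxrank_tr trmx_mul mxrankMfree ?mxrank_tr ?row_free_unit ?unitmx_tr.
have le1 : (\rank P0 + \rank P1 <= n)%N by exact: mulmx0_rank_max.
have le2 : (n <= \rank P0 + \rank P1)%N.
  by rewrite -[leqLHS](@mxrank1 C) -P01 mxrank_add.
by move: le1 le2; rewrite r01; lia.
Qed.

(** The first half of the frame is a basis of the eigenspace of [I_3] for the
    eigenvalue [-i] (of dimension [2m], since [I_2] exchanges the two
    eigenspaces), and [I_2] maps it to the second half. The eigenspaces are
    isotropic, so that the metric reduces to the skew form [g(v, I_2 w)] on the
    first one, which is non-degenerate because the metric is. *)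
Lemma adapted_exists : exists e, adapted hk a y e.
Proof.
have [E EP] : exists E : 'M[C]_(2 * m, n), (E :=: P0^T)%MS.
  have r0 : \rank P0^T = (2 * m)%N by rewrite mxrank_tr.
  exists (castmx (r0, erefl) (row_base P0^T)).
  exact: eqmx_trans (eqmx_cast _ _) (eq_row_base _).
have Efree : row_free E by rewrite /row_free EP mxrank_tr P0_rank.
pose v0 D : 'cV[C]_n := (row D E)^T.
pose v1 D : 'cV[C]_n := Kr 1 *m v0 D.
pose eps : 'M[C]_(2 * m) := \matrix_(B, D) ((v0 B)^T *m G *m v1 D) 0 0.
pose e := Frame (fun D (D' : 'I_2) => if D' == 0 then v0 D else v1 D) eps.
have P0v0 D : P0 *m v0 D = v0 D.
  have /submxP[x xE] : (row D E <= P0^T)%MS by rewrite -EP row_sub.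
  by apply: trmx_inj; rewrite trmx_mul trmxK xE -mulmxA -trmx_mul P0_idem.
have K2v0 D : Kr 2 *m v0 D = - 'i *: v0 D.
  have := P0v0 D; rewrite /P0 -scalemxAl mulmxDl mul1mx -scalemxAl.
  move/(congr1 ( *:%R 2)); rewrite scalerA mulfV ?two_neq0// scale1r.
  rewrite scaler_nat mulr2n => /addrI /(congr1 ( *:%R (- 'i))).
  by rewrite scalerA mulNr mul_i_i opprK scale1r.
have K2v1 D : Kr 2 *m v1 D = 'i *: v1 D.
  rewrite /v1 mulmxA (K21 (cpx_csqr hk hy) (cpx_cmul hk hy)).
  rewrite -(K12 (cpx_csqr hk hy) (cpx_cmul hk hy)) mulNmx -mulmxA K2v0.
  by rewrite -scalemxAr scaleNr opprK.
have K0v0 D : Kr 0 *m v0 D = - 'i *: v1 D.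
  rewrite -(K12 (cpx_csqr hk hy) (cpx_cmul hk hy)) -mulmxA K2v0.
  by rewrite -scalemxAr.
have K1v1 D : Kr 1 *m v1 D = - v0 D by rewrite /v1 mulmxA cpx_csqr// mulNmx mul1mx.
have K0v1 D : Kr 0 *m v1 D = - 'i *: v0 D.
  rewrite -(K12 (cpx_csqr hk hy) (cpx_cmul hk hy)) -mulmxA K2v1.
  by rewrite -scalemxAr K1v1 scalerN scaleNr.
have skew r (u w : 'cV[C]_n) : (Kr r *m u)^T *m G *m w = - (u^T *m G *m (Kr r *m w)).
  by rewrite trmx_mul -!mulmxA [_ *m (G *m w)]mulmxA cpx_skew// mulNmx mulmxN !mulmxA.
have sym (u w : 'cV[C]_n) : (u^T *m G *m w) 0 0 = (w^T *m G *m u) 0 0.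
  have -> : (u^T *m G *m w) 0 0 = ((u^T *m G *m w)^T) 0 0 by rewrite [RHS]mxE.
  by rewrite !trmx_mul trmxK met_csym// mulmxA.
have iso D F : (v0 D)^T *m G *m v0 F = 0.
  have := skew 2 (v0 D) (v0 F); rewrite !K2v0 trmxZ -!scalemxAl -scalemxAr.
  move: (_ *m v0 F) => x /eqP; rewrite !scaleNr opprK eq_sym -addr_eq0 -scalerDl.
  by rewrite scaler_eq0 -mulr2n mulrn_eq0 (negPf i_neq0) => /eqP.
have iso1 D F : (v1 D)^T *m G *m v1 F = 0 by rewrite {1}/v1 skew K1v1 mulmxN opprK iso.
have epsE' B D : eps B D = ((v0 B)^T *m G *m v1 D) 0 0 by rewrite mxE.
have epsN B D : eps D B = - eps B D.
  have := skew 1 (v0 B) (v0 D); rewrite -/(v1 B) -/(v1 D) => /matrixP/(_ 0 0).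
  by rewrite [RHS]mxE sym -!epsE'.
have span0 (v : 'cV[C]_n) : exists c : 'I_(2 * m) -> C, P0 *m v = \sum_D c D *: v0 D.
  have /submxP[x xE] : (v^T *m P0^T <= E)%MS by rewrite EP submxMl.
  exists (fun D => x 0 D); apply: trmx_inj; rewrite trmx_mul xE mulmx_sum_row linear_sum.
  by apply: eq_bigr => D _; rewrite /= trmxZ trmxK.
have span (v : 'cV[C]_n) : exists c c' : 'I_(2 * m) -> C,
    v = \sum_D c D *: v0 D + \sum_D c' D *: v1 D.
  have [c cE] := span0 v; have [c' cE'] := span0 (- (Kr 1 *m v)).
  exists c, c'; rewrite -cE -[LHS]mul1mx -P01 mulmxDl; congr (_ + _).
  have -> : P1 *m v = Kr 1 *m (P0 *m - (Kr 1 *m v)).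
    by rewrite !mulmxN [P0 *m _]mulmxA -K1_P1 !mulmxA cpx_csqr// !mulNmx mul1mx opprK.
  rewrite cE' mulmx_sumr.
  by apply: eq_bigr => D _; rewrite -scalemxAr.
exists e; split.
- rewrite -row_free_unit -kermx_eq0; apply/rowV0P => x /sub_kermxP xe.
  pose u : 'cV[C]_n := (x *m E)^T.
  have uE : u = \sum_D x 0 D *: v0 D.
    rewrite /u mulmx_sum_row linear_sum; apply: eq_bigr => D _.
    by rewrite /= trmxZ.
  have uG : u^T *m G = 0.
    apply/matrixP => i k; have [c [c' E']] := span (delta_mx k 0).
    have : u^T *m G *m (delta_mx k 0 : 'cV[C]_n) = 0.
      rewrite [delta_mx _ _]E' mulmxDr !mulmx_sumr !big1 ?addr0// => D _; rewrite -scalemxAr.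
        rewrite (_ : u^T *m G *m v1 D = 0) ?scaler0//.
        have := congr1 (fun X : 'rV_(2 * m) => X 0 D) xe; rewrite mxE [RHS]mxE => xe0.
        apply/matrixP => p q; rewrite (ord1 p) (ord1 q) [RHS]mxE -xe0 uE linear_sum.
        rewrite !mulmx_suml summxE; apply: eq_bigr => B _.
        by rewrite epsE' /= trmxZ -!scalemxAl mxE.
      rewrite uE linear_sum !mulmx_suml big1 ?scaler0// => B _.
      by rewrite /= trmxZ -!scalemxAl iso scaler0.
    by rewrite -colE => /colP/(_ i); rewrite !mxE.
  have u0 : u^T = 0 by rewrite -[u^T](mulmxK (met_cunit hk hy)) uG mul0mx.
  have : x *m E = 0 by rewrite -u0 trmxK.
  by move=> h; apply: (row_free_inj Efree); rewrite mul0mx.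
- by apply/matrixP => B D; rewrite [LHS]mxE [RHS]mxE epsN.
- move=> v; have [c [c' vE]] := span v.
  exists (fun B B' => if B' == 0 then c B else c' B).
  by rewrite {1}vE -big_split; apply: eq_bigr => B _; rewrite sum2.
- move=> B B' D D'; rewrite /epsH [epsE e B D]/(eps B D) [X in _ * X]mxE; move: B' D'.
  apply: ord2P; apply: ord2P => /=.
  + by rewrite iso mxE mulr0.
  + by rewrite mulr1; exact/esym/epsE'.
  + by rewrite sym mulrN1; exact: etrans (esym (epsE' D B)) (epsN B D).
  + by rewrite iso1 mxE mulr0.
- apply: ord3P => D; apply: ord2P; rewrite sum2 /pauli !mxE /=.
  + by rewrite mulr0 scale0r add0r mulr1.
  + by rewrite mulr0 scale0r addr0 mulr1.
  + by rewrite mulr0 scale0r add0r mulNr mul_i_i opprK scale1r.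
  + by rewrite mulr0 scale0r addr0 mulrNN mul_i_i scaleN1r.
  + by rewrite mulr0 scale0r addr0 mulr1.
  + by rewrite mulr0 scale0r add0r mulrN1 opprK.
Qed.

End Point.
End Frames.

(** * Symmetrization and Pascal's rule *)

Section Combinatorics.
Context {R : realType}.
Local Notation C := R[i].

(** Composition with a transposition exchanges the two sets of permutations. *)
Lemma card_perm_fixed_value N (i : 'I_N.+1) :
  #|[pred s : 'S_N.+1 | s ord0 == i]| = #|[pred s : 'S_N.+1 | s ord0 == ord0]|.
Proof.
rewrite -!sum1_card (reindex_inj (mulIg (tperm ord0 i))) /=.
apply: eq_bigl => s; rewrite !inE permM.
by rewrite -(inj_eq (@perm_inj _ (tperm ord0 i))) tpermK tpermR.
Qed.

(** A permutation sends the first index to each of the indices equally often,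
    and the value of the summand depends only on that index. *)
Lemma symmetrize_head (T : seq 'I_2 -> C) (g : 'I_2 -> C) (t : seq 'I_2) r :
  size t = r.+1 ->
  (forall x u, perm_eq (x :: u) t -> T (x :: u) = g x) ->
  symmetrize T t = 0 -> \sum_(x <- t) g x = 0.
Proof.
move=> st Tg.
have -> : \sum_(x <- t) g x = \sum_(i < size t) g (nth 0 t i).
  by rewrite (big_nth 0) big_mkord.
have tE : t = [seq nth 0 t (i : 'I_(size t)) | i <- enum 'I_(size t)].
  by rewrite -{1}(mkseq_nth 0 t) /mkseq -val_enum_ord -map_comp.
rewrite /symmetrize; move: tE; move: (size t) st => N ->{N} tE /eqP.
rewrite mulf_eq0 invr_eq0 pnatr_eq0 -leqn0 leqNgt fact_gt0 /= => /eqP.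
have -> : \sum_(s : 'S_r.+1) T [seq nth 0 t (s p) | p <- enum 'I_r.+1] =
          \sum_(s : 'S_r.+1) g (nth 0 t (s ord0)).
  apply: eq_bigr => s _.
  have : perm_eq [seq nth 0 t (s p) | p <- enum 'I_r.+1] t.
    rewrite {2}tE (map_comp (fun i : 'I_r.+1 => nth 0 t i) s); apply: perm_map.
    apply: uniq_perm => [||x].
    - by rewrite (map_inj_uniq perm_inj) enum_uniq.
    - exact: enum_uniq.
    rewrite mem_enum inE; apply/mapP; exists ((s^-1)%g x); rewrite ?mem_enum//.
    by rewrite permKV.
  by rewrite enum_ordSl /= => /Tg.
rewrite (partition_big (fun s : 'S_r.+1 => s ord0) xpredT) //=.
have -> : \sum_(i < r.+1) \sum_(s : 'S_r.+1 | s ord0 == i) g (nth 0 t (s ord0)) =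
    (\sum_(i < r.+1) g (nth 0 t i)) *+ #|[pred s : 'S_r.+1 | s ord0 == ord0]|.
  rewrite -sumrMnl; apply: eq_bigr => i _.
  rewrite -(card_perm_fixed_value i) -sumr_const; apply: eq_big => s; rewrite ?inE//.
  by move=> /eqP ->.
move=> /eqP; rewrite mulrn_eq0 => /orP[/eqP h|/eqP//].
have : (1%g : 'S_r.+1) \in [pred s : 'S_r.+1 | s ord0 == ord0] by rewrite inE perm1.
by rewrite (card0_eq h).
Qed.

(** The case of a sequence over two letters, where only the number of
    occurrences of each matters. *)
Lemma symmetrize_zeros_ones (T : seq 'I_2 -> C) (g : 'I_2 -> C) q q' :
  (0 < q + q')%N ->
  (forall x u, perm_eq (x :: u) (nseq q 0 ++ nseq q' 1) -> T (x :: u) = g x) ->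
  symmetrize T (nseq q 0 ++ nseq q' 1) = 0 ->
  q%:R * g 0 + q'%:R * g 1 = 0.
Proof.
move=> q0 Tg /(symmetrize_head (r := (q + q').-1)).
rewrite size_cat !size_nseq prednK// => /(_ _ erefl Tg).
rewrite big_cat !big_nseq /=.
have it (c : C) k : iter k ( +%R c) 0 = k%:R * c.
  by rewrite iter_addr_0 mulr_natl.
by rewrite !it.
Qed.

(** Pascal's rule, summed against an alternating sign. *)
Lemma pascal_sum N (sg u : nat -> C) : (forall p, sg p.+1 = - sg p) ->
  \sum_(p < N.+1) 'C(N, p)%:R * sg p * (u p.+1 - u p) =
  - \sum_(p < N.+2) 'C(N.+1, p)%:R * sg p * u p.
Proof.
move=> sgS; rewrite [in RHS]big_ord_recl /= bin0.
under [in RHS]eq_bigr do rewrite binS natrD mulrDl mulrDl.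
rewrite big_split /= [X in _ + (X + _)]big_ord_recr /= bin_small// !mul0r addr0.
under [X in _ + (_ + X)]eq_bigr do rewrite sgS mulrN mulNr.
under [X in X = _]eq_bigr do rewrite mulrBr.
rewrite sumrB sumrN; rewrite [X in _ - X = _]big_ord_recl /= bin0.
by rewrite !opprD opprK; ring.
Qed.

End Combinatorics.

(** * The Killing equation in a frame *)

Section KillingFields.
Context {R : realType} {m : nat} {M : topologicalType}.
Context {A : smooth_atlas R (4 * m) M}.
Variable hk : hyperkahler A.
Local Notation C := R[i].
Local Notation n := (4 * m)%N.
Variables (i : nat) (mu : Htensor R M).
Local Notation j := i.+1.
Hypothesis hmu : killing_tensor hk (2 * j) mu.

(** A symmetric tensor is determined by its components on these sequences. *)
Definition zeros_ones (r k : nat) : seq 'I_2 := nseq k 0 ++ nseq (r - k) 1.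

Lemma size_zeros_ones r k : (k <= r)%N -> size (zeros_ones r k) = r.
Proof. by move=> kr; rewrite size_cat !size_nseq subnKC. Qed.

Lemma eps_upH : eps_up (epsH R) = epsH R.
Proof.
rewrite /eps_up; have E : (epsH R)^T *m epsH R = 1%:M.
  apply/matrixP => p q; rewrite !mxE sum2 /epsH !mxE; move: p q.
  by apply: ord2P; apply: ord2P; rewrite /= ?(mulr0, mul0r, mulN1r, mulr1, opprK, addr0, add0r).
have [u _] := mulmx1_unit E.
by rewrite -[LHS]mulmx1 -E mulKmx.
Qed.

Local Notation mu_ k := (mu (zeros_ones (2 * j) k)).
Local Notation cj := ((2 * j)%:R / (2 * j).+1%:R : C).

Lemma dfunZ (c : C) (f : M -> C) (a : chart A) y : csmooth_fun_on A setT f -> img a y ->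
  dfun (fun x => c * f x) a y = c *: dfun f a y.
Proof.
move=> /(_ a); rewrite setIT => fs hy; apply/rowP => k; rewrite !mxE.
exact: (@cDZ _ _ (img a) (@img_open _ _ _ A a) c (f \o crd_inv a) _ y fs hy).
Qed.

Lemma mu_smooth t : size t = (2 * j)%N -> csmooth_fun_on A setT (mu t).
Proof. by case: hmu => h _ _ /h. Qed.

Lemma mu_perm t s : size t = (2 * j)%N -> perm_eq t s -> mu t = mu s.
Proof. by case: hmu => _ h _ /h; apply. Qed.

Section Point.
Variables (a : chart A) (y : 'cV[R]_n).
Hypothesis hy : img a y.
Local Notation G := (cmx (met hk a y)).
Local Notation Ip := (I_plus hk a y).
Local Notation I0 := (I_zero hk a y).
Local Notation Im := (I_minus hk a y).

Section Adapted.
Variable e : frame R m.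
Hypothesis he : adapted hk a y e.

(** Among the [2j + 1] indices of the symmetrized derivative, [k + 1] are equal
    to [0'] and [2j - k] to [1']; the derivation index is any of them. The case
    where all the indices are [1'] is [killing_frame0]. *)
Lemma killing_frame B k : (k <= 2 * j)%N ->
  k.+1%:R * nabla a y e B 0 (mu_ k) + (2 * j - k)%:R * nabla a y e B 1 (mu_ k.+1) = 0.
Proof.
move=> kj; case: hmu => _ _ /(_ a y e hy he B).
move=> /(_ (nseq k.+1 0 ++ nseq (2 * j - k) 1)).
rewrite size_cat !size_nseq addSn subnKC// => /(_ erefl).
pose g (x : 'I_2) := if x == 0 then nabla a y e B 0 (mu_ k) else nabla a y e B 1 (mu_ k.+1).
move/(@symmetrize_zeros_ones _ _ g); apply; first by [].
move=> x u xu /=; have su : size u = (2 * j)%N.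
  by have /perm_size := xu; rewrite size_cat !size_nseq addSn subnKC// => -[].
move: x xu; apply: ord2P; rewrite /g /= => xu; congr nabla; apply: mu_perm => //.
  by move: xu; rewrite perm_cons.
rewrite -(perm_cons 1) (perm_trans xu)// /zeros_ones.
have [kj'|] := ltnP k (2 * j).
  rewrite [in X in perm_eq X _](_ : (2 * j - k)%N = (2 * j - k.+1).+1); last by lia.
  by rewrite -cat1s perm_catC /= -cat_cons perm_sym -cat1s perm_catCA perm_sym perm_catC.
move=> kj'; have kE : k = (2 * j)%N by lia.
have /perm_mem/(_ 1) := xu; rewrite kE subnn /= cats0 !inE eqxx /=.
by rewrite mem_nseq andbF.
Qed.

Lemma killing_frame0 B : nabla a y e B 1 (mu_ 0) = 0.
Proof.
case: hmu => _ _ /(_ a y e hy he B (nseq (2 * j).+1 1)).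
rewrite size_nseq => /(_ erefl).
pose g (x : 'I_2) := if x == 0 then 0 else nabla a y e B 1 (mu_ 0).
move/(@symmetrize_zeros_ones _ _ g 0 _) => /(_ isT); rewrite mul0r add0r => H.
have /eqP : (2 * j).+1%:R * g 1 = 0.
  apply: H => x u xu /=; have su : size u = (2 * j)%N.
    by have /perm_size := xu; rewrite size_nseq => -[].
  have x1 : x = 1.
    have xu' : perm_eq (x :: u) (nseq (2 * j).+1 1) := xu.
    have : x \in nseq (2 * j).+1 1 by rewrite -(perm_mem xu') mem_head.
    by rewrite mem_nseq => /andP[_ /eqP].
  move: xu; rewrite x1 /g /= => xu; congr nabla; apply: mu_perm => //.
  have xu' : perm_eq (1 :: u) (1 :: nseq (2 * j) 1) := xu.
  by move: xu'; rewrite perm_cons /zeros_ones subn0.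
by rewrite mulf_eq0 pnatr_eq0 /= /g => /eqP.
Qed.

(** Division by [2j - k] in [killing_frame] gives the sequence, which is the tensor
    [X^A] up to a constant. *)
Lemma killing_potential B : exists p : nat -> C,
  (forall k, (k <= 2 * j)%N -> nabla a y e B 0 (mu_ k) = (2 * j - k)%:R * p k) /\
  (forall k, (k < 2 * j)%N -> nabla a y e B 1 (mu_ k.+1) = - (k.+1%:R * p k)).
Proof.
(* For [k = 2j] the divisor is 0, but then the derivative vanishes. *)
exists (fun k => nabla a y e B 0 (mu_ k) / (2 * j - k)%:R); split=> k kj.
  have [kj'|] := ltnP k (2 * j).
    by rewrite [RHS]mulrCA mulfV ?mulr1// pnatr_eq0 -lt0n subn_gt0.
  move=> jk; have kE : k = (2 * j)%N by lia.
  have /eqP := killing_frame B kj; rewrite kE subnn !mul0r addr0 mulf_eq0 pnatr_eq0 /=.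
  by move/eqP.
have d0 : (2 * j - k)%:R != 0 :> C by rewrite pnatr_eq0 -lt0n subn_gt0.
have /eqP := killing_frame B (ltnW kj); rewrite addrC addr_eq0 => /eqP E.
have aux (F : fieldType) (d b c x : F) : d != 0 -> d * b = - (c * x) -> b = - (c * (x / d)).
  by move=> d0' E'; apply: (mulfI d0'); rewrite E'; field.
exact: aux d0 E.
Qed.

End Adapted.

End Point.
End KillingFields.

(** * The covectors of the Killing vector fields *)

Section KillingForms.
Context {R : realType} {m : nat} {M : topologicalType}.
Context {A : smooth_atlas R (4 * m) M}.
Variable hk : hyperkahler A.
Local Notation C := R[i].
Local Notation n := (4 * m)%N.
Variables (i : nat) (mu : Htensor R M).
Local Notation j := i.+1.
Local Notation mu_ k := (mu (zeros_ones (2 * j) k)).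
Local Notation cj := ((2 * j)%:R / (2 * j).+1%:R : C).

(** This is the covector [g(X_t, .)], expressed without a frame, so that [X_t] does
    not depend on the frame and is smooth. *)
Definition killing_form (t : seq 'I_2) (a : chart A) (y : 'cV[R]_n) : 'rV[C]_n :=
  - cj *: (dfun (mu (1 :: 1 :: t)) a y *m I_plus hk a y
           + dfun (mu (0 :: 1 :: t)) a y *m I_zero hk a y
           + dfun (mu (0 :: 0 :: t)) a y *m I_minus hk a y).

Definition sgn (k p : nat) : C := (-1) ^ (p%:Z - k%:Z).

Lemma sgnS k p : sgn k p.+1 = - sgn k p.
Proof.
rewrite /sgn (_ : p.+1%:Z - k%:Z = p%:Z - k%:Z + 1); last by lia.
by rewrite exprzDr ?unitrN1// expr1z mulrN1.
Qed.

Lemma sgnSS k p : sgn k.+1 p.+1 = sgn k p.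
Proof. by rewrite /sgn; congr (_ ^ _); lia. Qed.

(** The components of the tensor and the covectors of its vector fields, with
    indices shifted so as to start from 0. *)
Definition phi (p : nat) (x : M) : C := (sgn j p * 'C(2 * j, p)%:R) * mu_ p x.

Definition xi (p : nat) (a : chart A) (y : 'cV[R]_n) : 'rV[C]_n :=
  (sgn i p * 'C(2 * i, p)%:R) *: killing_form (zeros_ones (2 * i) p) a y.

Hypothesis hmu : killing_tensor hk (2 * j) mu.

Section Point.
Variables (a : chart A) (y : 'cV[R]_n).
Hypothesis hy : img a y.
Local Notation G := (cmx (met hk a y)).

Section Adapted.
Variable e : frame R m.
Hypothesis he : adapted hk a y e.
Local Notation D B B' f := (nabla a y e B B' f).

Lemma killing_form_frame t B : size t = (2 * i)%N ->
  ((killing_form t a y *m vec e B 0) 0 0 =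
    - 'i * cj * (D B 1 (mu (0 :: 0 :: t)) - D B 0 (mu (1 :: 0 :: t)))) *
  ((killing_form t a y *m vec e B 1) 0 0 =
    - 'i * cj * (D B 1 (mu (0 :: 1 :: t)) - D B 0 (mu (1 :: 1 :: t)))).
Proof.
move=> st.
have sw : mu (1 :: 0 :: t) = mu (0 :: 1 :: t).
  by apply: (mu_perm hmu); [rewrite /= st; lia|exact: (introT permPl (perm_catCA [:: 1] [:: 0] t))].
have evZ (c : C) (r : 'rV[C]_n) B' : ((c *: r) *m vec e B B') 0 0 = c * (r *m vec e B B') 0 0.
  by rewrite -scalemxAl mxE.
have [h0 h1] := adapted_form he (dfun (mu (1 :: 1 :: t)) a y) (dfun (mu (0 :: 1 :: t)) a y)
  (dfun (mu (0 :: 0 :: t)) a y) B.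
have aux (c x x' : C) : - c * (- 'i * x + 'i * x') = - 'i * c * (x' - x) by ring.
by rewrite sw /killing_form !evZ h0 h1 !aux.
Qed.

(** Lowering the index of the vector with the metric cancels the inverses of the
    two symplectic forms that were used to raise the indices. *)
Lemma killing_vec_in_form t : size t = (2 * i)%N ->
  (killing_vec_in j mu a y e t)^T *m G = killing_form t a y.
Proof.
move=> st; case: (he) => eu _ _ gram _.
pose w B F' := D B 1 (mu (0 :: F' :: t)) - D B 0 (mu (1 :: F' :: t)).
pose eup := eps_up (epsE e).
have kX B F' : killing_X j mu a y e B (F' :: t) = - 'i * cj * \sum_D0 eup B D0 * w D0 F'.
  rewrite /killing_X; congr (_ * _); rewrite sum2 /nabla_up -big_split; apply: eq_bigr => D0 _.
  rewrite /= !sum2 eps_upH /epsH !mxE /= /w; ring.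
have vE : killing_vec_in j mu a y e t = \sum_B
    (killing_X j mu a y e B (1 :: t) *: vec e B 0 - killing_X j mu a y e B (0 :: t) *: vec e B 1).
  apply: eq_bigr => B _; rewrite sum2 !sum2 eps_upH /epsH !mxE /=.
  by rewrite !mul0r add0r addr0 mul1r mulN1r scaleNr.
have inv F F' : \sum_B killing_X j mu a y e B (F' :: t) * epsE e B F = - 'i * cj * w F F'.
  rewrite (eq_bigr (fun B => (- 'i * cj) * \sum_D0 eup B D0 * w D0 F' * epsE e B F)); last first.
    by move=> B _; rewrite kX -mulr_suml; exact/esym/mulrA.
  rewrite -mulr_sumr; congr (_ * _).
  rewrite exchange_big /= (bigD1 F)//= [X in _ + X]big1 ?addr0 => [|B BF].
    transitivity (((epsE e)^T *m eup) F F * w F F').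
      by rewrite mxE mulr_suml; apply: eq_bigr => B _; rewrite mxE; ring.
    by rewrite mulmxV ?unitmx_tr// mxE eqxx mul1r.
  transitivity (((epsE e)^T *m eup) F B * w B F').
    by rewrite mxE mulr_suml; apply: eq_bigr => D0 _; rewrite mxE; ring.
  by rewrite mulmxV ?unitmx_tr// mxE eq_sym (negPf BF) mul0r.
have entry F F' : ((killing_vec_in j mu a y e t)^T *m G *m vec e F F') 0 0 =
   \sum_B (killing_X j mu a y e B (1 :: t) * (epsE e B F * epsH R 0 F')
     - killing_X j mu a y e B (0 :: t) * (epsE e B F * epsH R 1 F')).
  rewrite vE linear_sum !mulmx_suml summxE; apply: eq_bigr => B _ /=.
  rewrite linearB /= !mulmxBl !trmxZ -!scalemxAl -!gram.
  by rewrite [LHS]mxE [X in _ + X = _]mxE; congr (_ - _); exact: mxE.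
apply: (adapted_row_eq he) => F; apply: mx11_eq; rewrite entry killing_form_frame// -/(w F _) -inv.
  by apply: eq_bigr => B _; rewrite /epsH !mxE /=; ring.
by apply: eq_bigr => B _; rewrite /epsH !mxE /=; ring.
Qed.

End Adapted.

Lemma killing_vecE t : size t = (2 * i)%N ->
  killing_vec hk j mu t a y = invmx G *m (killing_form t a y)^T.
Proof.
move=> st; have key e : adapted hk a y e ->
    killing_vec_in j mu a y e t = invmx G *m (killing_form t a y)^T.
  move=> he; rewrite -(killing_vec_in_form he st) trmx_mul trmxK met_csym//.
  by rewrite mulKmx// met_cunit.
rewrite /killing_vec; case: xgetP => [v _ [e [he ->]]|]; first exact: key.
have [e he] := adapted_exists hk hy.
by move=> /(_ (killing_vec_in j mu a y e t)) []; exists e.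
Qed.

End Point.
End KillingForms.

(** * The Hamiltonian equation in homogeneous coordinates *)

Section Hamiltonian.
Context {R : realType} {m : nat} {M : topologicalType}.
Context {A : smooth_atlas R (4 * m) M}.
Variable hk : hyperkahler A.
Local Notation C := R[i].
Local Notation n := (4 * m)%N.
Variables (i : nat) (mu : Htensor R M).
Local Notation j := i.+1.
Local Notation mu_ k := (mu (zeros_ones (2 * j) k)).
Local Notation cj := ((2 * j)%:R / (2 * j).+1%:R : C).
Local Notation phi := (phi i mu).
Local Notation xi := (xi hk i mu).
Hypothesis hmu : killing_tensor hk (2 * j) mu.

Let E2j : (2 * j = (2 * i).+2)%N. Proof. by lia. Qed.

Lemma sgnSl k p : sgn (R := R) k.+1 p = - sgn k p.
Proof. by rewrite -(sgnSS k p) sgnS opprK. Qed.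

Lemma phi_out p : (2 * j < p)%N -> phi p = cst 0.
Proof. by move=> jp; apply/funext => x; rewrite /phi bin_small// mulr0 mul0r. Qed.

Lemma phi_smooth p : csmooth_fun_on A setT (phi p).
Proof.
have [pj|/phi_out ->] := leqP p (2 * j); last first.
  by move=> a; rewrite setIT; exact: csmooth_cst.
move=> a; have := mu_smooth hmu (size_zeros_ones pj) a; rewrite setIT => ms.
exact: (csmoothM (@img_open _ _ _ A a) (csmooth_cst _ _) ms).
Qed.

Lemma xiE p a y : (p <= 2 * i)%N -> xi p a y = (sgn i p * 'C(2 * i, p)%:R) *: (- cj *:
  (dfun (mu_ p) a y *m I_plus hk a y + dfun (mu_ p.+1) a y *m I_zero hk a y
   + dfun (mu_ p.+2) a y *m I_minus hk a y)).
Proof.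
move=> pi; rewrite /xi /killing_form.
have st : size (zeros_ones (2 * i) p) = (2 * i)%N by exact: size_zeros_ones.
have pc s t : size s = (2 * j)%N -> perm_eq s t -> mu s = mu t by exact: (mu_perm hmu).
have -> : mu (1 :: 1 :: zeros_ones (2 * i) p) = mu_ p.
  apply: pc; first by rewrite /= st; lia.
  rewrite /zeros_ones (_ : (2 * j - p)%N = (2 * i - p).+2); last by lia.
  exact: (introT permPl (perm_catCA [:: 1; 1] (nseq p 0) (nseq (2 * i - p) 1))).
have -> : mu (0 :: 1 :: zeros_ones (2 * i) p) = mu_ p.+1.
  apply: pc; first by rewrite /= st; lia.
  rewrite /zeros_ones (_ : (2 * j - p.+1)%N = (2 * i - p).+1); last by lia.
  rewrite /= perm_cons.
  exact: (introT permPl (perm_catCA [:: 1] (nseq p 0) (nseq (2 * i - p) 1))).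
have -> : mu (0 :: 0 :: zeros_ones (2 * i) p) = mu_ p.+2.
  by congr mu; rewrite /zeros_ones (_ : (2 * j - p.+2)%N = (2 * i - p)%N) //; lia.
by [].
Qed.

Section Point.
Variables (a : chart A) (y : 'cV[R]_n).
Hypothesis hy : img a y.
Local Notation J := (J_hom hk a y).

Lemma dfun_phi p : (p <= 2 * j)%N ->
  dfun (phi p) a y = (sgn j p * 'C(2 * j, p)%:R) *: dfun (mu_ p) a y.
Proof. by move=> pj; apply: dfunZ hy; apply: (mu_smooth hmu); exact: size_zeros_ones. Qed.

Lemma dfun_phi_out p : (2 * j < p)%N -> dfun (phi p) a y = 0.
Proof.
by move=> /phi_out ->; apply/rowP => k; rewrite !mxE; exact: cD_cst.
Qed.

Section Adapted.
Variable e : frame R m.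
Hypothesis he : adapted hk a y e.
Local Notation ev r B B' := ((r *m vec e B B') 0 0).

(** All the derivatives and covectors along a pair [e_B0, e_B1] in terms of the
    common potential; the factors [2j - k] and [k + 1] turn the binomial
    coefficients of order [2j] into those of order [2j - 1]. *)
Lemma phi_frame B : exists P : nat -> C,
  [/\ forall p, (p <= 2 * j)%N -> ev (dfun (phi p) a y) B 0 =
        - ((2 * j)%:R * sgn i p * 'C((2 * i).+1, p)%:R * P p),
      forall p, (p < 2 * j)%N -> ev (dfun (phi p.+1) a y) B 1 =
        - ((2 * j)%:R * sgn i p * 'C((2 * i).+1, p)%:R * P p),
      ev (dfun (phi 0) a y) B 1 = 0 &
      forall p, (p <= 2 * i)%N ->
        ev (xi p a y) B 0 = 'i * (2 * j)%:R * sgn i p * 'C(2 * i, p)%:R * P p.+1 /\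
        ev (xi p a y) B 1 = 'i * (2 * j)%:R * sgn i p * 'C(2 * i, p)%:R * P p].
Proof.
have [P [P0 P1]] := killing_potential hmu hy he B.
have evZ c (r : 'rV[C]_n) B' : ev (c *: r) B B' = c * ev r B B'.
  by rewrite -scalemxAl mxE.
have binl p : 'C(2 * j, p)%:R * (2 * j - p)%:R = (2 * j)%:R * 'C((2 * i).+1, p)%:R :> C.
  by rewrite -!natrM mulnC -mul_bin_left -mul_bin_diag E2j.
have binr p : 'C(2 * j, p.+1)%:R * p.+1%:R = (2 * j)%:R * 'C((2 * i).+1, p)%:R :> C.
  by rewrite -!natrM mulnC -mul_bin_diag E2j.
exists P; split.
- move=> p pj; rewrite dfun_phi// evZ [ev _ _ _]P0// sgnSl.
  by rewrite mulrA -[_ * _ * (_ - _)%:R]mulrA binl; ring.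
- move=> p pj; rewrite dfun_phi// evZ [ev _ _ _]P1// sgnSS mulrN.
  by rewrite mulrA -[_ * _ * p.+1%:R]mulrA binr; ring.
- by rewrite dfun_phi// evZ [ev _ _ _](killing_frame0 hmu hy he) mulr0.
move=> p pi; have n0 : (2 * j).+1%:R != 0 :> C by rewrite pnatr_eq0.
have [th0 th1] := adapted_form he (dfun (mu_ p) a y) (dfun (mu_ p.+1) a y)
  (dfun (mu_ p.+2) a y) B.
have split2 k : (k < 2 * j)%N -> k.+1%:R + (2 * j - k)%:R = (2 * j).+1%:R :> C.
  by move=> kj; rewrite -natrD; congr (_%:R); lia.
split.
  rewrite xiE// evZ evZ th0.
  rewrite [ev (dfun (mu_ p.+1) a y) B 0]P0 ?[ev (dfun (mu_ p.+2) a y) B 1]P1; [|lia|lia].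
  have := split2 p.+1; have -> : (p.+1 < 2 * j)%N by lia.
  move=> /(_ isT) s2.
  rewrite [X in _ = X](_ : _ = sgn i p * 'C(2 * i, p)%:R *
     ((2 * j)%:R / (2 * j).+1%:R * ('i * ((2 * j).+1%:R * P p.+1)))); last by field.
  by rewrite -s2; ring.
rewrite xiE// evZ evZ th1.
rewrite [ev (dfun (mu_ p) a y) B 0]P0 ?[ev (dfun (mu_ p.+1) a y) B 1]P1; [|lia|lia].
have := split2 p; have -> : (p < 2 * j)%N by lia.
move=> /(_ isT) s2.
rewrite [X in _ = X](_ : _ = sgn i p * 'C(2 * i, p)%:R *
   ((2 * j)%:R / (2 * j).+1%:R * ('i * ((2 * j).+1%:R * P p)))); last by field.
by rewrite -s2; ring.
Qed.

End Adapted.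

(** The Hamiltonian equation on the fibre over the point [(s : t)]: along
    [e_B0] and [e_B1] it is Pascal's rule between the coefficients of order
    [2j - 2] of the vector fields and those of order [2j - 1] which
    differentiation produces from the Hamiltonian. *)
Lemma hamilton_hom s t :
  (\sum_(p < (2 * i).+1) (s ^+ p * t ^+ (2 * i - p)) *: xi p a y) *m J s t =
  \sum_(p < (2 * j).+1) (s ^+ p * t ^+ (2 * j - p)) *: dfun (phi p) a y.
Proof.
have [e he] := adapted_exists hk hy.
have evS N (c : 'I_N -> C) (r : 'I_N -> 'rV[C]_n) B B' :
    ((\sum_p c p *: r p) *m vec e B B') 0 0 = \sum_p c p * (r p *m vec e B B') 0 0.
  rewrite mulmx_suml summxE; apply: eq_bigr => p _.
  by rewrite -scalemxAl mxE.
have J0 B : J s t *m vec e B 0 = - 'i * (s * t) *: vec e B 0 + 'i * t ^+ 2 *: vec e B 1.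
  have [[p0 z0 m0] _] := adapted_I he B.
  move: p0 z0 m0; rewrite /J_hom; move: (I_plus hk a y) (I_zero hk a y) (I_minus hk a y) => Kp K0 Km p0 z0 m0.
  rewrite !mulmxDl -!scalemxAl p0 z0 m0 scaler0 add0r !scalerA.
  by rewrite [_ * - 'i]mulrC [_ * 'i]mulrC.
have J1 B : J s t *m vec e B 1 = - 'i * s ^+ 2 *: vec e B 0 + 'i * (s * t) *: vec e B 1.
  have [_ [p0 z0 m0]] := adapted_I he B.
  move: p0 z0 m0; rewrite /J_hom; move: (I_plus hk a y) (I_zero hk a y) (I_minus hk a y) => Kp K0 Km p0 z0 m0.
  rewrite !mulmxDl -!scalemxAl p0 z0 m0 scaler0 addr0 !scalerA.
  by rewrite [_ * - 'i]mulrC [_ * 'i]mulrC.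
have evJ (r : 'rV[C]_n) c c' B : (r *m (c *: vec e B 0 + c' *: vec e B 1)) 0 0 =
    c * (r *m vec e B 0) 0 0 + c' * (r *m vec e B 1) 0 0.
  by rewrite mulmxDr -!scalemxAr mxE; congr (_ + _); rewrite mxE.
have sgS p : sgn i p.+1 = - sgn i p :> C by exact: sgnS.
apply: (adapted_row_eq he) => B; apply: mx11_eq; rewrite -mulmxA ?J0 ?J1 evJ !evS;
  have [P [f0 f1 f10 x01]] := phi_frame he B.
- pose u p : C := (2 * j)%:R * (s ^+ p * t ^+ (2 * j - p)) * P p.
  transitivity (\sum_(p < (2 * i).+1) 'C(2 * i, p)%:R * sgn i p * (u p.+1 - u p)).
    rewrite !mulr_sumr -big_split; apply: eq_bigr => -[p /= pi] _.
    have [-> ->] := x01 p pi; rewrite /u.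
    rewrite (_ : (2 * j - p.+1)%N = (2 * i - p).+1); last by lia.
    rewrite (_ : (2 * j - p)%N = (2 * i - p).+2); last by lia.
    have I2 := @mul_i_i R; rewrite !exprS expr0; ring: I2.
  rewrite pascal_sum// -[in LHS]E2j -sumrN [RHS]big_ord_recr /=.
  rewrite [X in _ = _ + X](_ : _ = 0); last first.
    by rewrite f0// (_ : 'C((2 * i).+1, 2 * j) = 0)%N ?bin_small ?mulr0 ?mul0r ?oppr0 ?mulr0//; lia.
  rewrite addr0; apply: eq_bigr => -[p /= pj] _; rewrite f0 ?(ltnW pj)// /u; ring.
- pose u p : C := (2 * j)%:R * (s ^+ p.+1 * t ^+ ((2 * i).+1 - p)) * P p.
  transitivity (\sum_(p < (2 * i).+1) 'C(2 * i, p)%:R * sgn i p * (u p.+1 - u p)).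
    rewrite !mulr_sumr -big_split; apply: eq_bigr => -[p /= pi] _.
    have [-> ->] := x01 p pi; rewrite /u.
    rewrite (_ : ((2 * i).+1 - p.+1)%N = (2 * i - p)%N); last by lia.
    rewrite (_ : ((2 * i).+1 - p)%N = (2 * i - p).+1); last by lia.
    have I2 := @mul_i_i R; rewrite !exprS expr0; ring: I2.
  rewrite pascal_sum// -[in LHS]E2j -sumrN [RHS]big_ord_recl /= f10 mulr0 add0r.
  apply: eq_bigr => -[p /= pj] _; rewrite /bump /= add1n f1// /u.
  rewrite (_ : (2 * j - p.+1)%N = ((2 * i).+1 - p)%N); last by lia.
  by ring.
Qed.

(** In an adapted frame the relation says that [dphi_p e_B0 = dphi_(p+1) e_B1] for
    all [p], and both sides are the same multiple of the common potential. The
    two incomplete relations are those at the lower end of the chain. *)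
Lemma phi_recursion :
  [/\ dfun (phi 0) a y *m I_minus hk a y = 0,
      dfun (phi 0) a y *m I_zero hk a y + dfun (phi 1) a y *m I_minus hk a y = 0 &
      forall p, dfun (phi p) a y *m I_plus hk a y
        + dfun (phi p.+1) a y *m I_zero hk a y
        + dfun (phi p.+2) a y *m I_minus hk a y = 0].
Proof.
have [e he] := adapted_exists hk hy.
have sgz p B : (dfun (phi p) a y *m vec e B 0) 0 0 = (dfun (phi p.+1) a y *m vec e B 1) 0 0.
  have [P [f0 f1 f10 _]] := phi_frame he B.
  have [pj|pj] := ltnP p (2 * j); first by rewrite f0 ?f1// ltnW.
  rewrite [dfun (phi p.+1) a y]dfun_phi_out// mul0mx [RHS]mxE; have [pj'|] := ltnP (2 * j) p.
    by rewrite dfun_phi_out// mul0mx mxE.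
  move=> jp; rewrite f0// (_ : 'C((2 * i).+1, p) = 0)%N ?mulr0 ?mul0r ?oppr0 ?mulr0 ?mul0r ?oppr0//.
  by rewrite bin_small//; lia.
have fz p B : dfun (phi p) a y *m vec e B 0 = dfun (phi p.+1) a y *m vec e B 1.
  exact: mx11_eq.
have f0 B : dfun (phi 0) a y *m vec e B 1 = 0.
  by have [P [_ _ h _]] := phi_frame he B; apply: mx11_eq; rewrite h mxE.
have I0 B := (adapted_I he B).1; have I1 B := (adapted_I he B).2.
have key p : dfun (phi p.+1) a y *m I_zero hk a y + dfun (phi p.+2) a y *m I_minus hk a y
    = - (dfun (phi p) a y *m I_plus hk a y).
  apply: (adapted_row_eq he) => B; rewrite mulmxDl mulNmx -!mulmxA.
    have [-> -> ->] := I0 B; rewrite mulmx0 oppr0 -!scalemxAr fz.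
    by rewrite scaleNr addNr.
  have [-> -> ->] := I1 B; rewrite mulmx0 addr0 -!scalemxAr fz.
  by rewrite scaleNr opprK.
split.
- apply: (adapted_row_eq he) => B; rewrite [RHS]mul0mx -mulmxA.
    by have [_ _ ->] := I0 B; rewrite -scalemxAr f0 scaler0.
  by have [_ _ ->] := I1 B; rewrite mulmx0.
- apply: (adapted_row_eq he) => B; rewrite [RHS]mul0mx mulmxDl -!mulmxA.
    have [_ -> ->] := I0 B; rewrite -!scalemxAr fz.
    by rewrite scaleNr addNr.
  by have [_ -> ->] := I1 B; rewrite mulmx0 addr0 -scalemxAr f0 scaler0.
- move=> p; move: (key p); move: (_ *m I_plus hk a y) (_ *m I_zero hk a y) => u v.
  by move: (_ *m I_minus hk a y) => w E; rewrite -addrA E subrr.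
Qed.

End Point.
End Hamiltonian.

(** * Change of charts and Cartan's formula *)

Section MatrixFunctions.
Context {R : realType} {V : normedModType R} (U : set V).
Hypothesis oU : open U.
Local Notation C := R[i].

Lemma csmooth_mulmx p q r (F : V -> 'M[C]_(p, q)) (H : V -> 'M[C]_(q, r)) :
  csmooth_mx_on U F -> csmooth_mx_on U H -> csmooth_mx_on U (fun x => F x *m H x).
Proof.
move=> Fs Hs i k.
apply: csmooth_congr (csmooth_sum oU (index_enum _) xpredT
  (fun l => csmoothM oU (Fs i l) (Hs l k))) => // x _.
by rewrite mxE.
Qed.

Lemma csmooth_mxD p q (F H : V -> 'M[C]_(p, q)) :
  csmooth_mx_on U F -> csmooth_mx_on U H -> csmooth_mx_on U (fun x => F x + H x).
Proof.
move=> Fs Hs i k; apply: csmooth_congr (csmoothD oU (Fs i k) (Hs i k)) => // x _.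
by rewrite mxE.
Qed.

Lemma csmooth_mxZ p q (c : V -> C) (F : V -> 'M[C]_(p, q)) :
  csmooth_on U c -> csmooth_mx_on U F -> csmooth_mx_on U (fun x => c x *: F x).
Proof.
move=> cs Fs i k; apply: csmooth_congr (csmoothM oU cs (Fs i k)) => // x _.
by rewrite mxE.
Qed.

Lemma csmooth_mx_sum p q N (F : 'I_N -> V -> 'M[C]_(p, q)) :
  (forall k, csmooth_mx_on U (F k)) -> csmooth_mx_on U (fun x => \sum_k F k x).
Proof.
move=> Fs i k; apply: csmooth_congr (csmooth_sum oU (index_enum _) xpredT
  (fun l => Fs l i k)) => // x _.
by rewrite summxE.
Qed.

Lemma csmooth_mx_tr p q (F : V -> 'M[C]_(p, q)) :
  csmooth_mx_on U F -> csmooth_mx_on U (fun x => (F x)^T).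
Proof. by move=> Fs i k; apply: csmooth_congr (Fs k i) => // x _; rewrite mxE. Qed.

Lemma csmooth_mx_real p q (F : V -> 'M[R]_(p, q)) :
  (forall i k, smooth_on U (fun x => F x i k : R^o)) -> csmooth_mx_on U (fun x => cmx (F x)).
Proof.
by move=> Fs i k; apply: csmooth_congr (csmooth_real (Fs i k)) => // x _; rewrite mxE.
Qed.

Lemma csmooth_mx_congr p q (F H : V -> 'M[C]_(p, q)) : (forall x, U x -> F x = H x) ->
  csmooth_mx_on U F -> csmooth_mx_on U H.
Proof. by move=> FH Fs i k; apply: csmooth_congr (Fs i k) => // x /FH ->. Qed.

Lemma cD_real (f : V -> R^o) v x : cD v (fun y => (f y)%:C) x = ('D_v f x)%:C.
Proof. by apply: eq_ReIm => //=; rewrite derive_cst. Qed.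

End MatrixFunctions.

Section Charts.
Context {R : realType} {n : nat} {M : topologicalType} {A : smooth_atlas R n M}.
Local Notation C := R[i].

(** The function [g] is only required to be [f] in the other chart near [y]: the
    two charts overlap in a neighbourhood of the point. *)
Lemma chain_rule_charts (f : 'cV[R]_n -> R^o) (g : 'cV[R]_n -> R^o) (a b : chart A) y k :
  smooth_on (img b) f -> overlap a b y ->
  (\near y, f (trans a b y) = g y) ->
  'D_(delta_mx k 0) g y =
  \sum_i jac a b y i k * 'D_(delta_mx i 0) f (trans a b y).
Proof.
move=> fs oy fg; have sm := crd_smooth a b; have oy' := oy.
case: oy => x [xa xb] yE.
have iy : crd_inv a y = x by rewrite -yE crdK.
have ty : img b (trans a b y) by exists x => //; rewrite /trans /= iy.
have ct : {for y, continuous (trans a b)} by exact: (sm 0%N).1.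
have dt : derivable (trans a b) y (delta_mx k 0) by exact: ((sm 1%N).2 _).1.
have := chain_rule (@img_open _ _ _ A b) (fs 1%N) ty ct dt.
move=> /(@derive_val _ _ _ _ _ _ _) E.
rewrite -(near_eq_derive _ fg) [LHS]E; apply: eq_bigr => i _.
by rewrite mxE.
Qed.

Lemma near_trans (T : Type) (f : M -> T) (a b : chart A) y : overlap a b y ->
  \near y, (f \o crd_inv b) (trans a b y) = (f \o crd_inv a) y.
Proof.
case=> x [xa xb] yE; have iy : crd_inv a y = x by rewrite -yE crdK.
have ya : img a y by exists x.
have nb : nbhs (crd_inv a y) (Defs.dom b) by apply: open_nbhs_nbhs; split; [exact: (@dom_open _ _ _ A b)|rewrite iy].
have nw : nbhs y (crd_inv a @^-1` Defs.dom b) by exact: (crd_inv_continuous ya).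
apply: (@filterS _ (nbhs y) _ _ _ _ nw) => w /= wb.
by rewrite /trans /= crdK.
Qed.

Lemma dfun_trans (f : M -> C) (a b : chart A) y : csmooth_fun_on A setT f ->
  overlap a b y -> dfun f a y = dfun f b (trans a b y) *m cmx (jac a b y).
Proof.
move=> /(_ b); rewrite setIT => -[fr fi] oy; apply/rowP => k; rewrite mxE [RHS]mxE.
have nt := near_trans f oy.
have dr := @chain_rule_charts _ (fun x => complex.Re ((f \o crd_inv a) x)) _ _ _ k fr oy _.
have di := @chain_rule_charts _ (fun x => complex.Im ((f \o crd_inv a) x)) _ _ _ k fi oy _.
have ReS N (F : 'I_N -> C) : complex.Re (\sum_i F i) = \sum_i complex.Re (F i).
  by elim/big_rec2: _ => [//|i u v _ <-]; rewrite creD.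
have ImS N (F : 'I_N -> C) : complex.Im (\sum_i F i) = \sum_i complex.Im (F i).
  by elim/big_rec2: _ => [//|i u v _ <-]; rewrite cimD.
apply: eq_ReIm; rewrite ?ReS ?ImS.
  apply: etrans (dr _) _; first by move: nt; apply: filterS => w ->.
  by apply: eq_bigr => i _; rewrite [dfun _ _ _ _ _]mxE [cmx _ _ _]mxE creM /= mulr0 subr0 mulrC.
apply: etrans (di _) _; first by move: nt; apply: filterS => w ->.
by apply: eq_bigr => i _; rewrite [dfun _ _ _ _ _]mxE [cmx _ _ _]mxE cimM /= mulr0 add0r mulrC.
Qed.

Definition closed_form (B : 'cV[R]_n -> 'M[C]_n) (y : 'cV[R]_n) : Prop :=
  forall p q r, cD (delta_mx p 0) (fun x => B x q r) y
    + cD (delta_mx q 0) (fun x => B x r p) y + cD (delta_mx r 0) (fun x => B x p q) y = 0.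

(** Cartan's formula: [L_X B = d (i_X B) + i_X (d B)], and [d d f = 0]. *)
Lemma lie_form_hamiltonian (X : vfield A) (B : mx_field A) (a : chart A)
    (f : 'cV[R]_n -> C) y :
  img a y -> csmooth_mx_on (img a) (X a) -> csmooth_mx_on (img a) (B a) ->
  csmooth_on (img a) f -> (forall x, img a x -> (B a x)^T = - B a x) ->
  closed_form (B a) y ->
  (forall x, img a x -> (X a x)^T *m B a x = \row_k cD (delta_mx k 0) f x) ->
  lie_form X B a y = 0.
Proof.
move=> hy Xs Bs fs Ba Bc XB; have oU := @img_open _ _ _ A a.
have Bas x p q : img a x -> B a x p q = - B a x q p.
  by move=> /Ba /matrixP/(_ q p); rewrite !mxE => ->.
have dB v p q : cD v (fun x => B a x p q) y = - cD v (fun x => B a x q p) y.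
  rewrite -mulN1r -(cDZ oU (-1) v (Bs q p) hy); apply: (@cD_congr _ _ (img a) oU) => // x hx.
  by rewrite Bas// mulN1r.
have E p q : cD (delta_mx p 0) (fun x => cD (delta_mx q 0) f x) y =
  \sum_k (X a y k 0 * cD (delta_mx p 0) (fun x => B a x k q) y
    + cD (delta_mx p 0) (fun x => X a x k 0) y * B a y k q).
  transitivity (cD (delta_mx p 0) (fun x => \sum_k X a x k 0 * B a x k q) y).
    apply: (@cD_congr _ _ (img a) oU) => // x hx.
    have /rowP/(_ q) := XB x hx; rewrite !mxE => <-.
    by apply: eq_bigr => k _; rewrite mxE.
  rewrite (cD_sum oU)//; last by move=> k; exact: csmoothM.
  by apply: eq_bigr => k _; exact: (cDM oU _ (Xs k 0) (Bs k q) hy).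
apply/matrixP => p q; rewrite !mxE.
have := cD_comm oU (delta_mx p 0) (delta_mx q 0) fs hy; rewrite !E => /eqP.
rewrite -subr_eq0 -sumrB => /eqP h; rewrite -[RHS]h; apply: eq_bigr => k _.
have := Bc k p q; rewrite [cD _ (fun x => B a x q k) y]dB.
rewrite [B a y p k]Bas//.
move: (cD _ (fun x => B a x p q) y) (cD _ (fun x => B a x k q) y)
  (cD _ (fun x => B a x k p) y) => u v w h'.
have -> : u = v - w by rewrite -[u](subr0 _) -h'; ring.
by ring.
Qed.

End Charts.

(** * Closedness of the twistor family of 2-forms *)

Section HyperkahlerForms.
Context {R : realType} {m : nat} {M : topologicalType}.
Context {A : smooth_atlas R (4 * m) M}.
Variable hk : hyperkahler A.
Local Notation C := R[i].
Local Notation n := (4 * m)%N.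

Section Chart.
Variable a : chart A.
Local Notation oU := (@img_open _ _ _ A a).

Lemma met_csmooth : csmooth_mx_on (img a) (fun y => cmx (met hk a y)).
Proof. by apply: (csmooth_mx_real oU) => i k; exact: met_smooth. Qed.

Lemma cpx_csmooth r : csmooth_mx_on (img a) (fun y => cmx (cpx hk r a y)).
Proof. by apply: (csmooth_mx_real oU) => i k; exact: cpx_smooth. Qed.

Lemma met_inv_csmooth : csmooth_mx_on (img a) (fun y => invmx (cmx (met hk a y))).
Proof.
apply: (@csmooth_mx_congr _ _ _ oU _ _ (fun y => cmx (invmx (met hk a y)))).
  by move=> y hy; rewrite /cmx map_invmx.
apply: (csmooth_mx_real oU); apply: (smooth_invmx oU) => [x hx|i k]; first exact: (met_unit hk hx).
exact: met_smooth.
Qed.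

Lemma omega_kE r y : omega_k hk r a y = cmx (met hk a y) *m cmx (cpx hk r a y).
Proof. by rewrite /omega_k -map_mxM. Qed.

Lemma omega_k_csmooth r : csmooth_mx_on (img a) (omega_k hk r a).
Proof.
apply: (csmooth_mx_congr oU _ (csmooth_mulmx oU met_csmooth (cpx_csmooth r))) => y _.
by rewrite omega_kE.
Qed.

Lemma omega_k_alt r y : img a y -> (omega_k hk r a y)^T = - omega_k hk r a y.
Proof. by move=> hy; rewrite omega_kE trmx_mul met_csym// cpx_skew. Qed.

(** Each Kaehler form is closed because its covariant derivative vanishes and
    the connection has no torsion: the derivative [d_r W_pq] is
    [Gamma^u_rp W_uq + Gamma^u_rq W_pu], whose cyclic sum is zero. *)
Lemma omega_k_closed r3 y : img a y -> closed_form (omega_k hk r3 a) y.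
Proof.
move=> hy.
pose g p q : C := (met hk a y p q)%:C.
pose kf p q : C := (cpx hk r3 a y p q)%:C.
pose dg r p q := cD (delta_mx r 0) (fun x => (met hk a x p q)%:C) y.
pose dk r p q := cD (delta_mx r 0) (fun x => (cpx hk r3 a x p q)%:C) y.
pose gam k i l : C := (christoffel (met hk a) y k i l)%:C.
pose W p q := omega_k hk r3 a y p q.
have dgE r p q : dg r p q = (pd r (fun x => met hk a x p q) y)%:C by exact: cD_real.
have dkE r p q : dk r p q = (pd r (fun x => cpx hk r3 a x p q) y)%:C by exact: cD_real.
have gs p q : csmooth_on (img a) (fun x => (met hk a x p q)%:C).
  by apply: csmooth_real; exact: met_smooth.
have ks p q : csmooth_on (img a) (fun x => (cpx hk r3 a x p q)%:C).
  by apply: csmooth_real; exact: cpx_smooth.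
have met_s x p q : img a x -> met hk a x p q = met hk a x q p.
  by move=> hx; rewrite -[in LHS](met_sym hk hx) mxE.
have dg_sym r p q : dg r p q = dg r q p.
  by apply: (@cD_congr _ _ (img a) oU) => // x hx; rewrite met_s.
have WE p q : W p q = \sum_s g p s * kf s q.
  by rewrite /W omega_kE mxE; apply: eq_bigr => s _; rewrite !mxE.
have W_alt p q : W p q = - W q p.
  by have /matrixP/(_ q p) := omega_k_alt r3 hy; rewrite mxE [RHS]mxE.
have par r s q : dk r s q = - \sum_p gam s r p * kf p q + \sum_p gam p r q * kf s p.
  have P := congr1 (real_complex R) (cpx_parallel hk r3 hy r s q).
  rewrite /nabla_endo rmorphB rmorphD !rmorph_sum rmorph0 /= -dkE in P.
  move/eqP: P; rewrite subr_eq0 => /eqP P.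
  have -> : \sum_p gam p r q * kf s p =
      \sum_p (christoffel (met hk a) y p r q * cpx hk r3 a y s p)%:C.
    by apply: eq_bigr => p _; exact/esym/rmorphM.
  have -> : \sum_p gam s r p * kf p q =
      \sum_p (christoffel (met hk a) y s r p * cpx hk r3 a y p q)%:C.
    by apply: eq_bigr => p _; exact/esym/rmorphM.
  by rewrite -P addrC addrK.
(* The Christoffel symbols of the first kind. *)
have lower s i l : \sum_u g s u * gam u i l = 2^-1 * (dg i l s + dg l i s - dg s i l).
  pose T q := dg i l q + dg l i q - dg q i l.
  have gamE u : gam u i l = 2^-1 * \sum_q (invmx (met hk a y) u q)%:C * T q.
    rewrite /gam /christoffel rmorphM fmorphV rmorph_nat; congr (_ * _).
    rewrite rmorph_sum; apply: eq_bigr => q _.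
    by rewrite /= rmorphM rmorphB rmorphD /= /T !dgE.
  under eq_bigr do rewrite gamE mulrCA mulr_sumr.
  rewrite -mulr_sumr exchange_big /=; congr (_ * _).
  rewrite -[RHS]/(T s) (bigD1 s)//= [X in _ + X]big1 ?addr0.
    under eq_bigr do rewrite mulrA -rmorphM.
    rewrite -mulr_suml -rmorph_sum /=.
    have /matrixP/(_ s s) := mulmxV (met_unit hk hy); rewrite mxE => ->.
    by rewrite mxE eqxx mul1r.
  move=> q qs; under eq_bigr do rewrite mulrA -rmorphM.
  rewrite -mulr_suml -rmorph_sum /=.
  have /matrixP/(_ s q) := mulmxV (met_unit hk hy); rewrite mxE => ->.
  by rewrite mxE eq_sym (negPf qs) mul0r.
have gam_sym k i l : gam k i l = gam k l i.
  congr (_%:C); rewrite /christoffel; congr (_ * _); apply: eq_bigr => q _; congr (_ * _).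
  rewrite [X in X - _ = _]addrC; congr (_ - _).
  by apply: complexI; rewrite -!dgE dg_sym.
have dW r p q : cD (delta_mx r 0) (fun x => omega_k hk r3 a x p q) y =
    \sum_u gam u r p * W u q + \sum_u gam u r q * W p u.
  transitivity (\sum_s (g p s * dk r s q + dg r p s * kf s q)).
    rewrite -(eq_bigr _ (fun s _ => cDM oU (delta_mx r 0) (gs p s) (ks s q) hy)).
    rewrite -(cD_sum oU)//; last by move=> s; exact: (csmoothM oU (gs p s) (ks s q)).
    apply: (@cD_congr _ _ (img a) oU) => // x hx.
    by rewrite omega_kE mxE; apply: eq_bigr => s _; rewrite !mxE.
  have e1 : \sum_s g p s * (\sum_u gam u r q * kf s u) = \sum_u gam u r q * W p u.
    under eq_bigr do rewrite mulr_sumr.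
    rewrite exchange_big; apply: eq_bigr => u _ /=; rewrite WE mulr_sumr.
    by apply: eq_bigr => s _; ring.
  have e2 : \sum_s g p s * (\sum_u gam s r u * kf u q) =
      \sum_u 2^-1 * (dg r u p + dg u r p - dg p r u) * kf u q.
    under eq_bigr do rewrite mulr_sumr.
    rewrite exchange_big; apply: eq_bigr => u _ /=; rewrite -lower mulr_suml.
    by apply: eq_bigr => s _; ring.
  have e3 : \sum_u gam u r p * W u q =
      \sum_u 2^-1 * (dg r p u + dg p r u - dg u r p) * kf u q.
    under eq_bigr do rewrite WE mulr_sumr.
    rewrite exchange_big; apply: eq_bigr => u _ /=; rewrite -lower mulr_suml.
    by apply: eq_bigr => s _; rewrite /g (met_s _ u s)//; ring.
  rewrite big_split /= -e1 e3.
  under eq_bigr do rewrite par mulrDr mulrN.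
  rewrite big_split /= sumrN e2 [in LHS]addrAC; congr (_ + _).
  rewrite addrC -sumrB; apply: eq_bigr => u _.
  by rewrite (dg_sym r u p); field.
have sw x x' z : \sum_u gam u x x' * W u z = - \sum_u gam u x' x * W z u.
  by rewrite -sumrN; apply: eq_bigr => u _; rewrite (W_alt u z) (gam_sym u x x') mulrN.
have cyc (x y' z u v w : C) : u = - x -> v = - y' -> w = - z ->
    u + z + (v + x) + (w + y') = 0 by move=> -> -> ->; ring.
move=> p q r; rewrite (dW p q r) (dW q r p) (dW r p q).
exact: (cyc _ _ _ _ _ _ (sw p q r) (sw q r p) (sw r p q)).
Qed.

End Chart.

Section Twistor.

(** The coefficients of [tw_omega] on the three Kaehler forms. *)
Definition omega_coef (b : bool) (z : C) (r : 'I_3) : C :=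
  let: (s, t) := hom_pt b z in
  if r == 0 then (s ^+ 2 - t ^+ 2) / 2 else
  if r == 1 then 'i * (s ^+ 2 + t ^+ 2) / 2 else s * t.

Lemma tw_omega_kE b z a y :
  tw_omega hk b z a y = \sum_r omega_coef b z r *: omega_k hk r a y.
Proof.
rewrite /tw_omega /omega_plus /omega_zero /omega_minus sum3 /omega_coef /hom_pt /=.
move: (omega_k _ _ _ _) (omega_k _ _ _ _) (omega_k _ _ _ _) => K0 K1 K2.
have aux (F : numFieldType) (w x : F) (k0 k1 k2 : F) :
  (2^-1 * (k0 + w * k1) + x * k2 + x ^+ 2 * (- (2^-1 * (k0 - w * k1))) =
    (1 ^+ 2 - x ^+ 2) / 2 * k0 + w * (1 ^+ 2 + x ^+ 2) / 2 * k1 + 1 * x * k2) *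
  (- (2^-1 * (k0 - w * k1)) + x * k2 + x ^+ 2 * (2^-1 * (k0 + w * k1)) =
    (x ^+ 2 - 1 ^+ 2) / 2 * k0 + w * (x ^+ 2 + 1 ^+ 2) / 2 * k1 + x * 1 * k2).
  by split; field.
by case: b; apply/matrixP => p q; rewrite !mxE aux.
Qed.

Lemma tw_omega_closed b z a y : img a y -> closed_form (tw_omega hk b z a) y.
Proof.
move=> hy p q r.
have E v k l : cD v (fun x => tw_omega hk b z a x k l) y =
    \sum_s omega_coef b z s * cD v (fun x => omega_k hk s a x k l) y.
  have oU := @img_open _ _ _ A a.
  have os s : csmooth_on (img a) (fun x => omega_k hk s a x k l) := omega_k_csmooth a s k l.
  transitivity (cD v (fun x => \sum_s omega_coef b z s * omega_k hk s a x k l) y).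
    apply: (@cD_congr _ _ (img a) oU) => // x _.
    by rewrite tw_omega_kE summxE; apply: eq_bigr => s _; rewrite mxE.
  rewrite (cD_sum oU)//.
    by apply: eq_bigr => s _; exact: (cDZ oU).
  by move=> s; apply: (csmoothM oU) => //; exact: csmooth_cst.
rewrite !E -!big_split big1// => s _ /=.
by rewrite -!mulrDr omega_k_closed// mulr0.
Qed.

Lemma tw_omega_csmooth b z a : csmooth_mx_on (img a) (tw_omega hk b z a).
Proof.
have oU := @img_open _ _ _ A a.
apply: (csmooth_mx_congr oU (F := fun y => \sum_r omega_coef b z r *: omega_k hk r a y)).
  by move=> y _; rewrite tw_omega_kE.
apply: csmooth_mx_sum => // r; apply: csmooth_mxZ => //; first exact: csmooth_cst.
exact: omega_k_csmooth.
Qed.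

End Twistor.
End HyperkahlerForms.

(** * Brackets with vector fields of type (0,1) *)

Section Slices.
Context {R : realType} {V W : normedModType R}.

Lemma Ck_on_slice k (U : set (V * W)) (f : V * W -> R^o) (w : W) : Ck_on k U f ->
  Ck_on k [set y | U (y, w)] (fun y => f (y, w) : R^o).
Proof.
have fc (g : V * W -> R^o) : (forall x, U x -> {for x, continuous g}) ->
    forall y, U (y, w) -> {for y, continuous (fun y => g (y, w) : R^o)}.
  move=> gc y Uy; apply: (@cvg_comp _ _ _ (fun y : V => (y, w)) g _ (nbhs (y, w))).
    by apply: cvg_pair => //=; exact: cvg_cst.
  exact: gc.
have E (g : V * W -> R^o) v y : (fun h : R => h^-1 *: (((fun y => g (y, w)) \o shift y) (h *: v) - g (y, w)))
    = (fun h : R => h^-1 *: ((g \o shift (y, w)) (h *: ((v, 0) : V * W)) - g (y, w))).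
  apply/funext => h /=; congr (_ *: (g _ - _)).
  by congr pair; rewrite /= scaler0 add0r.
elim: k f => [|k IH] f [/fc ct fd]; split=> // v; have [fv fk] := fd (v, 0); split.
  by move=> y /= /fv; rewrite /derivable E.
have := IH _ fk; congr Ck_on; apply/funext => y; rewrite /derive E.
by [].
Qed.

Lemma csmooth_slice (U : set (V * W)) (f : V * W -> R[i]) (w : W) : csmooth_on U f ->
  csmooth_on [set y | U (y, w)] (fun y => f (y, w)).
Proof.
move=> [fr fi]; split=> k.
  exact: (@Ck_on_slice k U (fun x => complex.Re (f x) : R^o) w (fr k)).
exact: (@Ck_on_slice k U (fun x => complex.Im (f x) : R^o) w (fi k)).
Qed.

End Slices.

Section Bracket.
Context {R : realType} {m : nat}.
Local Notation C := R[i].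
Local Notation n := (4 * m)%N.
Local Notation ZR := ('cV[R]_n * (R^o * R^o))%type.

(** If a form [B] in the fibres is closed, holomorphic along the base and
    satisfies [i_S B = d h], and [w] lies in its kernel, then the bracket of
    [w + c d/dzbar] with [S] lies in the kernel too:
    [i_[w,S] B = L_w (i_S B) - i_S (L_w B) = d (i_w d h) = 0]. *)
Lemma bracket_kernel (O : set ZR) (B : ZR -> 'M[C]_n) (S w : ZR -> 'cV[C]_n)
    (c h : ZR -> C) (t : ZR) : open O -> O t ->
  csmooth_mx_on O B -> csmooth_mx_on O S -> csmooth_mx_on O w -> csmooth_on O h ->
  (forall x, O x -> (B x)^T = - B x) ->
  (forall p q r, cD ((delta_mx p 0, (0, 0)) : ZR) (fun x => B x q r) t
    + cD ((delta_mx q 0, (0, 0)) : ZR) (fun x => B x r p) t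
    + cD ((delta_mx r 0, (0, 0)) : ZR) (fun x => B x p q) t = 0) ->
  (forall x, O x ->
    (S x)^T *m B x = \row_k cD ((delta_mx k 0, (0, 0)) : ZR) h x) ->
  (forall x, O x -> (w x)^T *m B x = 0) ->
  (forall q r, D_zbar (fun x => B x q r) t = 0) ->
  (forall k, D_zbar (fun x => cD ((delta_mx k 0, (0, 0)) : ZR) h x) t = 0) ->
  (bracket w c S t)^T *m B t = 0.
Proof.
move=> oO Ot Bs Ss ws hs Ba Bc SB wB Bz hz.
pose d k : ZR := (delta_mx k 0, (0, 0)).
have Bas x p q : O x -> B x p q = - B x q p.
  by move=> /Ba /matrixP/(_ q p); rewrite mxE [RHS]mxE.
have dB k p q : cD (d k) (fun x => B x p q) t = - cD (d k) (fun x => B x q p) t.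
  rewrite -mulN1r -(cDZ oO (-1) (d k) (Bs q p) Ot); apply: (@cD_congr _ _ O oO) => // x Ox.
  by rewrite Bas// mulN1r.
have SBx x q : O x -> \sum_p S x p 0 * B x p q = cD (d q) h x.
  move=> Ox; have /rowP/(_ q) := SB x Ox; rewrite mxE [RHS]mxE => <-.
  by apply: eq_bigr => p _; rewrite mxE.
have wBx x q : O x -> \sum_p w x p 0 * B x p q = 0.
  move=> Ox; have /rowP/(_ q) := wB x Ox; rewrite mxE [RHS]mxE => {2}<-.
  by apply: eq_bigr => p _; rewrite mxE.
have prodS (u : ZR -> 'cV[C]_n) (us : csmooth_mx_on O u) q p :
    csmooth_on O (fun x => u x p 0 * B x p q) by exact: csmoothM.
have D (u : ZR -> 'cV[C]_n) (us : csmooth_mx_on O u) k q :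
    cD (d k) (fun x => \sum_p u x p 0 * B x p q) t =
    \sum_p u t p 0 * cD (d k) (fun x => B x p q) t +
    \sum_p cD (d k) (fun x => u x p 0) t * B t p q.
  rewrite (cD_sum oO (index_enum _) (d k) (prodS u us q) Ot) -big_split; apply: eq_bigr => p _.
  exact: (cDM oO (d k) (us p 0) (Bs p q) Ot).
have F1 k q : \sum_p cD (d k) (fun x => S x p 0) t * B t p q =
    cD (d q) (fun x => cD (d k) h x) t - \sum_p S t p 0 * cD (d k) (fun x => B x p q) t.
  rewrite -(cD_comm oO (d k) (d q) hs Ot).
  have -> : cD (d k) (fun x => cD (d q) h x) t = cD (d k) (fun x => \sum_p S x p 0 * B x p q) t.
    by apply: (@cD_congr _ _ O oO) => // x Ox; rewrite SBx.
  by rewrite (D S Ss) addrC addKr.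
have F2 q : \sum_p D_zbar (fun x => S x p 0) t * B t p q = 0.
  rewrite -[RHS](hz q).
  have -> : D_zbar (fun x => cD (d q) h x) t = D_zbar (fun x => \sum_p S x p 0 * B x p q) t.
    by apply: (zbar_congr oO) => // x Ox; rewrite SBx.
  rewrite (zbar_sum oO (index_enum _) (prodS S Ss q) Ot); apply: eq_bigr => p _.
  by rewrite (zbarM oO (Ss p 0) (Bs p q) Ot) Bz mulr0 add0r.
have F3 k q : \sum_p cD (d k) (fun x => w x p 0) t * B t p q =
    - \sum_p w t p 0 * cD (d k) (fun x => B x p q) t.
  have := D w ws k q; have -> : cD (d k) (fun x => \sum_p w x p 0 * B x p q) t = 0.
    rewrite -[RHS](cD_cst 0 (d k) t); apply: (@cD_congr _ _ O oO) => // x Ox; exact: wBx.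
  by move=> /esym/eqP; rewrite addrC addr_eq0 => /eqP.
have F5 q : \sum_k w t k 0 * cD (d q) (fun x => cD (d k) h x) t =
    - \sum_k cD (d q) (fun x => w x k 0) t * cD (d k) h t.
  have hk k : csmooth_on O (fun x => w x k 0 * cD (d k) h x).
    by apply: csmoothM => //; exact: csmooth_cD.
  have : cD (d q) (fun x => \sum_k w x k 0 * cD (d k) h x) t = 0.
    rewrite -[RHS](cD_cst 0 (d q) t); apply: (@cD_congr _ _ O oO) => // x Ox.
    under eq_bigr do rewrite -(SBx x _ Ox) mulr_sumr.
    rewrite exchange_big big1// => p _ /=.
    transitivity (- (S x p 0 * \sum_k w x k 0 * B x k p)); last by rewrite wBx// mulr0 oppr0.
    by rewrite mulr_sumr -sumrN; apply: eq_bigr => k _; rewrite (Bas x p k)//; ring.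
  rewrite (cD_sum oO (index_enum _) (d q) hk Ot).
  rewrite (eq_bigr _ (fun k _ => cDM oO (d q) (ws k 0) (csmooth_cD (d k) hs) Ot)).
  by rewrite big_split /= => /eqP; rewrite addr_eq0 => /eqP.
apply/rowP => q; rewrite mxE [RHS]mxE.
transitivity (\sum_k w t k 0 * (\sum_p cD (d k) (fun x => S x p 0) t * B t p q)
   + c t * (\sum_p D_zbar (fun x => S x p 0) t * B t p q)
   - \sum_k S t k 0 * (\sum_p cD (d k) (fun x => w x p 0) t * B t p q)).
  rewrite [X in X + _ - _](_ : _ = \sum_p (\sum_k w t k 0 * cD (d k) (fun x => S x p 0) t) * B t p q);
    last first.
    under eq_bigr do rewrite mulr_sumr.
    rewrite exchange_big; apply: eq_bigr => p _; rewrite mulr_suml.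
    by apply: eq_bigr => k _; rewrite mulrA.
  rewrite [X in _ + _ - X](_ : _ = \sum_p (\sum_k S t k 0 * cD (d k) (fun x => w x p 0) t) * B t p q);
    last first.
    under eq_bigr do rewrite mulr_sumr.
    rewrite exchange_big; apply: eq_bigr => p _; rewrite mulr_suml.
    by apply: eq_bigr => k _; rewrite mulrA.
  rewrite mulr_sumr -big_split -sumrB; apply: eq_bigr => p _ /=.
  by rewrite mxE [bracket _ _ _ _ _ _]mxE /D_fiber mulrBl mulrDl mulrA.
rewrite F2 mulr0 addr0.
under eq_bigr do rewrite F1 mulrBr mulr_sumr.
rewrite sumrB F5.
under [X in _ - X = _]eq_bigr do rewrite F3 mulrN mulr_sumr.
rewrite sumrN opprK.
have -> : \sum_k cD (d q) (fun x => w x k 0) t * cD (d k) h t =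
    \sum_p \sum_k S t p 0 * (w t k 0 * cD (d q) (fun x => B x k p) t).
  under eq_bigr do rewrite -(SBx t _ Ot) mulr_sumr.
  rewrite exchange_big; apply: eq_bigr => p _ /=.
  transitivity (- (S t p 0 * \sum_k cD (d q) (fun x => w x k 0) t * B t k p)).
    by rewrite mulr_sumr -sumrN; apply: eq_bigr => k _; rewrite (Bas t p k)//; ring.
  by rewrite F3 mulrN opprK mulr_sumr.
rewrite [X in _ - X + _](exchange_big) /= -opprD -big_split /=.
apply/eqP; rewrite addrC subr_eq0; apply/eqP; apply: eq_bigr => p _.
rewrite -big_split; apply: eq_bigr => k _ /=.
have := Bc q k p; rewrite -/(d _) -/(d _) -/(d _) [cD (d p) (fun x => B x q k) t]dB => /eqP.
rewrite subr_eq0 => /eqP <-.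
by rewrite !mulrDr; congr (_ + _); rewrite mulrCA.
Qed.

End Bracket.

(** * The sections over the twistor space *)

Section Sections.
Context {R : realType} {m : nat} {M : topologicalType}.
Context {A : smooth_atlas R (4 * m) M}.
Variable hk : hyperkahler A.
Local Notation C := R[i].
Local Notation n := (4 * m)%N.
Local Notation ZR := ('cV[R]_n * (R^o * R^o))%type.
Variables (i : nat) (mu : Htensor R M).
Local Notation j := i.+1.
Local Notation phi := (phi i mu).
Local Notation xi := (xi hk i mu).
Hypothesis hmu : killing_tensor hk (2 * j) mu.

(** The vector fields [X_n], and below the sections that they and the [mu_n] define
    over the twistor space, as homogeneous polynomials in the coordinates of
    the twistor line: this treats its two affine charts, hence also the points
    0 and infinity, at once. *)
Definition ham_vec (p : nat) : vfield A := fun a y =>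
  invmx (cmx (met hk a y)) *m (xi p a y)^T.

Definition hom_sum (V : lmodType C) (N : nat) (F : nat -> V) (st : C * C) : V :=
  \sum_(p < N.+1) (st.1 ^+ p * st.2 ^+ (N - p)) *: F p.

Definition ham_hom (st : C * C) : vfield A := fun a y =>
  hom_sum (2 * i) (fun p => ham_vec p a y) st.

Definition sec_TF : tw_vfield A := fun b z a y =>
  proj10 hk b z a y (ham_hom (hom_pt b z) a y).

Definition sec_O : tw_fun R M := fun b z x =>
  hom_sum (V := C^o) (2 * j) (fun p => phi p x) (hom_pt b z).

(** Homogeneity: [(1, z) = z (1/z, 1)]. *)
Lemma hom_sum_transition (V : lmodType C) N (F : nat -> V) z : z != 0 ->
  hom_sum N F (1, z) = z ^+ N *: hom_sum N F (z^-1, 1).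
Proof.
move=> z0; rewrite /hom_sum scaler_sumr; apply: eq_bigr => -[p /= pN] _.
rewrite scalerA !expr1n mul1r mulr1; congr (_ *: _).
by rewrite exprVn expfB_cond// (negPf z0).
Qed.

Lemma hom_sum_laurent (V : lmodType C) k (F : nat -> V) z (c : int -> V) : z != 0 ->
  (forall p, (p <= 2 * k)%N -> c (p%:Z - k%:Z) = F p) ->
  laurent k c z = z ^- k *: hom_sum (2 * k) F (1, z).
Proof.
move=> z0 cF; rewrite /laurent /hom_sum scaler_sumr; apply: eq_bigr => -[p /= pN] _.
rewrite cF// scalerA expr1n mul1r; congr (_ *: _).
have -> : k%:Z - p%:Z = (2 * k - p)%N%:Z - k%:Z by lia.
by rewrite expfzDr// mulrC exprnN.
Qed.

Lemma component_index (V : lmodType C) k (T : seq 'I_2 -> V) p : (p <= 2 * k)%N ->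
  component k T (p%:Z - k%:Z) =
  (sgn k p * 'C(2 * k, p)%:R) *: T (zeros_ones (2 * k) p).
Proof.
move=> pk; rewrite /component.
have -> : (`|p%:Z - k%:Z| <= k)%N by lia.
have -> : absz (k%:Z + (p%:Z - k%:Z)) = p by lia.
by have -> : absz (k%:Z - (p%:Z - k%:Z))%R = (2 * k - p)%N by lia.
Qed.

Lemma X_compE p a y : img a y -> (p <= 2 * i)%N ->
  X_comp hk j mu (p%:Z - i%:Z) a y = ham_vec p a y.
Proof.
move=> hy pi; rewrite /X_comp /= component_index// killing_vecE//; last exact: size_zeros_ones.
apply: etrans (scalemxAr _ _ _) _; congr (_ *m _); exact/esym/trmxZ.
Qed.

Lemma X_ofE z a y : img a y -> z != 0 ->
  X_of hk j mu z a y = z ^- i *: ham_hom (1, z) a y.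
Proof. by move=> hy z0; apply: hom_sum_laurent => // p pi; exact: X_compE. Qed.

Lemma mu_compE p x : (p <= 2 * j)%N -> mu_comp j mu (p%:Z - j%:Z) x = phi p x.
Proof. by move=> pj; rewrite /mu_comp component_index. Qed.

Lemma mu_ofE z x : z != 0 -> mu_of j mu z x = z ^- j * sec_O false z x.
Proof. by move=> z0; apply: hom_sum_laurent => // p pj; exact: mu_compE. Qed.

Lemma mu_comp_pos l : (- j%:Z <= l)%R -> mu_comp j mu l = phi (absz (j%:Z + l)).
Proof.
move=> jl; apply/funext => x; have [lj|lj] := leqP (absz (j%:Z + l)) (2 * j).
  by rewrite -mu_compE//; congr mu_comp; lia.
rewrite phi_out// /mu_comp /component.
by have -> : (`|l| <= j)%N = false by lia.
Qed.

Lemma mu_comp_neg l : (l < - j%:Z)%R -> mu_comp j mu l = cst 0.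
Proof.
move=> jl; apply/funext => x; rewrite /mu_comp /component.
by have -> : (`|l| <= j)%N = false by lia.
Qed.

Lemma mu_comp_recursive : inhabited M -> recursive_chain hk setT (mu_comp j mu).
Proof.
move=> M0; split=> [||l|l a y]; [exact: openT|by case: M0 => x; exists x| |].
  have [lj|lj] := leP (- j%:Z) l; first by rewrite mu_comp_pos//; exact: phi_smooth hmu _.
  by rewrite mu_comp_neg// => a; exact: csmooth_cst.
rewrite setIT => hy; have [r0 r1 r2] := phi_recursion hmu hy.
have d0 : dfun (cst 0 : M -> C) a y = 0 by apply/rowP => k; rewrite !mxE; exact: cD_cst.
have [l1|l1] := leP (- j%:Z) (l - 1).
  rewrite !mu_comp_pos; try lia.
  have -> : absz (j%:Z + l) = (absz (j%:Z + (l - 1))).+1 by lia.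
  have -> : absz (j%:Z + (l + 1)) = (absz (j%:Z + (l - 1))).+2 by lia.
  exact: r2.
have -> := mu_comp_neg l1; rewrite d0 (mul0mx _ (I_plus hk a y)) add0r.
have [l2|l2] := leP (- j%:Z) l.
  have -> : l = - j%:Z by lia.
  rewrite !mu_comp_pos; try lia.
  have -> : absz (j%:Z + - j%:Z)%R = 0%N by lia.
  have -> : absz (j%:Z + (- j%:Z + 1))%R = 1%N by lia.
  exact: r1.
have -> := mu_comp_neg l2; rewrite d0 (mul0mx _ (I_zero hk a y)) add0r.
have [l3|l3] := leP (- j%:Z) (l + 1).
  rewrite mu_comp_pos//; have -> : absz (j%:Z + (l + 1))%R = 0%N by lia.
  exact: r0.
by have -> := mu_comp_neg l3; rewrite d0 mul0mx.
Qed.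

Lemma mu_comp_bounded : bounded_chain (mu_comp j mu).
Proof.
exists j => l jl; apply/funext => x; rewrite /mu_comp /component.
by have -> : (`|l| <= j)%N = false by lia.
Qed.

Lemma ham_vec_met p a y : img a y -> (ham_vec p a y)^T *m cmx (met hk a y) = xi p a y.
Proof.
move=> hy; rewrite /ham_vec trmx_mul trmxK trmx_inv met_csym// mulmxKV//.
exact: met_cunit.
Qed.

Lemma dfun_sec_O b z (a : chart A) y : img a y ->
  dfun (sec_O b z) a y = \sum_(p < (2 * j).+1)
    ((hom_pt b z).1 ^+ p * (hom_pt b z).2 ^+ (2 * j - p)) *: dfun (phi p) a y.
Proof.
move=> hy; have oU := @img_open _ _ _ A a.
have ps (p : 'I_(2 * j).+1) : csmooth_on (img a) (phi p \o crd_inv a).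
  by have := phi_smooth hmu p a; rewrite setIT.
apply/rowP => k; rewrite mxE summxE.
rewrite -[LHS]/(cD (delta_mx k 0) (fun x => \sum_(p < (2 * j).+1)
  ((hom_pt b z).1 ^+ p * (hom_pt b z).2 ^+ (2 * j - p)) * (phi p \o crd_inv a) x) y).
rewrite (cD_sum oU)//.
  by apply: eq_bigr => p _; rewrite (cDZ oU _ _ (ps p) hy) !mxE.
by move=> p; apply: (csmoothM oU) => //; exact: csmooth_cst.
Qed.

Lemma ham_hom_omega b z a y : img a y ->
  (ham_hom (hom_pt b z) a y)^T *m tw_omega hk b z a y = dfun (sec_O b z) a y.
Proof.
move=> hy; rewrite tw_omegaE dfun_sec_O// -(hamilton_hom hmu hy) mulmxA.
congr (_ *m _); rewrite /ham_hom /hom_sum linear_sum mulmx_suml.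
by apply: eq_bigr => p _; rewrite /= trmxZ -scalemxAl ham_vec_met.
Qed.

Lemma sec_TF_omega b z a y : img a y ->
  (sec_TF b z a y)^T *m tw_omega hk b z a y = dfun (sec_O b z) a y.
Proof. by move=> hy; rewrite /sec_TF proj10_omega// ham_hom_omega. Qed.

End Sections.

(** * Holomorphy along the twistor line *)

Section ZetaHolomorphic.
Context {R : realType} {m : nat}.
Local Notation C := R[i].
Local Notation n := (4 * m)%N.
Local Notation ZR := ('cV[R]_n * (R^o * R^o))%type.
Variable U : set ZR.
Hypothesis oU : open U.

Definition zeta_holo (f : ZR -> C) : Prop :=
  csmooth_on U f /\ forall t, U t -> D_zbar f t = 0.

Lemma zeta_holo_cst c : zeta_holo (fun _ => c).
Proof. by split; [exact: csmooth_cst|move=> t _; exact: zbar_cst]. Qed.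

Lemma zeta_holoM f g : zeta_holo f -> zeta_holo g -> zeta_holo (fun t => f t * g t).
Proof.
move=> [fs fz] [gs gz]; split; first exact: csmoothM.
by move=> t Ut; rewrite (zbarM oU fs gs Ut) fz// gz// mulr0 mul0r addr0.
Qed.

Lemma zeta_holo_sum N (F : 'I_N -> ZR -> C) : (forall k, zeta_holo (F k)) ->
  zeta_holo (fun t => \sum_k F k t).
Proof.
move=> Fh; split; first by apply: csmooth_sum => // k; case: (Fh k).
move=> t Ut; rewrite (zbar_sum oU (index_enum _) (fun k => (Fh k).1) Ut) big1// => k _.
by case: (Fh k) => _ ->.
Qed.

Lemma zeta_holo_zcX k : zeta_holo (fun t => (zc t) ^+ k).
Proof.
split; first by apply: csmoothX => //; exact: csmooth_zc.
by move=> t Ut; exact: (zbar_zcX oU).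
Qed.

Lemma zeta_holo_congr f g : (forall t, U t -> f t = g t) -> zeta_holo f -> zeta_holo g.
Proof.
move=> fg [fs fz]; split; first exact: csmooth_congr fg fs.
by move=> t Ut; rewrite -(zbar_congr oU fg Ut) fz.
Qed.

Lemma zeta_holo_hom_pt b p q :
  zeta_holo (fun t => (hom_pt b (zc t)).1 ^+ p * (hom_pt b (zc t)).2 ^+ q).
Proof.
by case: b; apply: zeta_holo_congr; [|exact: (zeta_holoM (zeta_holo_zcX p) (zeta_holo_cst (1 ^+ q)))|
  |exact: (zeta_holoM (zeta_holo_cst (1 ^+ p)) (zeta_holo_zcX q))].
Qed.

End ZetaHolomorphic.

Section Twistor.
Context {R : realType} {m : nat} {M : topologicalType}.
Context {A : smooth_atlas R (4 * m) M}.
Variable hk : hyperkahler A.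
Local Notation C := R[i].
Local Notation n := (4 * m)%N.
Local Notation ZR := ('cV[R]_n * (R^o * R^o))%type.

Lemma open_Zimg (a : chart A) : open (@Zimg R m M A a).
Proof. exact: (open_fst (W := (R^o * R^o)%type) (@img_open _ _ _ A a)). Qed.

Lemma zeta_holo_fst (a : chart A) (f : 'cV[R]_n -> C) : csmooth_on (img a) f ->
  zeta_holo (@Zimg R m M A a) (fun t => f t.1).
Proof.
move=> fs; split; first exact: (csmooth_fst (W := (R^o * R^o)%type) fs).
by move=> t _; exact: zbar_fst.
Qed.

Lemma csmooth_mx_fst p q (a : chart A) (F : 'cV[R]_n -> 'M[C]_(p, q)) :
  csmooth_mx_on (img a) F -> csmooth_mx_on (@Zimg R m M A a) (fun t => F t.1).
Proof. by move=> Fs k l; exact: (csmooth_fst (W := (R^o * R^o)%type) (Fs k l)). Qed.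

(** The coefficients of the form are quadratic polynomials in the coordinate of
    the twistor line. *)
Lemma tw_omega_zeta_holo b (a : chart A) p q :
  zeta_holo (@Zimg R m M A a) (fun t => tw_omega hk b (zc t) a t.1 p q).
Proof.
have oU := @open_Zimg a.
have co r : zeta_holo (@Zimg R m M A a) (fun t => omega_coef b (zc t) r).
  have comb (x x' x'' : C) : zeta_holo (@Zimg R m M A a) (fun t => \sum_(k < 3)
     (if k == 0 then x else if k == 1 then x' else x'') *
     ((hom_pt b (zc t)).1 ^+ (2 - k) * (hom_pt b (zc t)).2 ^+ k)).
    apply: (zeta_holo_sum oU) => k; apply: (zeta_holoM oU); first exact: zeta_holo_cst.
    exact: (zeta_holo_hom_pt oU).
  move: r; apply: ord3P.
  - apply: (zeta_holo_congr oU _ (comb 2^-1 0 (- 2^-1))) => t _.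
    rewrite sum3 /omega_coef; case: (hom_pt b (zc t)) => x y /=.
    by rewrite !expr0; ring.
  - apply: (zeta_holo_congr oU _ (comb ('i / 2) 0 ('i / 2))) => t _.
    rewrite sum3 /omega_coef; case: (hom_pt b (zc t)) => x y /=.
    by rewrite !expr0; ring.
  - apply: (zeta_holo_congr oU _ (comb 0 1 0)) => t _.
    rewrite sum3 /omega_coef; case: (hom_pt b (zc t)) => x y /=.
    by rewrite !expr1; ring.
apply: (zeta_holo_congr oU (f := fun t => \sum_r omega_coef b (zc t) r * omega_k hk r a t.1 p q)).
  by move=> t _; rewrite tw_omega_kE summxE; apply: eq_bigr => r _; rewrite [RHS]mxE.
apply: (zeta_holo_sum oU) => r; apply: (zeta_holoM oU) => //.
exact: (@zeta_holo_fst a _ (@omega_k_csmooth _ _ _ _ hk a r p q)).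
Qed.

Lemma sphere_pt_csmooth b (a : chart A) r :
  csmooth_on (@Zimg R m M A a) (fun t => (sphere_pt b (zc t) 0 r)%:C).
Proof.
have oU := @open_Zimg a; have [ps qs] := @csmooth_zc R m _ oU.
apply: csmooth_real.
pose p (t : ZR) : R^o := complex.Re (zc t); pose q (t : ZR) : R^o := complex.Im (zc t).
pose s t : R^o := p t * p t + q t * q t.
have ss : smooth_on (@Zimg R m M A a) s by apply: (smoothD oU); exact: (smoothM oU).
have cs (x : R) := @smooth_cst R _ (@Zimg R m M A a) R^o x.
have vs : smooth_on (@Zimg R m M A a) (fun t => (1 + s t)^-1 : R^o).
  apply: (smoothV oU (f := fun t => 1 + s t : R^o)); last exact: (smoothD oU (cs 1) ss).
  by move=> t _; rewrite gt_eqF// ltr_pwDl// addr_ge0// -expr2 sqr_ge0.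
have fin (k : 'I_3) (f : ZR -> R^o) : smooth_on (@Zimg R m M A a) f ->
    (forall t, sphere_pt b (zc t) 0 k = (1 + s t)^-1 * f t) ->
    smooth_on (@Zimg R m M A a) (fun t => sphere_pt b (zc t) 0 k : R^o).
  by move=> fs E; apply: (smooth_congr oU _ (smoothM oU vs fs)) => t _; rewrite E.
have lin (f : ZR -> R^o) (x : R) (fs : smooth_on (@Zimg R m M A a) f) := smoothM oU (cs x) fs.
have aff (x x' : R) : smooth_on (@Zimg R m M A a) (fun t => x + x' * s t : R^o).
  exact: (smoothD oU (cs x) (lin _ x' ss)).
move: r; apply: ord3P.
- apply: (fin _ _ (lin _ (-2) ps)) => t.
  by rewrite /sphere_pt !mxE /= /s /p /q /= -!expr2 mulNr.
- apply: (fin _ _ (lin _ (if b then 2 else -2) qs)) => t.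
  by rewrite /sphere_pt !mxE /= /s /p /q /= -!expr2; case: (b) => //; rewrite mulNr.
- apply: (fin _ _ (aff (if b then -1 else 1) (if b then 1 else -1))) => t.
  rewrite /sphere_pt !mxE /= /s /p /q /= -!expr2.
  by case: (b); rewrite ?mul1r ?mulN1r// [-1 + _]addrC.
Qed.

End Twistor.

(** * Smoothness and gluing of the sections *)

Section HamiltonianSections.
Context {R : realType} {m : nat} {M : topologicalType}.
Context {A : smooth_atlas R (4 * m) M}.
Variable hk : hyperkahler A.
Local Notation C := R[i].
Local Notation n := (4 * m)%N.
Local Notation ZR := ('cV[R]_n * (R^o * R^o))%type.
Variables (i : nat) (mu : Htensor R M).
Local Notation j := i.+1.
Hypothesis hmu : killing_tensor hk (2 * j) mu.
Local Notation ham_vec := (ham_vec hk i mu).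
Local Notation ham_hom := (ham_hom hk i mu).
Local Notation sec_TF := (sec_TF hk i mu).
Local Notation sec_O := (sec_O i mu).

Lemma cmx_I_sphere u (a : chart A) y :
  cmx (I_sphere hk u a y) = \sum_r (u 0 r)%:C *: cmx (cpx hk r a y).
Proof.
by rewrite /I_sphere /cmx raddf_sum; apply: eq_bigr => r _; rewrite /= map_mxZ.
Qed.

Lemma dfun_csmooth (f : M -> C) (a : chart A) : csmooth_fun_on A setT f ->
  csmooth_mx_on (img a) (dfun f a).
Proof.
move=> /(_ a); rewrite setIT => fs p q.
apply: (csmooth_congr (@img_open _ _ _ A a) _ (csmooth_cD (delta_mx q 0) fs)) => y _.
by rewrite mxE.
Qed.

Lemma I_csmooth (a : chart A) :
  [/\ csmooth_mx_on (img a) (I_plus hk a), csmooth_mx_on (img a) (I_zero hk a) &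
      csmooth_mx_on (img a) (I_minus hk a)].
Proof.
have oU := @img_open _ _ _ A a.
have cs c := @csmooth_cst R _ (img a) c.
have ks r : csmooth_mx_on (img a) (fun y => cmx (cpx hk r a y)) := @cpx_csmooth _ _ _ _ hk a r.
split; first 2 last.
- apply: (csmooth_mx_congr oU _ (csmooth_mxZ oU (cs (- 2^-1))
    (csmooth_mxD oU (ks 0) (csmooth_mxZ oU (cs (- 'i)) (ks 1))))) => y _.
  by rewrite /I_minus scaleNr [in RHS]/(_ - _) scaleNr.
- apply: (csmooth_mx_congr oU _ (csmooth_mxZ oU (cs 2^-1)
    (csmooth_mxD oU (ks 0) (csmooth_mxZ oU (cs 'i) (ks 1))))) => y _.
  by [].
- exact: ks.
Qed.

Lemma ham_vec_csmooth p (a : chart A) : (p <= 2 * i)%N ->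
  csmooth_mx_on (img a) (ham_vec p a).
Proof.
move=> pi; have oU := @img_open _ _ _ A a.
have cs c := @csmooth_cst R _ (img a) c.
have [ps zs ms] := I_csmooth a.
have st : size (zeros_ones (2 * i) p) = (2 * i)%N by exact: size_zeros_ones.
have ds x x' : csmooth_mx_on (img a) (dfun (mu (x :: x' :: zeros_ones (2 * i) p)) a).
  by apply: dfun_csmooth; apply: (mu_smooth hmu); rewrite /= st; lia.
apply: (csmooth_mulmx oU); first exact: met_inv_csmooth.
apply: (csmooth_mx_tr oU); apply: (csmooth_mxZ oU); first exact: cs.
apply: (csmooth_mxZ oU); first exact: cs.
by apply: (csmooth_mxD oU); [apply: (csmooth_mxD oU)|]; apply: (csmooth_mulmx oU).
Qed.

Lemma ham_hom_zeta_csmooth b (a : chart A) :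
  csmooth_mx_on (@Zimg R m M A a) (fun t => ham_hom (hom_pt b (zc t)) a t.1).
Proof.
have oU := @open_Zimg _ _ _ A a.
apply: (csmooth_mx_sum oU) => -[p pi]; apply: (csmooth_mxZ oU).
  exact: (zeta_holo_hom_pt oU b p (2 * i - p)).1.
apply: csmooth_mx_fst; exact: ham_vec_csmooth.
Qed.

Lemma sec_TF_csmooth b (a : chart A) :
  csmooth_mx_on (@Zimg R m M A a) (vfield_coord sec_TF b a).
Proof.
have oU := @open_Zimg _ _ _ A a.
have cs c := @csmooth_cst R _ (@Zimg R m M A a) c.
have hs := ham_hom_zeta_csmooth b a.
have Is : csmooth_mx_on (@Zimg R m M A a)
    (fun t => cmx (I_sphere hk (sphere_pt b (zc t)) a t.1)).
  apply: (csmooth_mx_congr oU (F := fun t => \sum_r (sphere_pt b (zc t) 0 r)%:C *: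
     cmx (cpx hk r a t.1))).
    by move=> t _; rewrite cmx_I_sphere.
  apply: (csmooth_mx_sum oU) => r; apply: (csmooth_mxZ oU); first exact: sphere_pt_csmooth.
  exact: (@csmooth_mx_fst _ _ _ _ _ _ a _ (@cpx_csmooth _ _ _ _ hk a r)).
apply: (csmooth_mx_congr oU _ (csmooth_mxZ oU (cs 2^-1) (csmooth_mxD oU hs
   (csmooth_mxZ oU (cs (- 'i)) (csmooth_mulmx oU Is hs))))) => t _.
by rewrite /vfield_coord /sec_TF proj10E scaleNr.
Qed.

Lemma sec_TF_csmooth_fiber b z (a : chart A) : csmooth_mx_on (img a) (sec_TF b z a).
Proof.
move=> p q; case: z => x y.
exact: (csmooth_slice ((x, y) : R^o * R^o) (sec_TF_csmooth b a p q)).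
Qed.

Lemma X_of_csmooth z (a : chart A) : z != 0 ->
  csmooth_mx_on (img a) (X_of hk j mu z a).
Proof.
move=> z0; have oU := @img_open _ _ _ A a.
apply: (csmooth_mx_congr oU (F := fun y => z ^- i *: ham_hom (1, z) a y)).
  by move=> y hy; rewrite (X_ofE hmu).
apply: (csmooth_mxZ oU); first exact: csmooth_cst.
apply: (csmooth_mx_sum oU) => -[p pi]; apply: (csmooth_mxZ oU); first exact: csmooth_cst.
exact: ham_vec_csmooth.
Qed.

Lemma sec_O_zeta_holo b (a : chart A) :
  zeta_holo (@Zimg R m M A a) (fun_coord sec_O b a).
Proof.
have oU := @open_Zimg _ _ _ A a.
apply: (zeta_holo_sum oU) => p; apply: (zeta_holoM oU).
  exact: (zeta_holo_hom_pt oU b p (2 * j - p)).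
apply: (zeta_holo_fst (f := phi i mu p \o crd_inv a)).
by have := phi_smooth hmu p a; rewrite setIT.
Qed.

Lemma sec_O_csmooth_fiber b z (a : chart A) : csmooth_on (img a) (sec_O b z \o crd_inv a).
Proof.
case: z => x y.
exact: (csmooth_slice ((x, y) : R^o * R^o) (sec_O_zeta_holo b a).1).
Qed.

Lemma mu_of_csmooth z (a : chart A) : z != 0 -> csmooth_on (img a) (mu_of j mu z \o crd_inv a).
Proof.
move=> z0; have oU := @img_open _ _ _ A a.
apply: (csmooth_congr oU _ (csmoothM oU (csmooth_cst _ (z ^- j)) (sec_O_csmooth_fiber false z a))).
by move=> y _; rewrite /= mu_ofE.
Qed.

Section Compat.
Variables (a b : chart A) (y : 'cV[R]_n).
Hypothesis oy : overlap a b y.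
Local Notation y' := (trans a b y).
Local Notation Jc := (cmx (jac a b y)).

Lemma overlap_img : img a y /\ img b y'.
Proof.
case: oy => x [xa xb] <-; split; first by exists x.
by exists x => //; rewrite /trans /= crdK.
Qed.

Lemma cpx_ctrans r : cmx (cpx hk r b y') *m Jc = Jc *m cmx (cpx hk r a y).
Proof. by rewrite -!map_mxM cpx_compat. Qed.

Lemma met_ctrans : cmx (met hk a y) = Jc^T *m cmx (met hk b y') *m Jc.
Proof. by rewrite map_trmx -!map_mxM -met_compat. Qed.

(** Both [G] and [J^T G' J], to which it is equal, are invertible. *)
Lemma jac_unit : Jc \in unitmx.
Proof.
have [hy _] := overlap_img.
have : Jc^T *m (cmx (met hk b y') *m Jc) \in unitmx by rewrite mulmxA -met_ctrans met_cunit.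
by rewrite !unitmx_mul => /and3P[].
Qed.

Lemma I_trans : (I_plus hk b y' *m Jc = Jc *m I_plus hk a y) *
  (I_zero hk b y' *m Jc = Jc *m I_zero hk a y) *
  (I_minus hk b y' *m Jc = Jc *m I_minus hk a y).
Proof.
have lc (c w : C) (X0 X1 Y0 Y1 J : 'M[C]_n) : X0 *m J = J *m Y0 -> X1 *m J = J *m Y1 ->
    (c *: (X0 + w *: X1)) *m J = J *m (c *: (Y0 + w *: Y1)).
  by move=> h0 h1; rewrite -scalemxAl mulmxDl -scalemxAl h0 h1 -scalemxAr mulmxDr -scalemxAr.
have h0 := cpx_ctrans 0; have h1 := cpx_ctrans 1; have h2 := cpx_ctrans 2.
split; [split|] => //; first exact: lc.
rewrite /I_minus mulNmx mulmxN -!scaleNr; congr (- _).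
exact: lc.
Qed.

Lemma xi_trans p : (p <= 2 * i)%N -> xi hk i mu p b y' *m Jc = xi hk i mu p a y.
Proof.
move=> pi; rewrite /xi /killing_form -!scalemxAl !mulmxDl -!mulmxA !I_trans !mulmxA.
have st : size (zeros_ones (2 * i) p) = (2 * i)%N by exact: size_zeros_ones.
by rewrite -!dfun_trans//; apply: (mu_smooth hmu); rewrite /= st; lia.
Qed.

(** The covectors glue, and the metric, which is compatible with the change of
    charts, converts them into vectors. *)
Lemma ham_vec_trans p : (p <= 2 * i)%N -> ham_vec p b y' = Jc *m ham_vec p a y.
Proof.
move=> pi; have [hy hy'] := overlap_img.
have JT : Jc^T \in unitmx by rewrite unitmx_tr jac_unit.
apply: (can_inj (mulKmx (met_cunit hk hy'))).
apply: (can_inj (mulKmx JT)).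
have e1 : cmx (met hk b y') *m ham_vec p b y' = (xi hk i mu p b y')^T.
  exact: (mulKVmx (met_cunit hk hy')).
have e3 : cmx (met hk a y) *m ham_vec p a y = (xi hk i mu p a y)^T.
  exact: (mulKVmx (met_cunit hk hy)).
have e2 (v : 'cV[C]_n) : Jc^T *m (cmx (met hk b y') *m (Jc *m v)) = cmx (met hk a y) *m v.
  by rewrite met_ctrans !mulmxA.
apply: etrans (esym (e2 (ham_vec p a y))); rewrite e3 -(xi_trans pi) trmx_mul.
exact: (congr1 (mulmx Jc^T) e1).
Qed.

Lemma sec_TF_trans c z : sec_TF c z b y' = Jc *m sec_TF c z a y.
Proof.
have hE : ham_hom (hom_pt c z) b y' = Jc *m ham_hom (hom_pt c z) a y.
  rewrite /ham_hom /hom_sum mulmx_sumr; apply: eq_bigr => -[p /= pi] _.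
  by rewrite ham_vec_trans// scalemxAr.
have IE : cmx (I_sphere hk (sphere_pt c z) b y') *m Jc =
    Jc *m cmx (I_sphere hk (sphere_pt c z) a y).
  rewrite !cmx_I_sphere mulmx_suml mulmx_sumr; apply: eq_bigr => r _.
  by rewrite -scalemxAl -scalemxAr cpx_ctrans.
rewrite /sec_TF !proj10E hE mulmxA IE -scalemxAr; congr (_ *: _).
by rewrite mulmxBr -scalemxAr mulmxA.
Qed.

End Compat.
End HamiltonianSections.

(** * Holomorphic global sections *)

Section GlobalSections.
Context {R : realType} {m : nat} {M : topologicalType}.
Context {A : smooth_atlas R (4 * m) M}.
Variable hk : hyperkahler A.
Local Notation C := R[i].
Local Notation n := (4 * m)%N.
Local Notation ZR := ('cV[R]_n * (R^o * R^o))%type.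
Variables (i : nat) (mu : Htensor R M).
Local Notation j := i.+1.
Hypothesis hmu : killing_tensor hk (2 * j) mu.
Local Notation ham_vec := (ham_vec hk i mu).
Local Notation ham_hom := (ham_hom hk i mu).
Local Notation sec_TF := (sec_TF hk i mu).
Local Notation sec_O := (sec_O i mu).
Local Notation Zi a := (@Zimg R m M A a).

Lemma cD_fiber_sec_O b (a : chart A) k (t : ZR) :
  cD ((delta_mx k 0, (0, 0)) : ZR) (fun_coord sec_O b a) t =
  dfun (sec_O b (zc t)) a t.1 0 k.
Proof. by rewrite mxE; exact: (cD_slice (fun_coord sec_O b a)). Qed.

(** [dh w = (i_S Omega) w], and [w] lies in the kernel of [Omega]. *)
Lemma sec_O_vertical b (a : chart A) (t : ZR) w : Zi a t ->
  type01 hk b (zc t) a t.1 w -> D_fiber w (fun_coord sec_O b a) t = 0.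
Proof.
move=> ht tw; transitivity ((dfun (sec_O b (zc t)) a t.1 *m w) 0 0).
  by rewrite mxE; apply: eq_bigr => k _; rewrite cD_fiber_sec_O mulrC.
have Ow : tw_omega hk b (zc t) a t.1 *m w = 0.
  apply: trmx_inj; rewrite trmx_mul tw_omega_alt// mulmxN.
  by have /(tw_omega_ker hk ht) -> := tw; rewrite oppr0 trmx0.
by rewrite -(sec_TF_omega hmu b (zc t) ht) -mulmxA Ow mulmx0 mxE.
Qed.

Lemma sec_O_holomorphic : holomorphic_fun hk sec_O.
Proof.
move=> b a; have [hs hz] := sec_O_zeta_holo hmu b a; split=> // t ht; split; last exact: hz.
by move=> w; exact: sec_O_vertical.
Qed.

(** Since the kernel of the canonical form consists of the vectors of type
    (0,1), this is [bracket_kernel] for that form. *)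
Lemma sec_TF_bracket b (a : chart A) (O : set ZR) w c :
  open O -> O `<=` Zi a -> csmooth_mx_on O w -> csmooth_on O c ->
  (forall t, O t -> type01 hk b (zc t) a t.1 (w t)) ->
  forall t, O t -> type01 hk b (zc t) a t.1 (bracket w c (vfield_coord sec_TF b a) t).
Proof.
move=> oO OZ ws cs w01 t Ot; have ht := OZ t Ot.
have sub (f : ZR -> C) : csmooth_on (Zi a) f -> csmooth_on O f by exact: csmooth_sub.
have zO (f : ZR -> C) : zeta_holo (Zi a) f -> D_zbar f t = 0 by case=> _; apply.
have [hs _] := sec_O_zeta_holo hmu b a.
have oZ := @open_Zimg _ _ _ A a.
apply/(tw_omega_ker hk ht).
apply: (@bracket_kernel _ _ O (fun t => tw_omega hk b (zc t) a t.1)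
  (vfield_coord sec_TF b a) w c (fun_coord sec_O b a)) => //.
- by move=> p q; apply: sub; case: (tw_omega_zeta_holo hk b a p q).
- by move=> p q; apply: sub; exact: (sec_TF_csmooth hmu).
- exact: sub.
- by move=> x Ox; rewrite tw_omega_alt//; exact: OZ.
- move=> p q r.
  have E k p' q' : cD ((delta_mx k 0, (0, 0)) : ZR) (fun x => tw_omega hk b (zc x) a x.1 p' q') t =
      cD (delta_mx k 0) (fun x => tw_omega hk b (zc t) a x p' q') t.1.
    exact: (cD_slice (fun x => tw_omega hk b (zc x) a x.1 p' q')).
  by rewrite !E; exact: tw_omega_closed.
- move=> x Ox; rewrite (sec_TF_omega hmu b (zc x) (OZ x Ox)); apply/rowP => k.
  by rewrite [RHS]mxE cD_fiber_sec_O.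
- by move=> x Ox; apply/(tw_omega_ker hk (OZ x Ox)); exact: w01.
- by move=> q r; apply: zO; exact: tw_omega_zeta_holo.
- move=> k; apply: zO.
  apply: (zeta_holo_congr oZ (f := fun x => \sum_(p < (2 * j).+1)
    ((hom_pt b (zc x)).1 ^+ p * (hom_pt b (zc x)).2 ^+ (2 * j - p)) *
    cD (delta_mx k 0) (phi i mu p \o crd_inv a) x.1)).
    move=> x hx; rewrite cD_fiber_sec_O (dfun_sec_O hmu)// summxE.
    by apply: eq_bigr => p _; rewrite [RHS]mxE [X in _ = _ * X]mxE.
  apply: (zeta_holo_sum oZ) => p; apply: (zeta_holoM oZ).
    exact: (zeta_holo_hom_pt oZ b p (2 * j - p)).
  apply: (zeta_holo_fst (f := fun y => cD (delta_mx k 0) (phi i mu p \o crd_inv a) y)).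
  by apply: csmooth_cD; have := phi_smooth hmu p a; rewrite setIT.
Qed.

(** The two descriptions of the sphere are related by the inversion. *)
Lemma sphere_pt_antipode (z : C) : z != 0 -> sphere_pt false z = sphere_pt true z^-1.
Proof.
case: z => p q z0; have s0 : p ^+ 2 + q ^+ 2 != 0.
  apply: contra z0; rewrite paddr_eq0 ?sqr_ge0// !sqrf_eq0 => /andP[/eqP-> /eqP->].
  by rewrite eq_complex /= !eqxx.
have h : 1 + (p ^+ 2 + q ^+ 2) != 0.
  by rewrite gt_eqF// ltr_pwDl// addr_ge0// sqr_ge0.
have N2 : (p / (p ^+ 2 + q ^+ 2)) ^+ 2 + (- (q / (p ^+ 2 + q ^+ 2))) ^+ 2 = (p ^+ 2 + q ^+ 2)^-1.
  by field.
have h' : 1 + (p ^+ 2 + q ^+ 2)^-1 != 0.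
  by rewrite gt_eqF// ltr_pwDl// invr_ge0 addr_ge0// sqr_ge0.
have -> : (p +i* q)^-1 = (p / (p ^+ 2 + q ^+ 2)) +i* (- (q / (p ^+ 2 + q ^+ 2))) by [].
rewrite /sphere_pt N2; apply/rowP => r; rewrite !mxE; move: r; apply: ord3P => /=; field; by rewrite s0 [_ + 1]addrC h.
Qed.

Lemma proj10Z b z (a : chart A) y (c : C) v :
  proj10 hk b z a y (c *: v) = c *: proj10 hk b z a y v.
Proof.
rewrite !proj10E -scalemxAr; move: (_ *m v) => w.
rewrite [RHS]scalerA [c * _]mulrC -[RHS]scalerA; congr (_ *: _).
by rewrite scalerBr !scalerA mulrC.
Qed.

Lemma sec_TF_transition z (a : chart A) y : z != 0 ->
  sec_TF false z a y = z ^+ (2 * i) *: sec_TF true z^-1 a y.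
Proof.
move=> z0; rewrite /sec_TF /ham_hom /hom_pt (hom_sum_transition _ _ z0) proj10Z.
by rewrite /proj10 (sphere_pt_antipode z0).
Qed.

Lemma sec_O_transition z x : z != 0 ->
  sec_O false z x = z ^+ (2 * j) * sec_O true z^-1 x.
Proof. by move=> z0; exact: (hom_sum_transition (V := C^o) (2 * j) (fun p => phi i mu p x) z0). Qed.

Lemma sec_TF_holomorphic : holomorphic_section_TF hk i sec_TF.
Proof.
split; last by move=> z a y z0 _; exact: sec_TF_transition.
split.
- by move=> b z a b' y oy; exact: sec_TF_trans.
- by move=> b a; exact: sec_TF_csmooth.
- by move=> b z a y hy; exact: type10_proj10.
- by move=> b a O w c oO OZ ws cs w01; exact: sec_TF_bracket.
Qed.

Lemma sec_TF_represented : vfield_represented hk i sec_TF (X_of hk j mu).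
Proof.
move=> z a y z0 hy; rewrite (X_ofE hmu hy z0) proj10Z scalerA.
by rewrite mulfV ?scale1r// expf_neq0.
Qed.

Lemma sec_O_represented : fun_represented j sec_O (mu_of j mu).
Proof. by move=> z x z0; rewrite mu_ofE// mulrA mulfV ?mul1r// expf_neq0. Qed.

Lemma sec_lie b z (a : chart A) y : img a y ->
  lie_form (sec_TF b z) (tw_omega hk b z) a y = 0.
Proof.
move=> hy; apply: (lie_form_hamiltonian (f := sec_O b z \o crd_inv a)) => //.
- exact: sec_TF_csmooth_fiber.
- exact: tw_omega_csmooth.
- exact: (sec_O_csmooth_fiber hmu).
- by move=> x hx; exact: tw_omega_alt.
- exact: tw_omega_closed.
- by move=> x hx; exact: sec_TF_omega.
Qed.

Lemma omegaE z (a : chart A) y : z != 0 ->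
  omega hk z a y = z^-1 *: tw_omega hk false z a y.
Proof.
move=> z0; rewrite /omega /tw_omega !scalerDr !scalerA expr2 mulrA mulVf// mul1r.
by rewrite scale1r.
Qed.

Lemma X_of_hamiltonian z (a : chart A) y : z != 0 -> img a y ->
  interior_prod (X_of hk j mu z) (omega hk z) a y = dfun (mu_of j mu z) a y.
Proof.
move=> z0 hy; rewrite /interior_prod (X_ofE hmu hy z0) omegaE// trmxZ -scalemxAl -scalemxAr.
rewrite -[(1, z)]/(hom_pt false z) (ham_hom_omega hmu)// scalerA.
have -> : mu_of j mu z = (fun x => z ^- j * sec_O false z x).
  by apply/funext => x; rewrite mu_ofE.
have -> : z ^- i * z^-1 = z ^- j by rewrite exprSr invfM mulrC.
apply/rowP => k; rewrite !mxE; apply/esym.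
exact: (cDZ (@img_open _ _ _ A a) (z ^- j) (delta_mx k 0) (sec_O_csmooth_fiber hmu false z a) hy).
Qed.

Lemma X_of_lie z (a : chart A) y : z != 0 -> img a y ->
  lie_form (X_of hk j mu z) (omega hk z) a y = 0.
Proof.
move=> z0 hy; have oU := @img_open _ _ _ A a.
have os : csmooth_mx_on (img a) (omega hk z a).
  apply: (csmooth_mx_congr oU (F := fun y => z^-1 *: tw_omega hk false z a y)).
    by move=> x _; rewrite omegaE.
  apply: (csmooth_mxZ oU); first exact: csmooth_cst.
  exact: tw_omega_csmooth.
apply: (lie_form_hamiltonian (f := mu_of j mu z \o crd_inv a)) => //.
- exact: X_of_csmooth.
- exact: (mu_of_csmooth hmu).
- by move=> x hx; rewrite omegaE// trmxZ tw_omega_alt// scalerN.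
- move=> p q r; have E k p' q' : cD (delta_mx k 0) (fun x => omega hk z a x p' q') y =
      z^-1 * cD (delta_mx k 0) (fun x => tw_omega hk false z a x p' q') y.
    rewrite -(cDZ oU _ _ (@tw_omega_csmooth _ _ _ _ hk false z a p' q') hy).
    by apply: (@cD_congr _ _ (img a) oU) => // x _; rewrite omegaE// mxE.
  by rewrite !E -!mulrDr tw_omega_closed// mulr0.
- by move=> x hx; exact: X_of_hamiltonian.
Qed.

End GlobalSections.

Theorem theorem24 (R : realType) (m : nat) (M : topologicalType)
    (A : smooth_atlas R (4 * m) M) (hk : hyperkahler A)
    (M_hausdorff : hausdorff_space M) (M_countable : @second_countable M)
    (M_simply_connected : simply_connected R M)
    (j : nat) (hj : (1 <= j)%N)
    (mu : Htensor R M) (hmu : killing_tensor hk (2 * j) mu) :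
  [/\ (* the coefficients of mu(zeta) form a bounded recursive chain *)
      recursive_chain hk setT (mu_comp j mu) /\ bounded_chain (mu_comp j mu),
      (* the displayed identities on the fibers over C^* *)
      (forall (z : R[i]) (a : chart A) y, z != 0 -> img a y ->
         lie_form (X_of hk j mu z) (omega hk z) a y = 0 /\
         interior_prod (X_of hk j mu z) (omega hk z) a y
           = dfun (mu_of j mu z) a y) &
      (* the global sections over the twistor space *)
      exists (S : tw_vfield A) (h : tw_fun R M),
        [/\ holomorphic_section_TF hk j.-1 S,
            vfield_represented hk j.-1 S (X_of hk j mu),
            holomorphic_section_O hk j h,
            fun_represented j h (mu_of j mu) &
            (* the same identities on all the fibers *)
            forall b (z : R[i]) (a : chart A) y, img a y ->
              lie_form (S b z) (tw_omega hk b z) a y = 0 /\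
              interior_prod (S b z) (tw_omega hk b z) a y = dfun (h b z) a y]].
Proof.
case: j hj hmu => [//|i] _ hmu; split.
- split; last exact: mu_comp_bounded.
  by case: M_simply_connected => M0 _ _; exact: (mu_comp_recursive hmu M0).
- by move=> z a y z0 hy; split; [exact: X_of_lie|exact: X_of_hamiltonian].
exists (sec_TF hk i mu), (sec_O i mu); split.
- exact: sec_TF_holomorphic.
- exact: sec_TF_represented.
- by split; [exact: sec_O_holomorphic|move=> z x z0; exact: sec_O_transition].
- exact: sec_O_represented.
- by move=> b z a y hy; split; [exact: sec_lie|exact: sec_TF_omega].
Qed.
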